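(* Assume Conditions (C1)–(C6). There exist $\delta_0\in(0,1/253]$ and constants $\delta_T>0$, $\kappa_T>0$ (with $\delta_0$ and $\delta_T$ sufficiently small), depending only on $\Lambda_{\tilde X,\min}$, $\Lambda_{h,\max}$, $K_X$, $K_g$, $J_h$, $A$ and $m$, such that whenever $\lambda,\mu,R>0$ satisfy $$\kappa_T\, n^{-\frac{2m}{2m+1}}\le \mu^2\le \frac{\delta_0R^2}{2\,(1+J(g^0)+J_h)^2},\quad R^2\le\lambda\le 1,\quad \frac{4\lambda^2 s_0}{\Lambda_{\tilde X,\min}^2}\le \delta_0R^2,\quad \lambda\ge \frac{\sqrt{2\log(2p)/n}}{\delta_T},\quad 1+\frac{\Lambda_{h,\max}}{\Lambda_{\tilde X,\min}}\le \mu^{-1},$$ then with probability at least $1-2/p-6\exp(-n\delta_T^2\mu^2)$, every minimizer $(\hat\beta,\hat g)$ of the doubly penalised least squares criterion satisfies $$\|\tilde X(\hat\beta-\beta^0)\|_n^2+\frac{\lambda}{4}\|\hat\beta-\beta^0\|_1\le \frac{s_0\lambda^2}{\Lambda_{\tilde X,\min}^2}.$$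
   Context: Setting. Let $(x,z)$ be a random vector with $x\in\mathbb R^p$ (a row vector) and $z\in\mathbb R^d$, joint distribution $Q$ and marginal $Q_z$ of $z$; let $(x_i,z_i)$, $i=1,\dots,n$, be i.i.d. copies of $(x,z)$, let $X$ be the $n\times p$ matrix with rows $x_i$, entries $X_{ij}$ and columns $X_j$. Let $\mathcal G$ be a linear subspace of $L_2(Q_z)$ equipped with a semi-inner product $J(\cdot,\cdot)$ with associated seminorm $J(\cdot)$. Fix $\beta^0\in\mathbb R^p$, $g^0\in\mathcal G$; $S_0=\{j:\beta^0_j\neq 0\}$, $s_0=|S_0|$. The responses are $Y=X\beta^0+g^0(Z)+E\in\mathbb R^n$, where $g(Z)=(g(z_1),\dots,g(z_n))^T$ and $E=(e_1,\dots,e_n)^T$. For a function $f$ of $(x,z)$: $\|f\|^2=\mathbb E f(x,z)^2$, $\|f\|_n^2=\frac1n\sum_{i=1}^n f(x_i,z_i)^2$, $\|f\|_\infty=\sup|f|$; for $v\in\mathbb R^n$, $\|v\|_n^2=v^Tv/n$. Let $h(z)=\mathbb E[x\mid z]\in\mathbb R^p$ with components $h_j$, $\tilde x=x-h(z)$; $h$ and $\tilde X$ also denote the $n\times p$ matrices with rows $h(z_i)$ and $\tilde x_i=x_i-h(z_i)$. $\Lambda_{\tilde X,\min}^2$ is the smallest eigenvalue of $\mathbb E[\tilde X^T\tilde X]/n=\mathbb E[\tilde x^T\tilde x]$ and $\Lambda_{h,\max}^2$ the largest eigenvalue of $\mathbb E[h^Th]/n$. Estimator: for $\lambda,\mu>0$,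 $(\hat\beta,\hat g)$ is a minimizer over $\mathbb R^p\times\mathcal G$ of $\|Y-X\beta-g(Z)\|_n^2+\lambda\|\beta\|_1+\mu^2J^2(g)$. Conditions. (C1) $e_1,\dots,e_n$ are i.i.d. $N(0,1)$, independent of $\{(x_i,z_i)\}$. (C2) $\max_{i,j}|X_{ij}|\le K_X$ for a constant $K_X$. (C3) $\Lambda_{\tilde X,\min}>0$ and $\Lambda_{h,\max}<\infty$. (C4) For constants $A>0$ and $m>1/2$: $\mathcal H(u,\{g\in\mathcal G:\|g\|\le1,J(g)\le1\},\|\cdot\|_\infty)\le Au^{-1/m}$ for all $u>0$, where for a class $\mathcal C$, $\mathcal H(u,\mathcal C,\|\cdot\|_\infty)=\log N$ with $N$ the smallest cardinality of a set $G\subset\mathcal G$ such that every element of $\mathcal C$ lies within $\|\cdot\|_\infty$-distance $u$ of some element of $G$. (C5) $\sup\{\|g\|_\infty: g\in\mathcal G,\|g\|\le1,J(g)\le1\}\le K_g$ for a constant $K_g$. (C6) $h_j\in\mathcal G$ and $J(h_j)\le J_h$ for all $j$, for a constant $J_h$. *)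

(* Defs.v *)
From HB Require Import structures.
From mathcomp Require Import all_boot all_order all_algebra.
From mathcomp Require Import all_classical all_reals all_analysis.
Unset Printing Implicit Defensive.
Import Order.TTheory GRing.Theory Num.Theory.
Local Open Scope classical_set_scope.
Local Open Scope ring_scope.

(* R^k as a measurable space: row vectors 'rV[R]_k with the Borel      *)
(* sigma-algebra, i.e. the one generated by the coordinate maps        *)
(* (the product Borel sigma-algebra, equal to Borel(R^k)).             *)
Definition vecR (R : realType) (k : nat) : Type := 'rV[R]_k.
HB.instance Definition _ (R : realType) (k : nat) := Choice.on (vecR R k).
Definition vecR0 (R : realType) (k : nat) : vecR R k := (0 : 'rV[R]_k).
(* a default point, needed only to build the measurable structure *)
HB.instance Definition _ (R : realType) (k : nat) :=
  isPointed.Build (vecR R k) (vecR0 R k).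

Definition coord_gen (R : realType) (k : nat) : set (set (vecR R k)) :=
  fun A => exists (j : 'I_k) (B : set R),
      measurable B /\ A = (fun v : vecR R k => (v : 'rV[R]_k) ord0 j) @^-1` B.

Notation Rvec R k := (g_sigma_algebraType (coord_gen R k)).

Notation obs R p d := (Rvec R p * Rvec R d)%type.

(* Mutual independence of the 2n random elements U_1..U_n, V_1..V_n
   (product rule; taking some A i / B i = setT gives every subfamily). *)
Definition mutually_indep2 {R : realType} {dO d1 d2 : measure_display}
  {Om : measurableType dO} {T1 : measurableType d1} {T2 : measurableType d2}
  (P : probability Om R) (n : nat) (U : 'I_n -> Om -> T1) (V : 'I_n -> Om -> T2)
  : Prop :=
  forall (A : 'I_n -> set T1) (B : 'I_n -> set T2),
    (forall i, measurable (A i)) -> (forall i, measurable (B i)) ->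
    P [set w | forall i, A i (U i w) /\ B i (V i w)] =
    ((\prod_(i < n) fine (P (U i @^-1` A i))) *
     (\prod_(i < n) fine (P (V i @^-1` B i))))%:E.

Definition L2norm {R : realType} {p d : nat} (Q : probability (obs R p d) R)
  (g : Rvec R d -> R) : R :=
  Num.sqrt (fine (\int[Q]_w ((g w.2) ^+ 2)%:E)%E).

Definition in_L2 {R : realType} {p d : nat} (Q : probability (obs R p d) R)
  (g : Rvec R d -> R) : Prop :=
  measurable_fun setT g /\ Q.-integrable setT (fun w : obs R p d => ((g w.2) ^+ 2)%:E).

Definition L2_subspace {R : realType} {p d : nat} (Q : probability (obs R p d) R)
  (G : set (Rvec R d -> R)) : Prop :=
  (forall g, G g -> in_L2 Q g) /\
  G (fun _ => 0) /\
  (forall f g, G f -> G g -> G (fun z => f z + g z)) /\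
  (forall (a : R) f, G f -> G (fun z => a * f z)).

Definition semi_inner_product {R : realType} {T : Type}
  (G : set (T -> R)) (J : (T -> R) -> (T -> R) -> R) : Prop :=
  forall (a : R) f g k, G f -> G g -> G k ->
    [/\ J f g = J g f,
        J (fun z => a * f z + g z) k = a * J f k + J g k &
        0 <= J f f].

Definition Jnorm {R : realType} {T : Type} (J : (T -> R) -> (T -> R) -> R)
  (g : T -> R) : R := Num.sqrt (J g g).

Definition unit_class {R : realType} {p d : nat} (Q : probability (obs R p d) R)
  (G : set (Rvec R d -> R)) (J : (Rvec R d -> R) -> (Rvec R d -> R) -> R)
  : set (Rvec R d -> R) :=
  [set g | G g /\ L2norm Q g <= 1 /\ Jnorm J g <= 1].

Definition sup_cover {R : realType} {T : Type} (G C : set (T -> R)) (u : R)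
  (N : nat) (c : 'I_N -> T -> R) : Prop :=
  (forall k, G (c k)) /\
  (forall g, C g -> exists k, forall z, `|g z - c k z| <= u).

(* H(u, C, ||.||_oo) = log N, N the smallest cardinality of a cover
   (+oo if there is no finite cover). *)
Definition sup_entropy {R : realType} {T : Type} (G C : set (T -> R)) (u : R)
  : \bar R :=
  ereal_inf [set x : \bar R | exists (N : nat) (c : 'I_N -> T -> R),
                sup_cover G C u N c /\ x = (ln N%:R)%:E].

Definition cond_exp_x_given_z {R : realType} {p d : nat}
  (Q : probability (obs R p d) R) (h : 'I_p -> Rvec R d -> R) : Prop :=
  forall j : 'I_p,
    Q.-integrable setT (fun w : obs R p d => (w.1 ord0 j)%:E) /\
    measurable_fun setT (h j) /\
    forall B : set (Rvec R d), measurable B ->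
      (\int[Q]_(w in (@snd (Rvec R p) (Rvec R d)) @^-1` B) (w.1 ord0 j)%:E =
       \int[Q]_(w in (@snd (Rvec R p) (Rvec R d)) @^-1` B) (h j w.2)%:E)%E.

Definition cov_tilde {R : realType} {p d : nat} (Q : probability (obs R p d) R)
  (h : 'I_p -> Rvec R d -> R) : 'M[R]_p :=
  \matrix_(j, k) fine (\int[Q]_w
      (((w.1 ord0 j - h j w.2) * (w.1 ord0 k - h k w.2)))%:E)%E.

(* E[h^T h] / n = E[h(z)^T h(z)] *)
Definition cov_h {R : realType} {p d : nat} (Q : probability (obs R p d) R)
  (h : 'I_p -> Rvec R d -> R) : 'M[R]_p :=
  \matrix_(j, k) fine (\int[Q]_w ((h j w.2 * h k w.2))%:E)%E.

Definition smallest_eigenvalue {R : realType} {p : nat} (M : 'M[R]_p) (a : R) :=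
  eigenvalue M a /\ forall b, eigenvalue M b -> a <= b.

Definition largest_eigenvalue {R : realType} {p : nat} (M : 'M[R]_p) (a : R) :=
  eigenvalue M a /\ forall b, eigenvalue M b -> b <= a.

Definition l1norm {R : realType} {p : nat} (b : 'cV[R]_p) : R :=
  \sum_(j < p) `|b j ord0|.

Definition support_size {R : realType} {p : nat} (b : 'cV[R]_p) : nat :=
  #|[set j : 'I_p | b j ord0 != 0]|.

Definition criterion {R : realType} {n p d : nat}
  (X : 'I_n -> 'rV[R]_p) (Z : 'I_n -> Rvec R d) (Y : 'I_n -> R)
  (J : (Rvec R d -> R) -> (Rvec R d -> R) -> R) (lam mu : R)
  (beta : 'cV[R]_p) (g : Rvec R d -> R) : R :=
  n%:R^-1 * (\sum_(i < n) (Y i - (X i *m beta) ord0 ord0 - g (Z i)) ^+ 2)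
  + lam * l1norm beta + mu ^+ 2 * (Jnorm J g) ^+ 2.

Definition is_minimizer {R : realType} {n p d : nat}
  (G : set (Rvec R d -> R))
  (X : 'I_n -> 'rV[R]_p) (Z : 'I_n -> Rvec R d) (Y : 'I_n -> R)
  (J : (Rvec R d -> R) -> (Rvec R d -> R) -> R) (lam mu : R)
  (bhat : 'cV[R]_p) (ghat : Rvec R d -> R) : Prop :=
  G ghat /\ forall beta g, G g ->
    criterion X Z Y J lam mu bhat ghat <= criterion X Z Y J lam mu beta g.

Definition tilde_pred_norm2 {R : realType} {n p d : nat}
  (X : 'I_n -> 'rV[R]_p) (Z : 'I_n -> Rvec R d) (h : 'I_p -> Rvec R d -> R)
  (v : 'cV[R]_p) : R :=
  n%:R^-1 * \sum_(i < n) (\sum_(j < p) (X i ord0 j - h j (Z i)) * v j ord0) ^+ 2.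

(* Main.v *)
(** With [D = bhat - beta0] and [gam = ghat - g0], the estimation error splits as
    [X D + gam(Z) = Xt D + eta(Z)], where [Xt = X - h(Z)] and [eta = h D + gam]
    belongs to [G]; in mean square the two terms are orthogonal because
    [h = E[x | z]].  Suppose that the products noise x [Xt], noise x [G],
    [Xt] x [G] and the empirical second moments of [Xt] and of [G] are all close
    to their means.  By homogeneity the basic inequality then forces [lam |D|_1],
    the L2 norm of [eta] and [mu J(eta)] below their targets in terms of [R]
    (localization).  The bound of the theorem follows from optimality of
    [(bhat, ghat)] along the segment [(bhat - t D, ghat + t h D)], whose
    direction leaves [eta] unchanged, so that the estimation error of [g] only
    enters through the small product of [Xt D] with [eta].

    The deviation bounds over [G] come from chaining along the sup-norm nets of
    (C4).  The entropy exponent [1/m < 2] makes the number of links at level [s]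
    grow like [rho^s] with [rho < 4], so that errors decaying like [q^s] with
    [rho = 4 q^2] still sum.  The link probabilities come from Chernoff's
    inequality; where no Gaussian noise is involved, the elementary bound
    [exp u <= u + exp (2 u^2)] shows that a bounded conditionally centred
    variable is sub-Gaussian. *)

Require Import Defs.
From HB Require Import structures.
From mathcomp Require Import all_boot all_order all_algebra.
From mathcomp Require Import all_classical all_reals all_analysis.
From mathcomp Require Import measurable_realfun ring lra.
Import Order.TTheory GRing.Theory Num.Theory.
Local Open Scope classical_set_scope.
Local Open Scope ring_scope.
Import numFieldNormedType.Exports HBNNSimple.
Set Implicit Arguments.
Unset Strict Implicit.

(** * Measure-theoretic preliminaries *)

(** All of [G] reduces by scaling to the functions with L2 norm at most [mu] and [J] at most 1. This
    class is bounded in sup norm by (C5), and its entropy at scale [mu], at most [A * mu ^ (-1/m)],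
    is small against [n * mu ^ 2] by the lower bound on [mu]. The obstacle is the coarsest net of
    each chain: the functions there have variance [mu ^ 2] but sup norm of order one, so a bound by
    sup norms gives too weak an exponent. Squares start instead from a Bernstein bound, and products
    from a self-normalised bound whose random variance is an empirical square; hence the squares are
    controlled before the products. For the products with the [p] columns of [Xt], aiming at
    [mu * (lam + mu)] instead of [mu ^ 2] leaves an exponent of order [n * (lam + mu) ^ 2], whose
    part [n * lam ^ 2] pays for the union over the columns. The columns are bounded uniformly in [p]
    because the largest eigenvalue of [cov_h] and (C6) place every [h j] in a fixed ball of [G],
    where (C5) applies. *)

Lemma le_of_eq {disp : Order.disp_t} {T : porderType disp} (x y : T) :
  x = y -> (x <= y)%O.
Proof. by move->. Qed.

Lemma measurable_preimage {d1 d2 : measure_display} {X : measurableType d1}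
  {Y : measurableType d2} (W : X -> Y) (S : set Y) :
  measurable_fun setT W -> measurable S -> measurable (W @^-1` S).
Proof. by move=> mW mS; rewrite -[X in measurable X]setTI; exact: mW. Qed.

(** Indicators are covered by assumption, simple functions follow by linearity and [phi] by monotone
    convergence. The weights [F] and [G] serve three purposes: factorising products over independent
    coordinates, passing from the normal law to its density, and testing [h = E[x | z]] against
    functions instead of sets. *)
Lemma ge0_integral_comp_ext {dX dZ dY : measure_display} {X : measurableType dX}
  {Z : measurableType dZ} {Y : measurableType dY} {R : realType}
  (mu : {measure set X -> \bar R}) (nu : {measure set Z -> \bar R})
  (U : X -> Y) (V : Z -> Y) (F : X -> R) (G : Z -> R) (phi : Y -> R) :
  measurable_fun setT U -> measurable_fun setT V ->
  measurable_fun setT F -> measurable_fun setT G ->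
  (forall x, 0 <= F x) -> (forall z, 0 <= G z) ->
  (forall S, measurable S ->
    \int[mu]_(x in U @^-1` S) (F x)%:E = \int[nu]_(z in V @^-1` S) (G z)%:E)%E ->
  measurable_fun setT phi -> (forall y, 0 <= phi y) ->
  (\int[mu]_x (F x * phi (U x))%:E = \int[nu]_z (G z * phi (V z))%:E)%E.
Proof.
move=> mU mV mF mG F0 G0 FG /measurable_EFinP mphi phi0.
pose f_ := nnsfun_approx measurableT mphi.
have lim_int d (T : measurableType d) (m : {measure set T -> \bar R}) (W : T -> Y)
    (H : T -> R) : measurable_fun setT W ->
    measurable_fun setT H -> (forall x, 0 <= H x) ->
    (\int[m]_x (H x * phi (W x))%:E =
     limn (fun n => \sum_(k \in range (f_ n))
        (k%:E * \int[m]_(x in W @^-1` (f_ n @^-1` [set k])) (H x)%:E)))%E.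
  move=> mW mH H0.
  have mWS S : measurable S -> measurable (W @^-1` S).
    exact: measurable_preimage.
  have mfW n : measurable_fun setT (fun x => f_ n (W x)).
    by apply: measurableT_comp.
  have mHk n k : measurable_fun setT
      (fun x => ((H x)%:E * (\1_(W @^-1` (f_ n @^-1` [set k])) x)%:E)%E).
    apply: emeasurable_funM; first exact/measurable_EFinP.
    by apply/measurable_EFinP/measurable_indic/mWS/measurable_funPTI.
  transitivity (limn (fun n => \int[m]_x (H x * f_ n (W x))%:E))%E.
    rewrite -monotone_convergence//.
    - apply: eq_integral => x _; apply/esym/cvg_lim => //.
      under eq_fun do rewrite EFinM.
      rewrite EFinM; apply: cvgeZl => //.
      by apply: (cvg_nnsfun_approx measurableT mphi) => // y _; rewrite lee_fin.
    - by move=> n; apply/measurable_EFinP/measurable_funM.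
    - by move=> n x _; rewrite lee_fin mulr_ge0.
    - move=> x _ a b ab; rewrite lee_fin; apply: ler_wpM2l => //.
      exact/lefP/nd_nnsfun_approx.
  congr (limn _); apply/funext => n.
  transitivity (\int[m]_x \sum_(k \in range (f_ n))
     (k%:E * ((H x)%:E * (\1_(W @^-1` (f_ n @^-1` [set k])) x)%:E)))%E.
    apply: eq_integral => x _; rewrite EFinM fimfunE -fsumEFin// ge0_mule_fsumr; last first.
      by move=> r; exact: nnfun_muleindic_ge0.
    apply: eq_fsbigr => r _.
    by rewrite EFinM muleCA; congr (_ * (_ * _))%E; rewrite /indic.
  rewrite ge0_integral_fsum//; last 2 first.
  - by move=> k; apply: measurable_funeM.
  - move=> k x _; have [xk|xk] := boolP (W x \in f_ n @^-1` [set k]).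
      have k0 : 0 <= k by move: xk; rewrite inE => <-; exact: fun_ge0.
      by apply: mule_ge0; rewrite lee_fin ?mulr_ge0.
    have -> : \1_(W @^-1` (f_ n @^-1` [set k])) x = 0 :> R.
      rewrite indicE; apply/eqP; rewrite pnatr_eq0 eqb0.
      by apply: contra xk; rewrite !inE.
    by rewrite mule0 mule0.
  apply: eq_fsbigr => k; rewrite inE => -[y _ <-].
  rewrite ge0_integralZl//.
  - by congr (_ * _)%E; rewrite [RHS]integral_mkcond epatch_indic.
  - by move=> x _; apply: mule_ge0; rewrite lee_fin.
  - by rewrite lee_fin.
rewrite (lim_int _ _ _ _ _ mU mF F0) (lim_int _ _ _ _ _ mV mG G0); congr (limn _); apply/funext => n.
by apply: eq_fsbigr => k _; rewrite FG.
Qed.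

Lemma measure_eq_rectangles {d1 d2 : measure_display} {T1 : measurableType d1}
  {T2 : measurableType d2} {R : realType}
  (m1 m2 : {measure set (T1 * T2) -> \bar R}) (S : set (T1 * T2)) :
  (m1 setT < +oo)%E ->
  (forall A B, measurable A -> measurable B -> m1 (A `*` B) = m2 (A `*` B)) ->
  measurable S -> m1 S = m2 S.
Proof.
move=> m1fin m12 mS.
pose C : set (set (T1 * T2)) :=
  [set C | exists A, measurable A /\ exists B, measurable B /\ C = A `*` B].
apply: (measure_unique C (fun=> setT)) => //.
- rewrite measurable_prod_measurableType //; congr (<<s _ >>).
  rewrite predeqE; split => [[A mA [B mB <-]]|[A [mA [B [mB ->]]]]].
    by exists A; split => //; exists B.
  by exists A => //; exists B.
- move=> _ _ [X1 [mX1 [X2 [mX2 ->]]]] [Y1 [mY1 [Y2 [mY2 ->]]]].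
  rewrite -setXI; exists (X1 `&` Y1); split; first exact: measurableI.
  by exists (X2 `&` Y2); split => //; exact: measurableI.
- by move=> _; exists setT; split => //; exists setT; split => //; rewrite setXTT.
- by rewrite bigcup_const//; exists 0%N.
- by move=> _ [A [mA [B [mB ->]]]]; exact: m12.
Qed.

Definition indep_sets {R : realType} {dO dT : measure_display}
  {Om : measurableType dO} {T : measurableType dT} (P : probability Om R)
  (n : nat) (W : 'I_n -> Om -> T) : Prop :=
  forall S : 'I_n -> set T, (forall i, measurable (S i)) ->
    P [set w | forall i, S i (W i w)] = (\prod_(i < n) fine (P (W i @^-1` S i)))%:E.

Lemma probability_fineK {R : realType} {d : measure_display}
  {Om : measurableType d} (P : probability Om R) (A : set Om) :
  measurable A -> ((fine (P A))%:E = P A)%E.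
Proof. by move=> mA; rewrite fineK// fin_num_measure. Qed.

Lemma prod_eq1_except {R : realType} {n : nat} (i : 'I_n) (F : 'I_n -> R) :
  (forall j, j != i -> F j = 1) -> \prod_(j < n) F j = F i.
Proof. by move=> F1; rewrite (bigD1 i)//= big1 ?mulr1. Qed.

Lemma indep2_rect {R : realType} {dO d1 d2 : measure_display}
  {Om : measurableType dO} {T1 : measurableType d1} {T2 : measurableType d2}
  (P : probability Om R) (n : nat) (U : 'I_n -> Om -> T1) (V : 'I_n -> Om -> T2)
  (i : 'I_n) (A : set T1) (B : set T2) :
  mutually_indep2 P n U V -> measurable A -> measurable B ->
  P [set w | A (U i w) /\ B (V i w)] =
    (fine (P (U i @^-1` A)) * fine (P (V i @^-1` B)))%:E.
Proof.
move=> UV mA mB.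
have := UV (fun j => if j == i then A else setT) (fun j => if j == i then B else setT).
rewrite !(@prod_eq1_except _ _ i) ?eqxx.
- move=> <-; last by move=> j; case: ifP.
    congr (P _); apply/seteqP; split => w /=.
      by move=> [Aw Bw] j; case: eqP => [->|//].
    by move=> /(_ i); rewrite eqxx.
  by move=> j; case: ifP.
- by move=> j /negPf ->; rewrite preimage_setT probability_setT.
- by move=> j /negPf ->; rewrite preimage_setT probability_setT.
Qed.

Lemma indep2_pairs {R : realType} {dO d1 d2 : measure_display}
  {Om : measurableType dO} {T1 : measurableType d1} {T2 : measurableType d2}
  (P : probability Om R) (n : nat) (U : 'I_n -> Om -> T1) (V : 'I_n -> Om -> T2) :
  (forall i, measurable_fun setT (U i)) -> (forall i, measurable_fun setT (V i)) ->
  mutually_indep2 P n U V -> indep_sets P (fun i w => (U i w, V i w)).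
Proof.
move=> mU mV UV; set W := (fun i w => _).
have mW i : measurable_fun setT (W i) by exact: measurable_fun_pair.
(* Rectangles are replaced by measurable sets one coordinate at a time. *)
suff main k : forall S : 'I_n -> set (T1 * T2), (forall i, measurable (S i)) ->
    (forall i : 'I_n, (k <= i)%N -> exists A B, [/\ measurable A, measurable B &
       S i = A `*` B]) ->
    P [set w | forall i, S i (W i w)] = (\prod_(i < n) fine (P (W i @^-1` S i)))%:E.
  move=> S mS; apply: (main n) => // i.
  by rewrite leqNgt ltn_ord.
elim: k => [S mS rect|k IH S mS rect].
  have [A AB] := choice (fun i => rect i (leq0n i)).
  have [B {}AB] := choice AB.
  have -> : [set w | forall i, S i (W i w)] =
      [set w | forall i, A i (U i w) /\ B i (V i w)].
    apply/seteqP; split => w /= Sw i; have := Sw i; have [_ _ ->] := AB i => //.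
  rewrite UV; [|by move=> i; have [] := AB i|by move=> i; have [] := AB i].
  rewrite -big_split/=; congr EFin; apply: eq_bigr => i _.
  have [mA mB ->] := AB i.
  by rewrite -[LHS]/(fine _%:E) -(indep2_rect i UV mA mB).
have [kn|nk] := ltnP k n; last first.
  by apply: IH => // i ki; have := ltn_ord i; rewrite ltnNge (leq_trans nk).
pose i0 := Ordinal kn.
pose C := \bigcap_(i in [set i | i != i0]) W i @^-1` S i.
have mC : measurable C.
  apply: fin_bigcap_measurable; first exact: finite_finset.
  by move=> i _; apply: measurable_preimage.
pose c := \prod_(i < n | i != i0) fine (P (W i @^-1` S i)).
have c0 : 0 <= c by apply: prodr_ge0 => i _; rewrite fine_ge0.
(* With the other sets fixed, both sides of the product rule are measures of the set at [i0]: the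
   law of [W i0] restricted to [C], and [c] times the law of [W i0]. The induction hypothesis
   compares them on rectangles. *)
pose m1 : {measure set _ -> \bar R} := pushforward (mrestr P mC) (W i0).
pose m2 : {measure set _ -> \bar R} := mscale (NngNum c0) (pushforward P (W i0)).
suff : m1 (mW i0) (S i0) = m2 (mW i0) (S i0).
  rewrite /m1 /m2 /= /mscale/= /pushforward /mrestr => E.
  have -> : [set w | forall i, S i (W i w)] = W i0 @^-1` S i0 `&` C.
    apply/seteqP; split => w /=; first by move=> Sw; split => // i _; exact: Sw.
    by move=> [S0 Cw] i; have [->//|ii0] := eqVneq i i0; exact: Cw.
  rewrite (bigD1 i0)//= EFinM probability_fineK; last exact: measurable_preimage.
  by rewrite muleC -E.
apply: (@measure_eq_rectangles _ _ _ _ _ (m1 (mW i0)) (m2 (mW i0))) => //.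
  rewrite /m1 /= /pushforward /mrestr.
  by apply: le_lt_trans (probability_le1 P _) _; rewrite ?ltry// preimage_setT setTI.
move=> A B mA mB; rewrite /m1 /m2 /= /mscale/= /pushforward /mrestr.
have := IH (fun i => if i == i0 then A `*` B else S i).
rewrite (bigD1 i0)//= eqxx EFinM probability_fineK; last first.
  by apply: measurable_preimage => //; exact: measurableX.
under eq_bigr => i /negPf -> do over.
rewrite muleC => <-.
- congr (P _); apply/seteqP; split => w /=.
    by move=> [ABw Cw] i; case: eqP => [->|/eqP ii0]//; exact: Cw.
  move=> Sw; split; first by have := Sw i0; rewrite eqxx.
  by move=> i ii0; have := Sw i; rewrite (negPf ii0).
- by move=> i; case: ifP => // _; exact: measurableX.
- move=> i ki; case: ifP => [_|/negbT ii0]; first by exists A, B.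
  apply: rect; rewrite ltn_neqAle ki andbT.
  by apply: contra ii0 => /eqP ?; apply/eqP/val_inj.
Qed.

Lemma integral_indicT {R : realType} {d : measure_display} {X : measurableType d}
  (mu : {measure set X -> \bar R}) (A : set X) :
  measurable A -> (\int[mu]_x (\1_A x)%:E = mu A)%E.
Proof. by move=> mA; rewrite integral_indic// setIT. Qed.

Lemma indep_sets_prod {R : realType} {dO dT : measure_display}
  {Om : measurableType dO} {T : measurableType dT} (P : probability Om R)
  (n : nat) (W : 'I_n -> Om -> T) (phi : 'I_n -> T -> R) :
  (forall i, measurable_fun setT (W i)) -> indep_sets P W ->
  (forall i, measurable_fun setT (phi i)) -> (forall i t, 0 <= phi i t) ->
  (forall i, \int[P]_w (phi i (W i w))%:E < +oo)%E ->
  (\int[P]_w (\prod_(i < n) phi i (W i w))%:E =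
   (\prod_(i < n) fine (\int[P]_w (phi i (W i w))%:E))%:E)%E.
Proof.
move=> mW indep.
(* Indicators are replaced by arbitrary functions one coordinate at a time. *)
suff main k : forall phi : 'I_n -> T -> R,
    (forall i, measurable_fun setT (phi i)) -> (forall i t, 0 <= phi i t) ->
    (forall i, \int[P]_w (phi i (W i w))%:E < +oo)%E ->
    (forall i : 'I_n, (k <= i)%N -> exists S, measurable S /\ phi i = \1_S) ->
    (\int[P]_w (\prod_(i < n) phi i (W i w))%:E =
      (\prod_(i < n) fine (\int[P]_w (phi i (W i w))%:E))%:E)%E.
  by move=> mp p0 pfin; apply: (main n) => // i; rewrite leqNgt ltn_ord.
elim: k => [{}phi mp p0 pfin ind|k IH {}phi mp p0 pfin ind].
  have [S Sp] := choice (fun i => ind i (leq0n i)).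
  have mS i : measurable (S i) by have [] := Sp i.
  have pE i : phi i = \1_(S i) by have [] := Sp i.
  have mI : measurable [set w | forall i, S i (W i w)].
    have -> : [set w | forall i, S i (W i w)] = \bigcap_(i in setT) W i @^-1` S i.
      by apply/seteqP; split => w /= Sw i; [move=> _; exact: Sw|exact: (Sw i Logic.I)].
    apply: fin_bigcap_measurable; [exact: finite_finset|move=> i _]; exact: measurable_preimage.
  transitivity (P [set w | forall i, S i (W i w)]).
    rewrite -integral_indicT//; apply: eq_integral => w _; congr EFin.
    rewrite indicE; have [Sw|nSw] := pselect (forall i, S i (W i w)).
      by rewrite big1 ?mem_set// => i _; rewrite pE indicE mem_set.
    rewrite [in RHS]memNset//; move: nSw => /existsNP[i nS].
    by rewrite (bigD1 i)//= pE indicE memNset// mul0r.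
  rewrite indep//; congr EFin; apply: eq_bigr => i _.
  rewrite pE; congr fine; rewrite -integral_indicT//; exact: measurable_preimage.
have [kn|nk] := ltnP k n; last first.
  by apply: IH => // i ki; have := ltn_ord i; rewrite ltnNge (leq_trans nk).
pose i0 := Ordinal kn.
pose c := \prod_(i < n | i != i0) fine (\int[P]_w (phi i (W i w))%:E)%E.
have c0 : 0 <= c.
  apply: prodr_ge0 => i _; apply/fine_ge0/integral_ge0 => w _.
  by rewrite lee_fin.
pose F w := \prod_(i < n | i != i0) phi i (W i w).
have mF : measurable_fun setT F.
  rewrite /F; under eq_fun do rewrite -big_filter.
  apply: measurable_prod => i _.
  exact: measurableT_comp.
have F0 w : 0 <= F w by apply: prodr_ge0.
have mpW i : measurable_fun setT (fun w => (phi i (W i w))%:E).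
  by apply/measurable_EFinP; exact: measurableT_comp.
transitivity (\int[P]_w (c * phi i0 (W i0 w))%:E)%E; last first.
  under eq_integral do rewrite EFinM.
  rewrite ge0_integralZl ?lee_fin//; last by move=> w _; rewrite lee_fin.
  rewrite (bigD1 i0)//= EFinM muleC fineK//.
  by rewrite ge0_fin_numE// integral_ge0// => w _; rewrite lee_fin.
under eq_integral => w _ do rewrite (bigD1 i0)//= mulrC -/(F w).
(* The weight [F] collects the other factors and [c] is the product of their means; on a set [S] the
   required equality is the induction hypothesis with [phi i0] replaced by an indicator. *)
apply: (@ge0_integral_comp_ext _ _ _ _ _ _ _ P P (W i0) (W i0) F (fun=> c) (phi i0)) => //.
move=> S mS; rewrite integral_cst/=; last exact: measurable_preimage.
have mS' : measurable (W i0 @^-1` S) by exact: measurable_preimage.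
have := IH (fun i => if i == i0 then \1_S else phi i).
rewrite [in X in _ = X](bigD1 i0)//= eqxx.
under [X in (_ * X)%R]eq_bigr => i /negPf -> do over.
rewrite -/c => E.
transitivity (\int[P]_w (\prod_(i < n) (if i == i0 then \1_S else phi i) (W i w))%:E)%E.
  rewrite integral_mkcond epatch_indic; apply: eq_integral => w _.
  rewrite (bigD1 i0)//= eqxx -EFinM mulrC; congr (EFin (_ * _)).
  by apply: eq_bigr => i /negPf ->.
rewrite E.
- rewrite mulrC EFinM; congr (_ * _)%E.
  rewrite -(integral_indicT P mS') fineK//.
  by rewrite (integral_indicT P mS') fin_num_measure.
- by move=> i; case: ifP => // _; exact: measurable_indic.
- by move=> i t; case: ifP.
- move=> i; case: ifP => // /eqP ->.
  rewrite -[X in (X < _)%E]/(\int[P]_w (\1_(W i0 @^-1` S) w)%:E)%E integral_indicT//.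
  by apply: le_lt_trans (probability_le1 P _) _ => //; rewrite ltry.
- move=> i ki; case: ifP => [_|/negbT ii0]; first by exists S.
  apply: ind; rewrite ltn_neqAle ki andbT.
  by apply: contra ii0 => /eqP ?; apply/eqP/val_inj.
Qed.

(** * High-probability events and Chernoff bounds *)

(** [A] may quantify over an uncountable class of functions and need not be measurable, so a
    measurable event inside it carries the probability. *)
Definition whp {R : realType} {d : measure_display} {Om : measurableType d}
  (P : probability Om R) (q : R) (A : Om -> Prop) : Prop :=
  exists E : set Om, [/\ measurable E, (P (~` E) <= q%:E)%E & forall w, E w -> A w].

Section whp.
Context {R : realType} {d : measure_display} {Om : measurableType d}.
Variable P : probability Om R.
Implicit Types (q : R) (A B : Om -> Prop).

Lemma whp_event q (E : set Om) :
  measurable E -> (P E <= q%:E)%E -> whp P q (fun w => ~ E w).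
Proof.
by move=> mE PE; exists (~` E); split => //; [exact: measurableC|rewrite setCK].
Qed.

Lemma whpW q q' A B : whp P q A -> q <= q' -> (forall w, A w -> B w) -> whp P q' B.
Proof.
move=> [E [mE PE EA]] qq' AB; exists E; split => //; last by move=> w /EA/AB.
by rewrite (le_trans PE)// lee_fin.
Qed.

Lemma whp_true A : (forall w, A w) -> whp P 0 A.
Proof.
by move=> AT; exists setT; split => //; rewrite setCT measure0.
Qed.

Lemma whp_and q1 q2 A B :
  whp P q1 A -> whp P q2 B -> whp P (q1 + q2) (fun w => A w /\ B w).
Proof.
move=> [E [mE PE EA]] [F [mF PF FB]]; exists (E `&` F); split.
- exact: measurableI.
- rewrite setCI EFinD (le_trans (measureU2 _ _ _))//; [exact: measurableC..|].
  exact: leeD.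
- by move=> w [/EA ? /FB].
Qed.

Lemma whp_nat (N : nat) (q : nat -> R) (A : nat -> Om -> Prop) :
  (forall i, (i < N)%N -> whp P (q i) (A i)) ->
  whp P (\sum_(i < N) q i) (fun w => forall i, (i < N)%N -> A i w).
Proof.
elim: N => [|N IH] qA; first by rewrite big_ord0; apply: whp_true.
rewrite big_ord_recr/=.
apply: whpW (whp_and (IH _) (qA N _)) (lexx _) _ => //.
  by move=> i iN; apply: qA; rewrite ltnS ltnW.
move=> w [AN Aw] i; rewrite ltnS leq_eqVlt => /orP[/eqP ->//|]; exact: AN.
Qed.

Lemma whp_natc (N : nat) (q : R) (A : nat -> Om -> Prop) :
  (forall i, (i < N)%N -> whp P q (A i)) ->
  whp P (N%:R * q) (fun w => forall i, (i < N)%N -> A i w).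
Proof.
move=> qA; apply: whpW (whp_nat (q := fun=> q) qA) _ (fun w H => H).
by rewrite sumr_const card_ord mulr_natl lexx.
Qed.

Lemma whp_ord (N : nat) (q : R) (A : 'I_N -> Om -> Prop) :
  (forall i, whp P q (A i)) -> whp P (N%:R * q) (fun w => forall i, A i w).
Proof.
move=> qA.
pose B i w := forall h : (i < N)%N, A (Ordinal h) w.
apply: (@whpW _ _ (fun w => forall i, (i < N)%N -> B i w)) (lexx _) _.
  apply: whp_natc => i iN; apply: whpW (qA (Ordinal iN)) (lexx _) _ => w Aw h.
  by rewrite (bool_irrelevance h iN).
by move=> w Bw [i iN]; exact: (Bw i iN iN).
Qed.

End whp.

Section chernoff.
Context {R : realType} {dO d1 d2 : measure_display} {Om : measurableType dO}
  {T1 : measurableType d1} {T2 : measurableType d2}.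
Variables (P : probability Om R) (Q : probability T1 R) (N : probability T2 R).
Variables (n : nat) (U : 'I_n -> Om -> T1) (V : 'I_n -> Om -> T2).
Hypothesis mU : forall i, measurable_fun setT (U i).
Hypothesis mV : forall i, measurable_fun setT (V i).
Hypothesis UV : mutually_indep2 P n U V.
Hypothesis lawU : forall i (S : set T1), measurable S -> P (U i @^-1` S) = Q S.
Hypothesis lawV : forall i (S : set T2), measurable S -> P (V i @^-1` S) = N S.

(** Independence makes the law of the pair a product, so that the noise can be integrated first, at
    a fixed [x]. *)
Lemma integral_law_pair (i : 'I_n) (phi : T1 * T2 -> R) :
  measurable_fun setT phi -> (forall t, 0 <= phi t) ->
  (\int[P]_w (phi (U i w, V i w))%:E = \int[Q]_x \int[N]_y (phi (x, y))%:E)%E.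
Proof.
move=> mphi phi0.
have mW : measurable_fun setT (fun w => (U i w, V i w)) by exact: measurable_fun_pair.
have mE : measurable_fun setT (fun t => (phi t)%:E) by exact/measurable_EFinP.
transitivity (\int[pushforward P (fun w => (U i w, V i w))]_t (phi t)%:E)%E.
  rewrite ge0_integral_pushforward//; last by move=> t _; rewrite lee_fin.
rewrite -(fubini_tonelli1 (fun t => (phi t)%:E)); last 2 first.
- exact: mE.
- by move=> t; rewrite lee_fin.
pose m' : {measure set _ -> \bar R} := pushforward P (fun w => (U i w, V i w)).
symmetry; apply: (eq_measure_integral (m' mW)) => A mA _.
apply: product_measure_unique => // B C mB mC; rewrite /m'/= /pushforward.
have -> : (fun w => (U i w, V i w)) @^-1` (B `*` C) = [set w | B (U i w) /\ C (V i w)].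
  by [].
rewrite (indep2_rect i UV)// EFinM.
by rewrite !probability_fineK ?lawU ?lawV//; exact: measurable_preimage.
Qed.

(** Markov's inequality for the exponential of the sum, whose mean is a product of factors at most
    1. Multiplier and variance compensator are absorbed in [psi], so Gaussian, sub-Gaussian and
    Bernstein bounds share this form. *)
Lemma chernoff_sum (psi : T1 * T2 -> R) (t : R) :
  measurable_fun setT psi ->
  (\int[Q]_x \int[N]_y (expR (psi (x, y)))%:E <= 1)%E ->
  whp P (expR (- t)) (fun w => \sum_(i < n) psi (U i w, V i w) <= t).
Proof.
move=> mpsi psi1.
have mexp : measurable_fun setT (fun t => expR (psi t)).
  exact: measurableT_comp.
have mS : measurable_fun setT (fun w => \sum_(i < n) psi (U i w, V i w)).
  apply: measurable_sum => i; apply: measurableT_comp => //.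
  exact: measurable_fun_pair.
pose E := [set w | t < \sum_(i < n) psi (U i w, V i w)].
have mE : measurable E.
  have -> : E = (fun w => \sum_(i < n) psi (U i w, V i w)) @^-1` `]t, +oo[.
    by apply/seteqP; split => w /=; rewrite in_itv/= andbT.
  exact: measurable_preimage.
have int1 : (\int[P]_w (expR (\sum_(i < n) psi (U i w, V i w)))%:E <= 1)%E.
  under eq_integral do rewrite expR_sum.
  have le1 i : (\int[P]_w (expR (psi (U i w, V i w)))%:E <= 1)%E.
    by rewrite (integral_law_pair i mexp)//; move=> ?; exact: expR_ge0.
  have ge0 i : (0 <= \int[P]_w (expR (psi (U i w, V i w)))%:E)%E.
    by apply: integral_ge0 => w _; rewrite lee_fin expR_ge0.
  rewrite (@indep_sets_prod _ _ _ _ _ P n (fun i w => (U i w, V i w))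
    (fun=> fun t => expR (psi t))) ?lee_fin//.
  - apply: prodr_ile1 => i _; rewrite fine_ge0//=.
    by rewrite -lee_fin fineK// ge0_fin_numE// (le_lt_trans (le1 i))// ltry.
  - by move=> i; exact: measurable_fun_pair.
  - exact: indep2_pairs.
  - by move=> i; rewrite (le_lt_trans (le1 i))// ltry.
have PE : (P E <= (expR (- t))%:E)%E.
  rewrite expRN -[X in (_ <= X)%E]mul1e -lee_pdivrMr ?invr_gt0 ?expR_gt0//.
  have m1E : measurable_fun setT (fun w => (\1_E w)%:E : \bar R).
    exact/measurable_EFinP/measurable_indic.
  rewrite invrK -(integral_indicT P mE) muleC.
  have <- : (\int[P]_w ((expR t)%:E * (\1_E w)%:E) =
             (expR t)%:E * \int[P]_w (\1_E w)%:E)%E.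
    exact: ge0_integralZl.
  apply: le_trans int1; apply: ge0_le_integral => //.
  - exact: measurable_funeM.
  - by apply/measurable_EFinP; exact: measurableT_comp.
  - move=> w _; rewrite indicE -EFinM lee_fin.
    have [|_] := boolP (w \in E); last by rewrite mulr0 expR_ge0.
    by rewrite inE /E/= => tw; rewrite mulr1 ler_expR ltW.
apply: whpW (whp_event mE PE) (lexx _) _ => w /negP.
by rewrite -leNgt.
Qed.

(* The bound is self-normalised: it holds for every [a], with the random
   variance proxy [\sum v] in place of a deterministic one. *)
Lemma subgauss_sum (xi v : T1 * T2 -> R) (a tau : R) :
  measurable_fun setT xi -> measurable_fun setT v -> 0 < a ->
  (forall b : R, \int[Q]_x \int[N]_y
     (expR (b * xi (x, y) - b ^+ 2 / 2 * v (x, y)))%:E <= 1)%E ->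
  whp P (2 * expR (- tau)) (fun w =>
    `|\sum_(i < n) xi (U i w, V i w)| <=
      a / 2 * \sum_(i < n) v (U i w, V i w) + tau / a).
Proof.
move=> mxi mv a0 sg.
have one b : whp P (expR (- tau)) (fun w =>
    b * \sum_(i < n) xi (U i w, V i w) -
      b ^+ 2 / 2 * \sum_(i < n) v (U i w, V i w) <= tau).
  have mpsi : measurable_fun setT (fun t => b * xi t - b ^+ 2 / 2 * v t).
    by apply: measurable_funB; apply: measurable_funM.
  apply: whpW (chernoff_sum tau mpsi (sg b)) (lexx _) _ => w.
  by rewrite sumrB !mulr_sumr.
rewrite mulr_natl mulr2n; apply: whpW (whp_and (one a) (one (- a))) (lexx _) _.
move=> w [H1 H2]; rewrite sqrrN in H2.
set S := \sum_(i < n) xi _ in H1 H2 *; set VV := \sum_(i < n) v _ in H1 H2 *.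
have -> : a / 2 * VV + tau / a = (a ^+ 2 / 2 * VV + tau) / a.
  by field; rewrite gt_eqF.
by rewrite ler_norml lerNl !ler_pdivlMr//; apply/andP; split; lra.
Qed.

End chernoff.

(** * Exponential moments of bounded variables *)

Section bounded.
Context {R : realType} {d : measure_display} {T : measurableType d}.
Variable Q : probability T R.
Implicit Types f g : T -> R.

Lemma bounded_integrable f (M : R) : measurable_fun setT f ->
  (forall t, `|f t| <= M) -> Q.-integrable setT (EFin \o f).
Proof.
move=> mf fM; apply: measurable_bounded_integrable => //.
  by rewrite (le_lt_trans (probability_le1 Q _))// ltry.
exists M; split; first exact: num_real.
by move=> r Mr t _ /=; rewrite (le_trans (fM t))// ltW.
Qed.

Lemma mean_cst (c : R) : \int[Q]_t c = c.
Proof. by rewrite Rintegral_cst// [X in fine X]probability_setT mulr1. Qed.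

Lemma integral_finE f : Q.-integrable setT (EFin \o f) ->
  (\int[Q]_t (f t)%:E = (\int[Q]_t f t)%:E)%E.
Proof. by move=> intf; rewrite /Rintegral fineK//; exact: integrable_fin_num. Qed.

Lemma mean_le_cst f (M : R) : Q.-integrable setT (EFin \o f) ->
  (forall t, f t <= M) -> \int[Q]_t f t <= M.
Proof.
move=> intf fM; rewrite -[leRHS](mean_cst M); apply: le_Rintegral => //.
exact: finite_measure_integrable_cst.
Qed.

Lemma mean_ge_cst f (M : R) : Q.-integrable setT (EFin \o f) ->
  (forall t, M <= f t) -> M <= \int[Q]_t f t.
Proof.
move=> intf fM; rewrite -[leLHS](mean_cst M); apply: le_Rintegral => //.
exact: finite_measure_integrable_cst.
Qed.

Lemma norm_mean_le f (M : R) : Q.-integrable setT (EFin \o f) ->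
  (forall t, `|f t| <= M) -> `|\int[Q]_t f t| <= M.
Proof.
move=> intf fM; rewrite ler_norml mean_le_cst ?mean_ge_cst// => t.
- by have := fM t; rewrite ler_norml => /andP[].
- by have := fM t; rewrite ler_norml => /andP[].
Qed.

End bounded.

(** [exp u <= 1 / (1 - u)], and [(1 - u) (1 + u + 2 u^2) = 1 + u^2 (1 - 2 u)] is at least 1 for
    [u <= 1/2]. *)
Lemma expR_le_quad {R : realType} (u : R) : u <= 2^-1 -> expR u <= 1 + u + 2 * u ^+ 2.
Proof.
move=> u2; have h : 1 - u <= expR (- u) := expR_ge1Dx _.
have h1 : 0 < 1 - u by lra.
apply: (@le_trans _ _ (1 - u)^-1).
  by rewrite -[expR u]invrK -expRN lef_pV2 ?posrE ?expR_gt0.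
by rewrite -[leLHS]mul1r ler_pdivrMr//; nra.
Qed.

Lemma expR_le_subgauss {R : realType} (u : R) : expR u <= u + expR (2 * u ^+ 2).
Proof.
have [u2|u2] := leP u 2^-1.
  apply: (le_trans (expR_le_quad u2)); have := expR_ge1Dx (2 * u ^+ 2); lra.
by apply: ler_wpDl; [lra|rewrite ler_expR; nra].
Qed.

Section mgf.
Context {R : realType} {d : measure_display} {T : measurableType d}.
Variable Q : probability T R.

(** The elementary bound at [s t * x t], times the compensator, gives at most [1 + x * phi] with
    [phi = s * exp (- 2 (s B)^2)]. Orthogonality of [x] to this one [phi] is what conditional
    centring supplies when [s] is a function of [z]. *)
Lemma subgauss_bounded (x s : T -> R) (B : R) :
  measurable_fun setT x -> measurable_fun setT s -> 0 < B ->
  (forall t, `|x t| <= B) ->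
  \int[Q]_t (x t * (s t * expR (- (2 * (s t * B) ^+ 2)))) = 0 ->
  (\int[Q]_t (expR (s t * x t - 2 * (s t * B) ^+ 2))%:E <= 1)%E.
Proof.
move=> mx ms B0 xB int0.
pose phi t := s t * expR (- (2 * (s t * B) ^+ 2)).
have mphi : measurable_fun setT phi.
  apply: measurable_funM => //; apply: measurableT_comp => //.
  apply: measurableT_comp => //; apply: measurable_funM => //.
  by apply: measurable_funX; apply: measurable_funM.
(* With [v = |s| B], [v <= 1 + 2 v^2 <= exp (2 v^2)]: the damping keeps [phi] bounded even where [s]
   is large. *)
have phiB t : `|phi t| <= B^-1.
  rewrite /phi normrM (ger0_norm (expR_ge0 _)) expRN.
  rewrite ler_pdivrMr ?expR_gt0// ler_pdivlMl//.
  apply: (le_trans _ (expR_ge1Dx _)).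
  have -> : (s t * B) ^+ 2 = (`|s t| * B) ^+ 2 by rewrite !exprMn real_normK ?num_real.
  have : 0 <= `|s t| * B by rewrite mulr_ge0// ltW.
  nra.
have intphi : Q.-integrable setT (EFin \o (fun t => x t * phi t)).
  apply: (@bounded_integrable _ _ _ _ _ (B * B^-1)); first exact: measurable_funM.
  by move=> t; rewrite normrM ler_pM.
have le1 t : expR (s t * x t - 2 * (s t * B) ^+ 2) <= 1 + x t * phi t.
  rewrite /phi expRD mulrA -[X in X + _](expRxMexpNx_1 (2 * (s t * B) ^+ 2)) -mulrDl.
  apply: ler_wpM2r; first exact: expR_ge0.
  apply: (le_trans (expR_le_subgauss _)).
  rewrite [X in _ <= X]addrC [x t * s t]mulrC lerD2l ler_expR ler_pM2l//.
  rewrite !exprMn ler_wpM2l ?sqr_ge0//.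
  by rewrite -(real_normK (num_real (x t))) lerXn2r ?nnegrE// ltW.
have int1 : Q.-integrable setT (EFin \o (fun t => 1 + x t * phi t)).
  have -> : EFin \o (fun t => 1 + x t * phi t) =
      (EFin \o cst 1) \+ (EFin \o (fun t => x t * phi t)) by apply/funext => t.
  by apply: integrableD => //; exact: finite_measure_integrable_cst.
apply: (@le_trans _ _ (\int[Q]_t (1 + x t * phi t)%:E)%E).
  apply: ge0_le_integral => //.
  - apply/measurable_EFinP; apply: measurableT_comp => //.
    apply: measurable_funB; first exact: measurable_funM.
    apply: measurable_funM => //.
    by apply: measurable_funX; apply: measurable_funM.
  - by case/integrableP : int1.
  - by move=> t _; rewrite lee_fin.
rewrite integral_finE// lee_fin RintegralD// ?int0 ?mean_cst ?addr0//.
exact: finite_measure_integrable_cst.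
Qed.

(** For [0 <= y <= B] the variance is at most [B] times the mean, so the proxy [B * v] is linear in
    [v]. For squares of functions of L2 norm at most [mu] this yields exponents of order
    [n * mu ^ 2] instead of [n * mu ^ 4]. *)
Lemma bernstein_mgf (y : T -> R) (B a v : R) :
  measurable_fun setT y -> 0 < B -> (forall t, 0 <= y t <= B) ->
  \int[Q]_t y t <= v -> `|a| * B <= 2^-1 ->
  (\int[Q]_t (expR (a * (y t - \int[Q]_t y t) - 2 * a ^+ 2 * (B * v)))%:E <= 1)%E.
Proof.
move=> my B0 yB yv aB; set m := \int[Q]_t y t in yv *.
have inty : Q.-integrable setT (EFin \o y).
  by apply: (@bounded_integrable _ _ _ _ _ B) => // t; rewrite ger0_norm; case/andP : (yB t).
have m0 : 0 <= m by apply: mean_ge_cst => // t; case/andP : (yB t).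
have mB : m <= B by apply: mean_le_cst => // t; case/andP : (yB t).
pose z t := 1 + a * (y t - m) + 2 * a ^+ 2 * (B * y t - 2 * m * y t + m ^+ 2).
have bound_z t : expR (a * (y t - m)) <= z t.
  have /andP[y0 yB'] := yB t.
  have u2 : a * (y t - m) <= 2^-1.
    apply: le_trans aB; apply: (le_trans (ler_norm _)); rewrite normrM.
    by rewrite ler_wpM2l// ler_norml; apply/andP; split; lra.
  apply: (le_trans (expR_le_quad u2)); rewrite /z lerD2l exprMn -mulrA.
  rewrite ler_pM2l// ler_wpM2l ?sqr_ge0//; nra.
have Ez : (\int[Q]_t (z t)%:E <= (1 + 2 * a ^+ 2 * (B * v))%:E)%E.
  have -> : z = (fun t => (a + 2 * a ^+ 2 * (B - 2 * m)) * y t +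
                 (1 - a * m + 2 * a ^+ 2 * m ^+ 2)).
    by apply/funext => t; rewrite /z; ring.
  have intZ : Q.-integrable setT (EFin \o (fun t => (a + 2 * a ^+ 2 * (B - 2 * m)) * y t)).
    have -> : EFin \o (fun t => (a + 2 * a ^+ 2 * (B - 2 * m)) * y t) =
       (fun t => (a + 2 * a ^+ 2 * (B - 2 * m))%:E * (EFin \o y) t)%E by apply/funext => t.
    exact: integrableZl.
  rewrite integral_finE.
    rewrite RintegralD// ?mean_cst ?RintegralZl//; last exact: finite_measure_integrable_cst.
    rewrite lee_fin -/m.
    suff : 0 <= a ^+ 2 * (B * v - B * m + m ^+ 2) by nra.
    by rewrite mulr_ge0 ?sqr_ge0//; nra.
  rewrite [X in _.-integrable _ X](_ : _ =
    (EFin \o (fun t => (a + 2 * a ^+ 2 * (B - 2 * m)) * y t)) \+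
    (EFin \o cst (1 - a * m + 2 * a ^+ 2 * m ^+ 2))).
    by apply: integrableD => //; exact: finite_measure_integrable_cst.
  by apply/funext => t.
have mexp : measurable_fun setT (fun t => expR (a * (y t - m))).
  apply: measurableT_comp => //; apply: measurable_funM => //.
  exact: measurable_funB.
under eq_integral do rewrite expRD mulrC EFinM.
rewrite ge0_integralZl//; last exact/measurable_EFinP.
rewrite expRN -[X in (_ <= X)%E]/((1 : R)%:E) lee_pdivrMl ?expR_gt0// mule1.
apply: (@le_trans _ _ (\int[Q]_t (z t)%:E)%E).
  apply: ge0_le_integral => //.
  - exact/measurable_EFinP.
  - apply/measurable_EFinP; rewrite /z; apply: measurable_funD.
      by apply: measurable_funD => //; apply: measurable_funM => //; exact: measurable_funB.
    apply: measurable_funM => //; apply: measurable_funD => //.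
    by apply: measurable_funB; apply: measurable_funM.
  - by move=> t _; rewrite lee_fin.
by apply: (le_trans Ez); rewrite lee_fin expR_ge1Dx.
Qed.

End mgf.

Lemma half_sum_le1 {R : realType} {d : measure_display} {T : measurableType d}
  (mu : {measure set T -> \bar R}) (f g : T -> R) :
  measurable_fun setT f -> measurable_fun setT g ->
  (forall t, 0 <= f t) -> (forall t, 0 <= g t) ->
  (\int[mu]_t (f t)%:E <= 1)%E -> (\int[mu]_t (g t)%:E <= 1)%E ->
  (\int[mu]_t ((2^-1)%:E * ((f t)%:E + (g t)%:E)) <= 1)%E.
Proof.
move=> /measurable_EFinP mf /measurable_EFinP mg f0 g0 f1 g1.
have mfg : measurable_fun setT (fun t => ((f t)%:E + (g t)%:E)%E).
  exact: emeasurable_funD.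
have fg0 t : setT t -> (0 <= (f t)%:E + (g t)%:E)%E by move=> _; rewrite adde_ge0 ?lee_fin.
rewrite (ge0_integralZl mu measurableT mfg fg0) ?lee_fin//.
rewrite (ge0_integralD mu measurableT _ mf _ mg)//; last 2 first.
- by move=> t _; rewrite lee_fin.
- by move=> t _; rewrite lee_fin.
rewrite [X in (_ <= X)%E](_ : _ = (2^-1)%:E * (1 + 1))%E; last first.
  by rewrite -EFinD -EFinM; congr EFin; field.
by apply: lee_wpmul2l; rewrite ?lee_fin//; exact: leeD.
Qed.

(** * Exponential moments of the standard normal law *)

Section normal.
Context {R : realType}.
Let N := normal_prob (0 : R) 1.
Local Notation mu := lebesgue_measure.

Lemma integral_normal01 (phi : R -> R) : measurable_fun setT phi ->
  (forall y, 0 <= phi y) ->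
  (\int[N]_y (phi y)%:E = \int[mu]_y (normal_pdf 0 1 y * phi y)%:E)%E.
Proof.
move=> mphi phi0.
under [LHS]eq_integral do rewrite -[phi _]mul1r.
have := (@ge0_integral_comp_ext _ _ _ _ _ _ _ N mu id id (cst 1) (normal_pdf 0 1) phi); apply => //.
- exact: measurable_normal_pdf.
- by move=> z; exact: normal_pdf_ge0.
- by move=> S mS; rewrite -[LHS]/(\int[N]_(y in S) (cst 1%:E) y)%E integral_cst// mul1e.
Qed.

(** Completing the square: the tilted density is the normal density centred at [c]. *)
Lemma normal_mgf (c : R) : (\int[N]_y (expR (c * y - c ^+ 2 / 2))%:E = 1)%E.
Proof.
have mexp : measurable_fun setT (fun y : R => expR (c * y - c ^+ 2 / 2)).
  by apply: measurableT_comp => //; apply: measurable_funB.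
rewrite integral_normal01//.
rewrite -[RHS](integral_normal_pdf c (1 : R)); apply: eq_integral => y _.
congr EFin; rewrite !normal_pdfE ?oner_neq0// -mulrA; congr (_ * _).
by rewrite /normal_fun -expRD; congr expR; field.
Qed.

(** [exp |y| <= exp y + exp (- y)], and each exponential has mean [exp (1/2)]; the shift 2 suffices
    because [2 * exp (1/2) <= exp 2]. *)
Lemma normal_abs_mgf : (\int[N]_y (expR (`|y| - 2))%:E <= 1)%E.
Proof.
have mexp (c : R) : measurable_fun setT (fun y : R => expR (c * y - c ^+ 2 / 2)).
  by apply: measurableT_comp => //; apply: measurable_funB.
have mexpE (c : R) : measurable_fun setT (fun y : R => (expR (c * y - c ^+ 2 / 2))%:E).
  by apply/measurable_EFinP; exact: mexp.
have msum := emeasurable_funD (mexpE 1) (mexpE (-1)).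
have h32 : 2 <= expR (3 / 2 : R).
  by have := expR_ge1Dx (3 / 2 : R); lra.
apply: (@le_trans _ _ (\int[N]_y ((2^-1)%:E * ((expR (1 * y - 1 ^+ 2 / 2))%:E +
    (expR ((-1) * y - (-1) ^+ 2 / 2))%:E)))%E).
  apply: ge0_le_integral => //.
  - apply/measurable_EFinP; apply: measurableT_comp => //; apply: measurable_funB => //.
  - exact: measurable_funeM.
  - move=> y _; rewrite -EFinD -EFinM lee_fin ler_pdivlMl//.
    apply: (@le_trans _ _ (expR (3 / 2) * expR (`|y| - 2))).
      by rewrite ler_wpM2r// expR_ge0.
    rewrite -expRD sqrrN expr1n.
    have e0 := expR_ge0 (1 * y - 1 / 2); have e1 := expR_ge0 ((-1) * y - 1 / 2).
    have [y0|y0] := leP 0 y.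
      rewrite (ger0_norm y0) (_ : 3 / 2 + (y - 2) = 1 * y - 1 / 2); last by field.
      by rewrite lerDl.
    rewrite (ltr0_norm y0) (_ : 3 / 2 + (- y - 2) = (-1) * y - 1 / 2); last by field.
    by rewrite lerDr.
apply: (@half_sum_le1 _ _ _ N _ _ (mexp 1) (mexp (-1))); rewrite ?normal_mgf//.
Qed.

End normal.

(** * Semi-inner products and the deterministic analysis *)

Section semi_inner.
Context {R : realType} {T : Type}.
Variables (G : set (T -> R)) (J : (T -> R) -> (T -> R) -> R).
Hypothesis G0 : G (fun=> 0).
Hypothesis Glin : forall (a : R) f g, G f -> G g -> G (fun z => a * f z + g z).
Hypothesis JG : semi_inner_product G J.
Implicit Types (f g k : T -> R).

Lemma J_sym f g : G f -> G g -> J f g = J g f.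
Proof. by move=> Gf Gg; have [] := JG 0 Gf Gg Gf. Qed.

Lemma J_linl a f g k : G f -> G g -> G k ->
  J (fun z => a * f z + g z) k = a * J f k + J g k.
Proof. by move=> Gf Gg Gk; have [] := JG a Gf Gg Gk. Qed.

Lemma J_ge0 f : G f -> 0 <= J f f.
Proof. by move=> Gf; have [] := JG 0 Gf Gf Gf. Qed.

Lemma J_linr a f g k : G f -> G g -> G k ->
  J k (fun z => a * f z + g z) = a * J k f + J k g.
Proof.
move=> Gf Gg Gk; rewrite J_sym ?J_linl//; last exact: Glin.
by rewrite (J_sym Gf Gk) (J_sym Gg Gk).
Qed.

Lemma J_sqr a f g : G f -> G g ->
  J (fun z => a * f z + g z) (fun z => a * f z + g z) =
  a ^+ 2 * J f f + 2 * a * J f g + J g g.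
Proof.
move=> Gf Gg; rewrite J_linl ?J_linr//; try exact: Glin.
rewrite (J_sym Gg Gf); ring.
Qed.

Lemma Jnorm_ge0 f : 0 <= Jnorm J f.
Proof. exact: sqrtr_ge0. Qed.

Lemma Jnorm_sqr f : G f -> Jnorm J f ^+ 2 = J f f.
Proof. by move=> Gf; rewrite sqr_sqrtr// J_ge0. Qed.

Lemma J_cauchy f g : G f -> G g -> `|J f g| <= Jnorm J f * Jnorm J g.
Proof.
move=> Gf Gg.
have key a : 0 <= a ^+ 2 * J f f + 2 * a * J f g + J g g.
  by rewrite -J_sqr// J_ge0//; exact: Glin.
have sq : (J f g) ^+ 2 <= J f f * J g g.
  have [f0|f0] := eqVneq (J f f) 0.
    rewrite f0 mul0r; have [->|fg0] := eqVneq (J f g) 0; first by rewrite expr0n.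
    (* When [J f f = 0] the quadratic is affine in [a]; this [a] makes it equal to [- 1]. *)
    have := key (- (J g g + 1) / (2 * J f g)).
    rewrite f0 mulr0 add0r.
    have -> : 2 * (- (J g g + 1) / (2 * J f g)) * J f g + J g g = - 1 by field.
    by rewrite ler0N1.
  have fp : 0 < J f f by rewrite lt_neqAle eq_sym f0 J_ge0.
  have := key (- J f g / J f f).
  have -> : (- J f g / J f f) ^+ 2 * J f f + 2 * (- J f g / J f f) * J f g + J g g
     = J g g - (J f g) ^+ 2 / J f f by field.
  by rewrite subr_ge0 ler_pdivrMr// mulrC.
rewrite -(@ler_pXn2r _ 2%N)// ?nnegrE ?mulr_ge0 ?Jnorm_ge0//.
by rewrite exprMn !Jnorm_sqr// real_normK// num_real.
Qed.

Lemma Jnorm_lin a f g : G f -> G g ->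
  Jnorm J (fun z => a * f z + g z) <= `|a| * Jnorm J f + Jnorm J g.
Proof.
move=> Gf Gg.
rewrite -(@ler_pXn2r _ 2%N)// ?nnegrE ?addr_ge0 ?mulr_ge0 ?Jnorm_ge0//.
rewrite Jnorm_sqr ?J_sqr//; last exact: Glin.
rewrite sqrrD exprMn real_normK ?num_real// !Jnorm_sqr// lerD2r lerD2l.
rewrite -mulrA -[leRHS]mulr_natl ler_pM2l//.
apply: (le_trans (ler_norm _)); rewrite normrM -mulrA ler_wpM2l//.
exact: J_cauchy.
Qed.

Lemma Glin_sum (I : Type) (s : seq I) (v : I -> R) (h : I -> T -> R) :
  (forall j, G (h j)) -> G (fun z => \sum_(j <- s) v j * h j z).
Proof.
move=> Gh; elim: s => [|j s IH].
  rewrite [X in G X](_ : _ = (fun=> 0))//; apply/funext => z; exact: big_nil.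
rewrite [X in G X](_ : _ = (fun z => v j * h j z + \sum_(j <- s) v j * h j z)).
  exact: Glin.
by apply/funext => z; exact: big_cons.
Qed.

Lemma Jnorm0 : Jnorm J (fun=> 0) = 0.
Proof.
rewrite /Jnorm; have := @J_linl (-1) _ _ _ G0 G0 G0.
rewrite (_ : (fun z : T => -1 * 0 + 0) = (fun=> 0)); last first.
  by apply/funext => z; rewrite mulr0 addr0.
by rewrite mulN1r addNr => ->; rewrite sqrtr0.
Qed.

Lemma Jnorm_sum (I : Type) (s : seq I) (v : I -> R) (h : I -> T -> R) (C : R) :
  (forall j, G (h j)) -> (forall j, Jnorm J (h j) <= C) ->
  Jnorm J (fun z => \sum_(j <- s) v j * h j z) <= (\sum_(j <- s) `|v j|) * C.
Proof.
move=> Gh hC; elim: s => [|j s IH].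
  rewrite [X in Jnorm J X](_ : _ = (fun=> 0)) ?Jnorm0 ?big_nil ?mul0r//.
  by apply/funext => z; exact: big_nil.
rewrite [X in Jnorm J X](_ : _ = (fun z => v j * h j z + \sum_(j <- s) v j * h j z)).
  apply: (le_trans (Jnorm_lin _ (Gh j) (Glin_sum _ _ Gh))).
  by rewrite big_cons mulrDl lerD// ler_wpM2l.
by apply/funext => z; exact: big_cons.
Qed.

End semi_inner.

(** Nonnegativity of the sum of squared deviations of [x] from its mean over [S]. *)
Lemma sum_sqr_le {R : realType} {I : finType} (S : {set I}) (x : I -> R) :
  (\sum_(j in S) x j) ^+ 2 <= #|S|%:R * \sum_(j in S) (x j) ^+ 2.
Proof.
set s := \sum_(j in S) x j; set q := \sum_(j in S) _; set m : R := #|S|%:R.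
have [m0|m0] := eqVneq m 0.
  have S0 : S = finset.set0.
    by apply/eqP; rewrite -cards_eq0; move/eqP: m0; rewrite pnatr_eq0.
  by rewrite /s /q S0 !big_set0 expr0n mulr0.
have mp : 0 < m by rewrite lt_neqAle eq_sym m0 ler0n.
have : 0 <= \sum_(j in S) (x j - s / m) ^+ 2 by apply: sumr_ge0 => j _; exact: sqr_ge0.
under eq_bigr do rewrite sqrrB.
rewrite big_split/= sumrB -/q sumr_const -[X in _ + X]mulr_natl -/m.
rewrite sumrMnl -mulr_suml -/s.
have -> : q - (s * (s / m)) *+ 2 + m * (s / m) ^+ 2 = q - s ^+ 2 / m.
  by rewrite -mulr_natl; field.
by rewrite subr_ge0 ler_pdivrMr// mulrC.
Qed.

Lemma amgm_of_sqr {R : realType} (x c y : R) : 0 <= c -> 0 <= y ->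
  x ^+ 2 <= c * y -> 2 * x <= c + y.
Proof.
move=> c0 y0 xcy; rewrite leNgt; apply/negP => lt.
have : (c + y) ^+ 2 < (2 * x) ^+ 2 by rewrite ltrXn2r// ?nnegrE; nra.
have := sqr_ge0 (c - y); nra.
Qed.

(** Off the support of [b0] the penalty grows by [|D j|]; on it, by at least [- |D j|]. Twice the
    support part makes up the difference. *)
Lemma l1norm_ge {R : realType} {p : nat} (b0 D : 'cV[R]_p) :
  l1norm D - 2 * \sum_(j in [set j : 'I_p | b0 j ord0 != 0]%SET) `|D j ord0|
    <= l1norm (b0 + D) - l1norm b0.
Proof.
rewrite /l1norm -sumrB [X in _ - 2 * X]big_mkcond/= mulr_sumr -sumrB.
apply: ler_sum => j _.
rewrite inE mxE; case: eqVneq => [->|_]/=.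
  by rewrite add0r normr0 mulr0 !subr0 lexx.
have := ler_normB (b0 j ord0 + D j ord0) (D j ord0).
rewrite addrK; lra.
Qed.

(** If [a < 0], the chosen [t] makes [t * |k| < - a], so the linear term wins. It serves optimality
    along a segment and the first variation of a quadratic form. *)
Lemma ge0_of_quadratic {R : realType} (a k : R) :
  (forall t, 0 < t -> t <= 1 -> 0 <= t * a + t ^+ 2 * k) -> 0 <= a.
Proof.
move=> H; rewrite leNgt; apply/negP => a0.
pose t := - a / (`|k| - a + 1).
have d0 : 0 < `|k| - a + 1 by have := normr_ge0 k; lra.
have t0 : 0 < t by rewrite divr_gt0//; lra.
have t1 : t <= 1 by rewrite ler_pdivrMr// mul1r; have := normr_ge0 k; lra.
have := H t t0 t1.
have -> : t * a + t ^+ 2 * k = t * (a + t * k) by ring.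
rewrite pmulr_rge0// => ak.
have tk : t * k <= t * `|k| by rewrite ler_pM2l// ler_norm.
have : t * `|k| < - a.
  by rewrite /t mulrAC ltr_pdivrMr//; have := normr_ge0 k; nra.
lra.
Qed.

Lemma support_sizeE {R : realType} {p : nat} (b : 'cV[R]_p) :
  support_size b = #|[set j : 'I_p | b j ord0 != 0]%SET|.
Proof.
apply: eq_card => j; rewrite inE.
by apply/idP/idP; rewrite in_setE.
Qed.

(** Here [b] and [e] are the scaled empirical squares of [Xt D] and [eta], [L] is the scaled l1
    penalty, [G1] and [K] are [mu] times the seminorms of the scaled [gam] and of [g0], and
    [r = Rad ^+ 2]. Splitting [2 G1 K] leaves half of [G1 ^+ 2] on the left; the rest is linear. *)
Lemma localization_arith {R : realType} (b e L G1 K w1 w2 w3 sl B c r : R) :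
  0 <= b -> 0 <= e -> 0 <= L ->
  b + e + L + G1 ^+ 2 <= 2 * w1 + 2 * w2 + 2 * (- w3) + 2 * sl + 2 * (G1 * K) ->
  2 * sl <= 4 * c + B / 4 -> 4 * c <= 1000^-1 * r ->
  B <= b + 1000^-1 * L -> w1 <= 1000^-1 * L -> w2 <= 1000^-1 * (r / 40) ->
  - (2 * 1000^-1 * L) <= w3 -> K ^+ 2 <= r / 1600 -> 0 < r ->
  [/\ e + 1000^-1 * r < r, L < r & G1 ^+ 2 < r / 4].
Proof.
move=> b0 e0 L0 H sB c04 eB e1 e3 e4 KR r0.
have GK : 2 * (G1 * K) <= G1 ^+ 2 / 2 + 2 * K ^+ 2.
  by have := sqr_ge0 (G1 - 2 * K); lra.
have := sqr_ge0 G1; move: (G1 ^+ 2) (G1 * K) (K ^+ 2) H GK KR => g k K2 H GK KR g0.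
by split; lra.
Qed.

(** * Localization and the deterministic error bound *)

Section deterministic.
Context {R : realType} {T : Type} (n p : nat).
Variables (G : set (T -> R)) (J : (T -> R) -> (T -> R) -> R) (N2 : (T -> R) -> R).
Hypothesis G0 : G (fun=> 0).
Hypothesis Glin : forall (a : R) f g, G f -> G g -> G (fun z => a * f z + g z).
Hypothesis JG : semi_inner_product G J.
Hypothesis N2_ge0 : forall g, 0 <= N2 g.

Variables (x : 'I_n -> 'rV[R]_p) (Z : 'I_n -> T) (e : 'I_n -> R).
Variables (h : 'I_p -> T -> R) (S : 'M[R]_p) (b0 : 'cV[R]_p) (g0 : T -> R).
Variables (lam mu Rad LX Jh : R).
Hypothesis Gg0 : G g0.
Hypothesis Gh : forall j, G (h j).
Hypothesis Jh_le : forall j, Jnorm J (h j) <= Jh.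
Hypothesis Jh0 : 0 <= Jh.
Hypotheses (lam0 : 0 < lam) (mu0 : 0 < mu) (Rad0 : 0 < Rad) (LX0 : 0 < LX).

Variables d0 ep : R.
Hypotheses (d0E : d0 = 1000^-1) (epE : ep = 1000^-1).
Let ep_ge0 : 0 <= ep. Proof. by rewrite epE; lra. Qed.
Hypothesis mu_le : mu ^+ 2 <= d0 * Rad ^+ 2 / (2 * (1 + Jnorm J g0 + Jh) ^+ 2).
Hypothesis Rad_le : Rad ^+ 2 <= lam.
Hypothesis lam_le : lam <= 1.
Hypothesis s0_le : 4 * lam ^+ 2 * (support_size b0)%:R / LX ^+ 2 <= d0 * Rad ^+ 2.

Let xt i j := x i ord0 j - h j (Z i).
Let av (u v : 'I_n -> R) := n%:R^-1 * \sum_(i < n) u i * v i.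

Hypothesis S_ge : forall v : 'cV[R]_p, LX ^+ 2 * (\sum_j v j ord0 ^+ 2) <=
  \sum_j \sum_k v j ord0 * v k ord0 * S j k.
Hypothesis E1 : forall j, `|av e (xt^~ j)| <= ep * lam.
Hypothesis E2 : forall j k, `|av (xt^~ j) (xt^~ k) - S j k| <= ep * lam.
Hypothesis E3 : forall g T0, G g -> 0 < T0 -> N2 g <= T0 -> mu * Jnorm J g <= T0 ->
  `|av e (fun i => g (Z i))| <= ep * mu * T0.
Hypothesis E4 : forall g T0 j, G g -> 0 < T0 -> N2 g <= T0 -> mu * Jnorm J g <= T0 ->
  `|av (xt^~ j) (fun i => g (Z i))| <= ep * (lam + mu) * T0.
Hypothesis E5 : forall g T0, G g -> 0 < T0 -> N2 g <= T0 -> mu * Jnorm J g <= T0 ->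
  `|av (fun i => g (Z i)) (fun i => g (Z i)) - N2 g ^+ 2| <= ep * T0 ^+ 2.

Variables (bh : 'cV[R]_p) (gh : T -> R).
Let Y i := (x i *m b0) ord0 ord0 + g0 (Z i) + e i.
Let crit b g := n%:R^-1 * (\sum_(i < n) (Y i - (x i *m b) ord0 ord0 - g (Z i)) ^+ 2)
  + lam * l1norm b + mu ^+ 2 * (Jnorm J g) ^+ 2.
Hypothesis Ggh : G gh.
Hypothesis min_bh : forall b g, G g -> crit bh gh <= crit b g.

Let D := bh - b0.
Let hD := fun z => \sum_j D j ord0 * h j z.
Let gam := fun z => (-1) * g0 z + gh z.
Let eta := fun z => 1 * hD z + gam z.
Let xD i := \sum_j xt i j * D j ord0.
Let etaZ i := eta (Z i).

Lemma avC u v : av u v = av v u.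
Proof. by rewrite /av; congr (_ * _); apply: eq_bigr => i _; rewrite mulrC. Qed.

Lemma av_sumr u (v : 'I_p -> 'I_n -> R) (c : 'I_p -> R) :
  av u (fun i => \sum_j v j i * c j) = \sum_j c j * av u (v j).
Proof.
rewrite /av mulr_sumr; under eq_bigr do rewrite mulr_sumr mulr_sumr.
rewrite exchange_big/=; apply: eq_bigr => j _.
by rewrite !mulr_sumr; apply: eq_bigr => i _; ring.
Qed.

Lemma avBD a u v w : av (fun i => w i - a * u i - v i) (fun i => w i - a * u i - v i) =
  av w w + a ^+ 2 * av u u + av v v - 2 * a * av w u - 2 * av w v + 2 * a * av u v.
Proof.
rewrite /av !mulr_sumr -!sumrN -!big_split/=.
by apply: eq_bigr => i _; ring.
Qed.

Lemma resid b g i : Y i - (x i *m b) ord0 ord0 - g (Z i) =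
  e i - (x i *m (b - b0)) ord0 ord0 - (g (Z i) - g0 (Z i)).
Proof. by rewrite /Y mulmxBr !mxE; ring. Qed.

Lemma xmulE (v : 'cV[R]_p) i : (x i *m v) ord0 ord0 =
  \sum_j xt i j * v j ord0 + \sum_j v j ord0 * h j (Z i).
Proof.
by rewrite mxE -big_split/=; apply: eq_bigr => j _; rewrite /xt; ring.
Qed.

Let GhD : G hD. Proof. exact: Glin_sum. Qed.
Let Ggam : G gam. Proof. exact: Glin. Qed.
Let Geta : G eta. Proof. exact: Glin. Qed.

Let a1 := l1norm D.
Let s1 := \sum_(j in [set j : 'I_p | b0 j ord0 != 0]%SET) `|D j ord0|.
Let b2 := av xD xD.
Let en2 := av etaZ etaZ.
Let B2 := \sum_j \sum_k D j ord0 * D k ord0 * S j k.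
Let c0 := (support_size b0)%:R * lam ^+ 2 / LX ^+ 2.

Let a1_ge0 : 0 <= a1. Proof. by apply: sumr_ge0. Qed.
Let av_ge0 u : 0 <= av u u.
Proof.
by rewrite mulr_ge0 ?invr_ge0 ?ler0n// sumr_ge0// => i _; rewrite -expr2 sqr_ge0.
Qed.

Let JhD : Jnorm J hD <= a1 * Jh.
Proof. exact: (Jnorm_sum G0 Glin JG (index_enum _) (fun j => D j ord0) Gh Jh_le). Qed.

Let Jeta_le : Jnorm J eta <= Jnorm J gam + a1 * Jh.
Proof.
apply: (le_trans (Jnorm_lin Glin JG 1 GhD Ggam)).
by rewrite normr1 mul1r addrC lerD2l.
Qed.

Let Jgam_le : Jnorm J gam <= Jnorm J eta + a1 * Jh.
Proof.
have -> : gam = (fun z => (-1) * hD z + eta z).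
  by apply/funext => z; rewrite /eta; ring.
apply: (le_trans (Jnorm_lin Glin JG (-1) GhD Geta)).
by rewrite normrN1 mul1r addrC lerD2l.
Qed.

Let Jgh_le : Jnorm J gh <= Jnorm J gam + Jnorm J g0.
Proof.
have -> : gh = (fun z => 1 * gam z + g0 z).
  by apply/funext => z; rewrite /gam; ring.
apply: (le_trans (Jnorm_lin Glin JG 1 Ggam Gg0)).
by rewrite normr1 mul1r.
Qed.

Let Jgh_sqr : Jnorm J gh ^+ 2 = J gam gam + 2 * J gam g0 + Jnorm J g0 ^+ 2.
Proof.
have -> : gh = (fun z => 1 * gam z + g0 z).
  by apply/funext => z; rewrite /gam; ring.
rewrite !(Jnorm_sqr JG)//; last exact: Glin.
by rewrite (J_sqr Glin JG)//; ring.
Qed.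

Let e_xD : `|av e xD| <= ep * lam * a1.
Proof.
rewrite av_sumr (le_trans (ler_norm_sum _ _ _))// mulr_sumr.
by apply: ler_sum => j _; rewrite normrM mulrC ler_wpM2r.
Qed.

Let b2_B2 : `|b2 - B2| <= ep * lam * a1 ^+ 2.
Proof.
have -> : ep * lam * a1 ^+ 2 = \sum_j `|D j ord0| * (ep * lam * a1).
  by rewrite -mulr_suml -/(l1norm D) -/a1; ring.
rewrite /b2 av_sumr /B2 -sumrB.
rewrite (le_trans (ler_norm_sum _ _ _))//; apply: ler_sum => j _.
rewrite avC av_sumr.
have -> : D j ord0 * (\sum_k D k ord0 * av (xt^~ j) (xt^~ k)) - \sum_k D j ord0 * D k ord0 * S j k
  = D j ord0 * \sum_k D k ord0 * (av (xt^~ j) (xt^~ k) - S j k).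
  rewrite !mulr_sumr -sumrB; apply: eq_bigr => k _; ring.
rewrite normrM ler_wpM2l// (le_trans (ler_norm_sum _ _ _))// /a1 /l1norm mulr_sumr.
by apply: ler_sum => k _; rewrite normrM mulrC ler_wpM2r.
Qed.

Let xD_eta T0 : 0 < T0 -> N2 eta <= T0 -> mu * Jnorm J eta <= T0 ->
  `|av xD etaZ| <= ep * (lam + mu) * T0 * a1.
Proof.
move=> T00 N2T JT; rewrite avC av_sumr (le_trans (ler_norm_sum _ _ _))// mulr_sumr.
by apply: ler_sum => j _; rewrite normrM mulrC ler_wpM2r// avC E4.
Qed.

(** Cauchy-Schwarz on the support followed by the eigenvalue bound [S_ge], whence the sparsity and
    [LX] in [c0]. *)
Let s1_sqr : (lam * s1) ^+ 2 <= c0 * B2.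
Proof.
have s1D : s1 ^+ 2 <= (support_size b0)%:R * \sum_j D j ord0 ^+ 2.
  apply: (le_trans (sum_sqr_le _ _)); rewrite support_sizeE; apply: ler_wpM2l; first exact: ler0n.
  under eq_bigr do rewrite real_normK ?num_real//.
  rewrite [leRHS](bigID (mem [set j : 'I_p | b0 j ord0 != 0]%SET))/= lerDl.
  by apply: sumr_ge0 => j _; exact: sqr_ge0.
have s0 : 0 <= (support_size b0)%:R :> R by rewrite ler0n.
rewrite /c0 exprMn.
have -> : (support_size b0)%:R * lam ^+ 2 / LX ^+ 2 * B2 =
  lam ^+ 2 * ((support_size b0)%:R * (B2 / LX ^+ 2)) by ring.
rewrite ler_wpM2l ?sqr_ge0// (le_trans s1D)// ler_wpM2l//.
by rewrite ler_pdivlMr ?exprn_gt0// mulrC S_ge.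
Qed.

Let B2_ge0 : 0 <= B2.
Proof.
apply: le_trans (S_ge D); rewrite mulr_ge0 ?sqr_ge0// sumr_ge0// => j _.
exact: sqr_ge0.
Qed.

Let c0_ge0 : 0 <= c0.
Proof. by rewrite /c0 divr_ge0 ?sqr_ge0// mulr_ge0 ?ler0n ?sqr_ge0. Qed.

Let muJ : mu * (1 + Jnorm J g0 + Jh) <= Rad / 40.
Proof.
have J0 := Jnorm_ge0 J g0; have H0 := mu_le.
have q0 : 0 < 1 + Jnorm J g0 + Jh by rewrite ltr_wpDr// ltr_wpDr.
set q := 1 + Jnorm J g0 + Jh in q0 H0 *.
(* Squared, with [d0 = 1/1000], the left side is at most [Rad^2 / 2000], below [(Rad / 40)^2]. *)
rewrite -(@ler_pXn2r _ 2%N)// ?nnegrE ?divr_ge0 ?mulr_ge0 ?(ltW mu0) ?(ltW Rad0) ?(ltW q0)//.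
move: H0; rewrite ler_pdivlMr; last by rewrite mulr_gt0// exprn_gt0.
rewrite !exprMn d0E exprVn => H.
have : 0 <= Rad ^+ 2 by exact: sqr_ge0.
by rewrite -[40 ^+ 2]natrX; lra.
Qed.

(** Compares the criterion with its value at [(b0, g0)]. Expanding [J(gh)^2] around [g0] keeps
    [mu^2 J(gam)^2] on the left; the cross term with [g0] is paid by Cauchy-Schwarz. *)
Lemma basic_ineq : b2 + en2 + lam * a1 + mu ^+ 2 * Jnorm J gam ^+ 2 <=
  2 * av e xD + 2 * av e etaZ - 2 * av xD etaZ + 2 * (lam * s1)
  + 2 * mu ^+ 2 * (Jnorm J gam * Jnorm J g0).
Proof.
have := min_bh b0 Gg0; rewrite /crit.
under eq_bigr do rewrite resid.
under [X in _ <= _ * X + _ + _ -> _]eq_bigr do rewrite resid.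
have -> : n%:R^-1 * \sum_(i < n) (e i - (x i *m (bh - b0)) ord0 ord0 - (gh (Z i) - g0 (Z i))) ^+ 2
   = av (fun i => e i - 1 * xD i - etaZ i) (fun i => e i - 1 * xD i - etaZ i).
  congr (_ * _); apply: eq_bigr => i _; rewrite xmulE -/D -expr2; congr (_ ^+ 2).
  by rewrite /etaZ /eta /gam /hD /xD; ring.
have -> : n%:R^-1 * \sum_(i < n) (e i - (x i *m (b0 - b0)) ord0 ord0 - (g0 (Z i) - g0 (Z i))) ^+ 2
   = av e e.
  congr (_ * _); apply: eq_bigr => i _.
  by rewrite subrr mulmx0 mxE !subr0 subrr subr0 expr2.
rewrite avBD Jgh_sqr -(Jnorm_sqr JG Ggam).
have := l1norm_ge b0 D; rewrite {1}/D [b0 + _]addrC subrK -/s1 -/a1 => l1.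
have := J_cauchy Glin JG Ggam Gg0; rewrite ler_norml => /andP[Jc _].
have Hl := ler_wpM2l (ltW lam0) l1.
have Hj := ler_wpM2l (sqr_ge0 mu) Jc.
rewrite /b2 /en2; lra.
Qed.

(** [M] is the largest ratio of the three quantities to their targets. If [M > 1], shrinking the
    error by [t = 1 / M] puts it on the boundary of the target region, while the basic inequality
    puts it strictly inside. [E3], [E4] and [E5] are used at level [Rad * M], and the powers of [t]
    bring them back to level [Rad]. *)
Lemma localization : [/\ lam * a1 <= Rad ^+ 2, N2 eta <= Rad & mu * Jnorm J eta <= Rad].
Proof.
pose r1 := lam * a1 / Rad ^+ 2; pose r2 := N2 eta / Rad.
pose r3 := mu * Jnorm J eta / Rad.
pose M := Num.max (Num.max r1 r2) r3.
have R2 : 0 < Rad ^+ 2 by exact: exprn_gt0.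
have half : Rad / 2 + Rad / 40 * 1 <= Rad by have R0 := Rad0; lra.
have [M1|M1] := leP M 1.
  move: M1; rewrite /M !ge_max => /andP[/andP[]].
  by rewrite !ler_pdivrMr// !mul1r => -> -> ->.
have M0 : 0 < M by lra.
have r1M : r1 <= M by rewrite /M !le_max lexx.
have r2M : r2 <= M by rewrite /M !le_max lexx orbT.
have r3M : r3 <= M by rewrite /M !le_max lexx !orbT.
exfalso.
pose t := M^-1.
have t0 : 0 < t by rewrite invr_gt0.
have t1 : t <= 1 by rewrite invf_le1// ltW.
have tM : t * M = 1 by rewrite mulVf// gt_eqF.
have tt : t ^+ 2 <= t by rewrite expr2 ler_piMl// ltW.
have RM0 : 0 < Rad * M by rewrite mulr_gt0.
have N2M : N2 eta <= Rad * M by rewrite mulrC -ler_pdivrMr.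
have JM : mu * Jnorm J eta <= Rad * M by rewrite [leRHS]mulrC -ler_pdivrMr.
have tL : t * (lam * a1) <= Rad ^+ 2.
  have : lam * a1 <= M * Rad ^+ 2 by rewrite -ler_pdivrMr.
  by move/(ler_wpM2l (ltW t0)); rewrite [leRHS]mulrA tM mul1r.
(* From [Rad ^+ 2 <= lam]. It turns the deviation of [b2] from [B2], quadratic in [a1], into a small
   multiple of the l1 penalty. *)
have ta1 : t * a1 <= 1.
  by rewrite -(ler_pM2l lam0) mulr1 mulrCA (le_trans tL).
have ta0 : 0 <= t * a1 by rewrite mulr_ge0// ltW.
have e3 : t * av e etaZ <= ep * mu * Rad.
  have := E3 Geta RM0 N2M JM; rewrite ler_norml => /andP[_ H].
  apply: (le_trans (ler_wpM2l (ltW t0) H)).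
  have -> : t * (ep * mu * (Rad * M)) = ep * mu * Rad * (t * M) by ring.
  by rewrite tM mulr1.
have e4 : `|t ^+ 2 * av xD etaZ| <= ep * (lam + mu) * Rad * (t * a1).
  rewrite normrM ger0_norm ?sqr_ge0//.
  apply: (le_trans (ler_wpM2l (sqr_ge0 t) (xD_eta RM0 N2M JM))).
  have -> : t ^+ 2 * (ep * (lam + mu) * (Rad * M) * a1) =
    ep * (lam + mu) * Rad * (t * a1) * (t * M) by ring.
  by rewrite tM mulr1.
have e5 : `|t ^+ 2 * en2 - (t * N2 eta) ^+ 2| <= ep * Rad ^+ 2.
  rewrite exprMn -mulrBr normrM ger0_norm ?sqr_ge0//.
  apply: (le_trans (ler_wpM2l (sqr_ge0 t) (E5 Geta RM0 N2M JM))).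
  have -> : t ^+ 2 * (ep * (Rad * M) ^+ 2) = ep * Rad ^+ 2 * (t * M) ^+ 2 by ring.
  by rewrite tM expr1n mulr1.
have e1 : t * av e xD <= ep * (t * (lam * a1)).
  have := e_xD; rewrite ler_norml => /andP[_ H].
  by apply: (le_trans (ler_wpM2l (ltW t0) H)); apply: le_of_eq; ring.
have eB : t ^+ 2 * B2 <= t ^+ 2 * b2 + ep * (t * (lam * a1)).
  have := b2_B2; rewrite ler_norml => /andP[H _].
  have H1 := ler_wpM2l (sqr_ge0 t) H.
  have : ep * (lam * (t * a1)) * (t * a1) <= ep * (lam * (t * a1)) * 1.
    by rewrite ler_wpM2l// !mulr_ge0 ?(ltW lam0) ?(ltW t0).
  lra.
have sB : 2 * (t * (lam * s1)) <= 4 * c0 + t ^+ 2 * B2 / 4.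
  apply: amgm_of_sqr; [exact: mulr_ge0|by apply: divr_ge0 => //; apply: mulr_ge0 => //; exact: sqr_ge0|].
  rewrite exprMn; apply: (le_trans (ler_wpM2l (sqr_ge0 t) s1_sqr)).
  by apply: le_of_eq; field.
have c04 : 4 * c0 <= d0 * Rad ^+ 2 by apply: le_trans s0_le; apply: le_of_eq; rewrite /c0; ring.
have J0 := Jnorm_ge0 J g0; have Jg := Jnorm_ge0 J gam; have Je := Jnorm_ge0 J eta.
have muR : mu <= Rad / 40 by apply: le_trans muJ; rewrite ler_peMr ?(ltW mu0)// -addrA lerDl addr_ge0.
have Rad1 : Rad <= 1.
  by rewrite -(@ler_pXn2r _ 2%N)// ?nnegrE ?(ltW Rad0)// expr1n (le_trans Rad_le).
have H := ler_wpM2l (ltW t0) basic_ineq.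
have muJ0 : mu * Jnorm J g0 <= Rad / 40.
  by apply: le_trans muJ; rewrite ler_wpM2l ?(ltW mu0)// -addrA [1 + _]addrC -addrA lerDl addr_ge0.
have muJh : mu * Jh <= Rad / 40.
  by apply: le_trans muJ; rewrite ler_wpM2l ?(ltW mu0)// lerDr addr_ge0.
pose G1 := t * (mu * Jnorm J gam); pose K0 := mu * Jnorm J g0.
have G10 : 0 <= G1 by rewrite !mulr_ge0 ?(ltW t0) ?(ltW mu0).
have K00 : 0 <= K0 by rewrite mulr_ge0 ?(ltW mu0).
have L0 : 0 <= t * (lam * a1) by rewrite !mulr_ge0 ?(ltW t0) ?(ltW lam0).
have lamR : lam * Rad <= lam * 1 by rewrite ler_wpM2l// ltW.
have muRad : mu * Rad <= Rad / 40 * Rad by rewrite ler_wpM2r// ltW.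
have Rl := Rad_le; have l0 := lam0; have R0 := Rad0.
have e4' : ep * (lam + mu) * Rad * (t * a1) <= 2 * ep * (t * (lam * a1)).
  have -> : ep * (lam + mu) * Rad * (t * a1) = ep * (t * a1) * ((lam + mu) * Rad) by ring.
  have -> : 2 * ep * (t * (lam * a1)) = ep * (t * a1) * (2 * lam) by ring.
  by rewrite ler_wpM2l// ?mulr_ge0//; lra.
move: e4; rewrite ler_norml => /andP[e4 _].
move: e5; rewrite ler_norml => /andP[e5 _].
have b2t : t ^+ 2 * b2 <= t * b2 by rewrite ler_wpM2r ?av_ge0.
have en2t : t ^+ 2 * en2 <= t * en2 by rewrite ler_wpM2r ?av_ge0.
(* The scaled error [t D], [t eta] satisfies the basic inequality too, since
   [t ^+ 2 <= t] and the quadratic terms on the left dominate. *)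
have H' : t ^+ 2 * b2 + t ^+ 2 * en2 + t * (lam * a1) + G1 ^+ 2 <=
   2 * (t * av e xD) + 2 * (t * av e etaZ) + 2 * (- (t ^+ 2 * av xD etaZ)) + 2 * (t * (lam * s1))
   + 2 * (G1 * K0).
  have q0 : 0 <= b2 + en2 + 2 * av xD etaZ.
    rewrite (_ : _ + _ = av (fun i => xD i + etaZ i) (fun i => xD i + etaZ i))//.
    rewrite /b2 /en2 /av !mulr_sumr -!big_split/=.
    by apply: eq_bigr => i _; ring.
  have q1 : 0 <= mu ^+ 2 * Jnorm J gam ^+ 2 by rewrite mulr_ge0 ?sqr_ge0.
  have Hq := ler_wpM2r (addr_ge0 q0 q1) tt.
  rewrite /G1 /K0; lra.
have K0R : K0 ^+ 2 <= Rad ^+ 2 / 1600.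
  have -> : Rad ^+ 2 / 1600 = (Rad / 40) ^+ 2 by field.
  by rewrite lerXn2r ?nnegrE ?divr_ge0 ?(ltW Rad0).
have e3' : t * av e etaZ <= ep * (Rad ^+ 2 / 40).
  apply: (le_trans e3); rewrite -mulrA; apply: ler_wpM2l => //.
  by apply: (le_trans muRad); rewrite mulrAC expr2.
have b2t0 : 0 <= t ^+ 2 * b2 by rewrite mulr_ge0 ?sqr_ge0 ?av_ge0.
have en2t0 : 0 <= t ^+ 2 * en2 by rewrite mulr_ge0 ?sqr_ge0 ?av_ge0.
have e4'' : - (2 * ep * (t * (lam * a1))) <= t ^+ 2 * av xD etaZ.
  by apply: le_trans e4; rewrite lerN2.
rewrite epE d0E in eB c04 e1 e3' e4'' e5.
have [concl_e concl_L concl_G] :=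
  localization_arith b2t0 en2t0 L0 H' sB c04 eB e1 e3' e4'' K0R R2.
have c1 : t * r1 < 1.
  by rewrite /r1 mulrA ltr_pdivrMr// mul1r.
have c2 : t * r2 < 1.
  rewrite /r2 mulrA ltr_pdivrMr// mul1r.
  rewrite -(@ltr_pXn2r _ 2%N)// ?nnegrE ?mulr_ge0 ?(ltW t0) ?(ltW Rad0)//.
  by apply: le_lt_trans concl_e; move: e5; rewrite lerBrDl lerBlDr.
(* [eta] differs from [gam] by [hD], whose scaled seminorm costs at most [Rad / 40]; [G1 < Rad / 2]
   leaves room for it. *)
have c3 : t * r3 < 1.
  rewrite /r3 mulrA ltr_pdivrMr// mul1r.
  have G1R : G1 < Rad / 2.
    rewrite -(@ltr_pXn2r _ 2%N)// ?nnegrE ?divr_ge0 ?(ltW Rad0)//.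
    by have -> : (Rad / 2) ^+ 2 = Rad ^+ 2 / 4 by field.
  have Jeta_G1 : t * (mu * Jnorm J eta) <= G1 + mu * Jh * (t * a1).
    apply: (le_trans (ler_wpM2l (ltW t0) (ler_wpM2l (ltW mu0) Jeta_le))).
    by apply: le_of_eq; rewrite /G1; ring.
  apply: (le_lt_trans Jeta_G1); apply: lt_le_trans half.
  by rewrite ltr_leD// ler_pM// mulr_ge0 ?(ltW mu0).
have : t * M < 1.
  rewrite /M; have [_|_] := leP r3 (Num.max r1 r2); rewrite ?maxElt.
    by case: ifP.
  by [].
by rewrite tM ltxx.
Qed.

(** The first-order condition puts [2 * b2] on the left. One copy pays for [2 lam s1 <= c0 + B2],
    since [B2] is close to [b2]; the remaining errors are small multiples of [lam * a1]. *)
Lemma deterministic_bound : b2 + lam / 4 * a1 <= c0.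
Proof.
have [L1 N1 J1] := localization.
have muR : mu <= Rad / 40.
  have J0 := Jnorm_ge0 J g0.
  by apply: le_trans muJ; rewrite ler_peMr ?(ltW mu0)// -addrA lerDl addr_ge0.
have R2 : 0 < Rad ^+ 2 by exact: exprn_gt0.
have Rad1 : Rad <= 1.
  by rewrite -(@ler_pXn2r _ 2%N)// ?nnegrE ?(ltW Rad0)// expr1n (le_trans Rad_le).
have a11 : a1 <= 1 by rewrite -(ler_pM2l lam0) mulr1 (le_trans L1).
have first_order : 0 <= 2 * (av e xD - b2 - av xD etaZ)
    + lam * (2 * s1 - a1) + 2 * mu ^+ 2 * J hD gh.
  apply: (@ge0_of_quadratic _ _ (b2 + mu ^+ 2 * J hD hD)) => t t0 t1.
  have := min_bh (bh - t *: D) (Glin t GhD Ggh); rewrite /crit.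
  under eq_bigr do rewrite resid.
  have -> : n%:R^-1 * \sum_(i < n) (e i - (x i *m (bh - b0)) ord0 ord0 - (gh (Z i) - g0 (Z i))) ^+ 2
     = av (fun i => e i - 1 * xD i - etaZ i) (fun i => e i - 1 * xD i - etaZ i).
    congr (_ * _); apply: eq_bigr => i _; rewrite xmulE -/D -expr2; congr (_ ^+ 2).
    by rewrite /etaZ /eta /gam /hD /xD; ring.
  have -> : n%:R^-1 * \sum_(i < n) (Y i - (x i *m (bh - t *: D)) ord0 ord0 -
      (t * hD (Z i) + gh (Z i))) ^+ 2
     = av (fun i => e i - (1 - t) * xD i - etaZ i) (fun i => e i - (1 - t) * xD i - etaZ i).
    congr (_ * _); apply: eq_bigr => i _; rewrite -expr2; congr (_ ^+ 2).
    rewrite [LHS](resid (bh - t *: D) (fun z => t * hD z + gh z)).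
    rewrite (_ : bh - t *: D - b0 = (1 - t) *: D); last first.
      by rewrite scalerBl scale1r addrAC.
    rewrite -scalemxAr mxE xmulE.
    rewrite -/(xD i) -/(hD (Z i)) /etaZ /eta /gam; ring.
  rewrite !avBD (Jnorm_sqr JG Ggh) (Jnorm_sqr JG (Glin t GhD Ggh)) (J_sqr Glin JG)//.
  have l1 : l1norm (bh - t *: D) <= l1norm bh - t * (a1 - 2 * s1).
    have : l1norm (bh - t *: D) <= (1 - t) * l1norm bh + t * l1norm b0.
      rewrite /l1norm !mulr_sumr -big_split/=; apply: ler_sum => j _.
      have -> : (bh - t *: D) j ord0 = (1 - t) * bh j ord0 + t * b0 j ord0.
        by rewrite !mxE; ring.
      apply: (le_trans (ler_normD _ _)); rewrite !normrM.
      by rewrite (ger0_norm (ltW t0)) ger0_norm// subr_ge0.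
    have := l1norm_ge b0 D; rewrite {1}/D [b0 + _]addrC subrK -/s1 -/a1 => l1.
    have := ler_wpM2l (ltW t0) l1; lra.
  have := ler_wpM2l (ltW lam0) l1.
  rewrite -/b2 -/en2; lra.
(* Derivative of the smoothness penalty: [mu J(hD) <= a1 Rad / 40] and [mu J(gh) <= 2 Rad] give at
   most [a1 Rad^2 / 10], and [Rad^2 <= lam]. *)
have Jb : 2 * mu ^+ 2 * J hD gh <= lam * a1 / 10.
  have := J_cauchy Glin JG GhD Ggh; rewrite ler_norml => /andP[_ Jc].
  have J0 := Jnorm_ge0 J g0; have Jg := Jnorm_ge0 J gh.
  have muJh : mu * Jh <= Rad / 40.
    by apply: le_trans muJ; rewrite ler_wpM2l ?(ltW mu0)// lerDr addr_ge0.
  have muJ0 : mu * Jnorm J g0 <= Rad / 40.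
    by apply: le_trans muJ; rewrite ler_wpM2l ?(ltW mu0)// -addrA [1 + _]addrC -addrA lerDl addr_ge0.
  have muJh0 : 0 <= mu * Jh by rewrite mulr_ge0 ?(ltW mu0).
  have muJgh : mu * Jnorm J gh <= 2 * Rad.
    have H1 := ler_wpM2l (ltW mu0) Jgh_le; have H2 := ler_wpM2l (ltW mu0) Jgam_le.
    have : mu * Jh * a1 <= Rad / 40 * 1 by rewrite ler_pM.
    lra.
  apply: (@le_trans _ _ (2 * (mu * (a1 * Jh) * (mu * Jnorm J gh)))).
    have : mu ^+ 2 * J hD gh <= mu ^+ 2 * ((a1 * Jh) * Jnorm J gh).
      rewrite ler_wpM2l ?sqr_ge0// (le_trans Jc)// ler_wpM2r//.
    lra.
  have : (a1 * (mu * Jh)) * (mu * Jnorm J gh) <= (a1 * (Rad / 40)) * (2 * Rad).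
    rewrite ler_pM// ?mulr_ge0 ?(ltW mu0)//.
    by rewrite ler_wpM2l.
  have := ler_wpM2l a1_ge0 Rad_le; rewrite expr2; lra.
have := xD_eta Rad0 N1 J1; rewrite ler_norml => /andP[e4 _].
have lamR : lam * Rad <= lam * 1 by rewrite ler_wpM2l// ltW.
have muRad : mu * Rad <= Rad / 40 * Rad by rewrite ler_wpM2r// ltW.
have Rl := Rad_le; have l0 := lam0; have R0 := Rad0.
have e4' : ep * (lam + mu) * Rad * a1 <= 2 * ep * (lam * a1).
  have -> : ep * (lam + mu) * Rad * a1 = ep * a1 * ((lam + mu) * Rad) by ring.
  have -> : 2 * ep * (lam * a1) = ep * a1 * (2 * lam) by ring.
  by rewrite ler_wpM2l// ?mulr_ge0//; lra.
have := e_xD; rewrite ler_norml => /andP[_ e1].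
have sB : 2 * (lam * s1) <= c0 + B2 by exact: amgm_of_sqr.
have eB : B2 <= b2 + ep * (lam * a1).
  have := b2_B2; rewrite ler_norml => /andP[H _].
  have : ep * (lam * a1) * a1 <= ep * (lam * a1) * 1.
    by rewrite ler_wpM2l// !mulr_ge0 ?(ltW lam0).
  lra.
have L0 : 0 <= lam * a1 by rewrite mulr_ge0 ?(ltW lam0).
rewrite epE in e1 e4 e4' eB; lra.
Qed.

End deterministic.

(** * Chaining *)

(* The centres of a cover lie in [G] only; moving them into [C] costs the factor 2. *)
Lemma entropy_net {R : realType} {T : Type} (G C : set (T -> R)) (f0 : T -> R) (u H : R) :
  C f0 -> (sup_entropy G C u <= H%:E)%E ->
  exists (N : nat) (c : nat -> T -> R),
    [/\ forall k, C (c k), N%:R <= expR (H + 1) &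
        forall f, C f -> exists2 k, (k < N)%N & forall z, `|f z - c k z| <= 2 * u].
Proof.
move=> Cf0 ent.
(* The slack 1 turns a bound on the infimum into an actual cover. *)
have : (sup_entropy G C u < (H + 1)%:E)%E.
  by rewrite (le_lt_trans ent)// lte_fin ltrDl.
move=> /ereal_inf_lt[_ [N [c [[Gc cov] ->]]]]; rewrite lte_fin => lnN.
have N0 : (0 < N)%N by have [k _] := cov _ Cf0; exact: leq_ltn_trans (ltn_ord k).
(* A cell that meets [C] gets a centre in [C]; other cells and indices beyond [N] get the default
   [f0], so that the net is total on [nat]. *)
have /choice[c' c'P] : forall k : nat, exists g, C g /\
    forall kN : (k < N)%N, (exists f, C f /\ forall z, `|f z - c (Ordinal kN) z| <= u) ->
      forall z, `|g z - c (Ordinal kN) z| <= u.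
  move=> k; have [kN|Nk] := pselect (k < N)%N; last by exists f0; split.
  have [[f [Cf fc]]|nex] := pselect (exists f, C f /\ forall z, `|f z - c (Ordinal kN) z| <= u).
    by exists f; split => // kN' _ z; rewrite (bool_irrelevance kN' kN).
  by exists f0; split => // kN'; rewrite (bool_irrelevance kN' kN).
exists N, c'; split => [k||f Cf].
- by have [] := c'P k.
- rewrite -(@lnK _ N%:R) ?posrE ?ltr0n//.
  by rewrite ler_expR ltW.
- have [k fk] := cov _ Cf; exists k => // z.
  have [_ /(_ (ltn_ord k))] := c'P k.
  have -> : Ordinal (ltn_ord k) = k by exact/val_inj.
  move=> /(_ (ex_intro _ f (conj Cf fk))) /(_ z).
  by have := fk z; rewrite !ler_norml => /andP[? ?] /andP[? ?]; apply/andP; split; lra.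
Qed.

Lemma half_pow_small {R : realType} (x t : R) : 0 < t -> exists S : nat, x / 2 ^+ S <= t.
Proof.
move=> t0; exists (Num.truncn (`|x| / t)).+1.
pose S := (Num.truncn (`|x| / t)).+1; rewrite -/S; have S0 : 0 < 2 ^+ S :> R by rewrite exprn_gt0.
have xS : `|x| / t <= 2 ^+ S.
  apply: (@le_trans _ _ S%:R); first by apply: ltW; rewrite /S truncnS_gt.
  by rewrite -natrX ler_nat ltnW// ltn_expl.
rewrite ler_pdivrMr//; apply: (le_trans (ler_norm x)).
by move: xS; rewrite ler_pdivrMr// mulrC.
Qed.

(* [Bp f] controls [Z f] at the points of the coarsest net.  It is left abstract
   because for products with the noise it is a self-normalised bound, which only
   becomes deterministic once the empirical norms of [C] are controlled. *)
Section chaining.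
Context {R : realType} {d : measure_display} {Om : measurableType d}.
Variables (P : probability Om R) (T : Type) (C : set (T -> R)).
Variables (Z : (T -> R) -> Om -> R) (Bp : (T -> R) -> Om -> Prop).
Variables (mu AE rho q W t M : R).
Hypotheses (q_ge0 : 0 <= q) (q_le1 : q <= 1) (rho_ge2 : 2 <= rho) (AE_ge0 : 0 <= AE).
Hypotheses (W_ge : 8 * AE <= W) (W_ge8 : 8 <= W) (t0 : 0 < t).
Hypothesis nets : forall s : nat, exists (N : nat) (c : nat -> T -> R),
    [/\ forall k, C (c k), N%:R <= expR (AE * rho ^+ s + 1) &
        forall f, C f -> exists2 k, (k < N)%N & forall z, `|f z - c k z| <= 2 * (mu / 2 ^+ s)].
Hypothesis link : forall (s : nat) f g, C f -> C g ->
  (forall z, `|f z - g z| <= 6 * (mu / 2 ^+ s)) ->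
  whp P (2 * expR (- (W * rho ^+ s))) (fun w => `|Z f w - Z g w| <= t * (1 - q) * q ^+ s).
Hypothesis base : forall f, C f -> whp P (2 * expR (- W)) (Bp f).

(** [W >= 8 * AE] pays for both nets with a quarter of the exponent, [W >= 8] for the two added
    units with another quarter; the remaining half dominates [(s + 2) W / 2] because
    [s + 2 <= 2^(s+1) <= rho^(s+1)]. *)
Lemma link_count (a b : R) (s : nat) : 0 <= a -> 0 <= b ->
  a <= expR (AE * rho ^+ s.+1 + 1) -> b <= expR (AE * rho ^+ s + 1) ->
  a * (b * (2 * expR (- (W * rho ^+ s.+1)))) <= 2 * (expR (- (W / 2))) ^+ s.+2.
Proof.
move=> a0 b0 aN bN.
have W8 := W_ge8; have WA := W_ge; have rho2 := rho_ge2; have A0 := AE_ge0.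
rewrite mulrA mulrCA ler_pM2l//.
apply: (@le_trans _ _ (expR (AE * rho ^+ s.+1 + 1) * expR (AE * rho ^+ s + 1) * expR (- (W * rho ^+ s.+1)))).
  by rewrite ler_wpM2r ?expR_ge0// ler_pM.
rewrite -!expRD -expRM_natl ler_expR.
have r1 : 1 <= rho ^+ s by rewrite exprn_ege1//; lra.
have rS : rho ^+ s <= rho ^+ s.+1 by rewrite exprS ler_peMl; lra.
have rs : s.+2%:R <= rho ^+ s.+1.
  apply: (@le_trans _ _ (2 ^+ s.+1)); first by rewrite -natrX ler_nat ltn_expl.
  by rewrite lerXn2r ?nnegrE//; lra.
have h1 : AE * rho ^+ s <= AE * rho ^+ s.+1 by rewrite ler_wpM2l.
have h2 : 8 * AE * rho ^+ s.+1 <= W * rho ^+ s.+1 by rewrite ler_wpM2r//; lra.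
have h3 : W * s.+2%:R <= W * rho ^+ s.+1 by rewrite ler_wpM2l//; lra.
have h4 : W * 1 <= W * rho ^+ s.+1 by rewrite ler_wpM2l//; lra.
lra.
Qed.

(** The chain stops at a finite level [S], where the Lipschitz constant [M] makes the remainder at
    most [t]; the links sum to at most [t]. The Lipschitz bound is a premise inside the event
    because for the noise it is random. *)
Lemma chaining : whp P (4 * expR (- (W / 2))) (fun w =>
  (forall f g u, C f -> C g -> (forall z, `|f z - g z| <= u) -> `|Z f w - Z g w| <= M * u) ->
  forall f, C f -> exists g, [/\ C g, Bp g w & `|Z f w - Z g w| <= 2 * t]).
Proof.
have W8 := W_ge8; have WA := W_ge; have rho2 := rho_ge2; have A0 := AE_ge0.
have [N /choice[c /all_and3[Cc Nle cov]]] := choice nets.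
have [S MS] := half_pow_small (2 * M * mu) t0.
pose x := expR (- (W / 2)).
have x0 : 0 <= x by exact: expR_ge0.
have x2 : 2 * x <= 1.
  rewrite /x expRN ler_pdivrMr ?expR_gt0// mul1r.
  by apply: (le_trans _ (expR_ge1Dx _)); lra.
have wl s : whp P (2 * x ^+ s.+2) (fun w => forall k, (k < N s.+1)%N -> forall l, (l < N s)%N ->
    (forall z, `|c s.+1 k z - c s l z| <= 6 * (mu / 2 ^+ s.+1)) ->
    `|Z (c s.+1 k) w - Z (c s l) w| <= t * (1 - q) * q ^+ s.+1).
  have q0 : 0 <= 2 * expR (- (W * rho ^+ s.+1)) by rewrite mulr_ge0// expR_ge0.
  have wk k : whp P ((N s)%:R * (2 * expR (- (W * rho ^+ s.+1)))) (fun w => forall l, (l < N s)%N ->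
      (forall z, `|c s.+1 k z - c s l z| <= 6 * (mu / 2 ^+ s.+1)) ->
      `|Z (c s.+1 k) w - Z (c s l) w| <= t * (1 - q) * q ^+ s.+1).
    apply: whp_natc => l lN.
    have [cl|ncl] := pselect (forall z, `|c s.+1 k z - c s l z| <= 6 * (mu / 2 ^+ s.+1)).
      by apply: whpW (link (Cc _ k) (Cc _ l) cl) (lexx _) _ => w Hw _.
    by apply: whpW (@whp_true _ _ _ P (fun=> True) _) q0 _.
  apply: whpW (whp_natc (fun k _ => wk k)) _ (fun w H => H).
  by apply: link_count => //; exact: Nle.
have wb : whp P (2 * x) (fun w => forall k, (k < N 0%N)%N -> Bp (c 0%N k) w).
  have wk k : whp P (2 * expR (- W)) (Bp (c 0%N k)) by exact: base.
  apply: whpW (whp_natc (fun k _ => wk k)) _ (fun w H => H).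
  rewrite mulrCA ler_pM2l//.
  apply: (le_trans (ler_wpM2r (expR_ge0 _) (Nle 0%N))).
  by rewrite expr0 mulr1 -expRD ler_expR; lra.
(* The spare term [2 * x ^+ S'.+1] pays for the next summand and the next spare term, because
   [2 * x <= 1]. *)
have sum_x S' : \sum_(s < S') 2 * x ^+ s.+2 + 2 * x ^+ S'.+1 <= 2 * x.
  elim: S' => [|k IH]; first by rewrite big_ord0 add0r expr1.
  rewrite big_ord_recr/= -addrA; apply: le_trans IH; rewrite lerD2l.
  have := exprn_ge0 k.+1 x0; rewrite [x ^+ k.+2]exprS; nra.
have wls := @whp_nat _ _ _ P S _ _ (fun s _ => wl s).
apply: whpW (whp_and wb wls) _ _.
  by have := sum_x S; have := exprn_ge0 S.+1 x0; rewrite -/x; lra.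
move=> w [Hb Hl] lip f Cf.
have /choice[k kP] : forall s, exists k, (k < N s)%N /\
    forall z, `|f z - c s k z| <= 2 * (mu / 2 ^+ s).
  by move=> s; have [k ? ?] := cov s f Cf; exists k.
exists (c 0%N (k 0%N)); split=> //; first by apply: Hb; case: (kP 0%N).
have tele s : (s <= S)%N ->
    `|Z (c s (k s)) w - Z (c 0%N (k 0%N)) w| <= t * (1 - q ^+ s).
  elim: s => [_|s IH sS]; first by rewrite subrr normr0 expr0 subrr mulr0.
  have {}IH := IH (ltnW sS).
  have [ks1 fs1] := kP s.+1; have [ks fs] := kP s.
  have H := Hl s sS _ ks1 _ ks.
  have {}H : `|Z (c s.+1 (k s.+1)) w - Z (c s (k s)) w| <= t * (1 - q) * q ^+ s.+1.
    apply: H => z; have := fs1 z; have := fs z; rewrite distrC => a1 a2.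
    have -> : c s.+1 (k s.+1) z - c s (k s) z =
       (c s.+1 (k s.+1) z - f z) - (c s (k s) z - f z) by ring.
    apply: (le_trans (ler_normB _ _)); rewrite [X in X + _]distrC.
    apply: (le_trans (lerD a2 a1)).
    (* The coarser radius is twice the finer one, so two centres near [f] are within [2 + 4 = 6]
       finer radii of each other. *)
    have -> : mu / 2 ^+ s = 2 * (mu / 2 ^+ s.+1).
      by rewrite exprS; field; rewrite expf_neq0.
    by apply: le_of_eq; ring.
  have -> : Z (c s.+1 (k s.+1)) w - Z (c 0%N (k 0%N)) w =
     (Z (c s.+1 (k s.+1)) w - Z (c s (k s)) w) + (Z (c s (k s)) w - Z (c 0%N (k 0%N)) w) by ring.
  apply: (le_trans (ler_normD _ _)); apply: (le_trans (lerD H IH)).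
  have qq : (1 - q) * q ^+ s.+1 <= q ^+ s - q ^+ s.+1.
    have := exprn_ge0 s q_ge0; have := q_le1; have := q_ge0.
    rewrite exprS => h0 h1 h2.
    have : 0 <= (1 - q) * (1 - q) * q ^+ s by rewrite !mulr_ge0// subr_ge0.
    lra.
  have := ler_wpM2l (ltW t0) qq; lra.
have lipS := lip f (c S (k S)) _ Cf (Cc S (k S)) (proj2 (kP S)).
have -> : Z f w - Z (c 0%N (k 0%N)) w =
   (Z f w - Z (c S (k S)) w) + (Z (c S (k S)) w - Z (c 0%N (k 0%N)) w) by ring.
apply: (le_trans (ler_normD _ _)).
have := tele S (leqnn S); have := exprn_ge0 S q_ge0 => qS.
have := mulr_ge0 (ltW t0) qS; lra.
Qed.

End chaining.

(** * Extreme eigenvalues *)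

Section rayleigh.
Context {R : realType} (p : nat).
Implicit Types (M : 'M[R]_p) (v : 'rV[R]_p).

(** Row vectors match [eigenvalue], which concerns left eigenvectors. *)
Definition qform M v : R := \sum_j \sum_k v ord0 j * v ord0 k * M j k.
Definition sqn v : R := \sum_j v ord0 j ^+ 2.

Lemma sqn_ge0 v : 0 <= sqn v.
Proof. by apply: sumr_ge0 => j _; exact: sqr_ge0. Qed.

Lemma sqn_eq0 v : sqn v = 0 -> v = 0.
Proof.
move/eqP; rewrite psumr_eq0 => [/allP H|j _]; last exact: sqr_ge0.
apply/rowP => j; rewrite mxE.
by have /eqP/eqP := H j (mem_index_enum _); rewrite sqrf_eq0 => /eqP.
Qed.

Lemma qformZ M a v : qform M (a *: v) = a ^+ 2 * qform M v.
Proof.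
rewrite /qform mulr_sumr; apply: eq_bigr => j _; rewrite mulr_sumr.
by apply: eq_bigr => k _; rewrite !mxE; ring.
Qed.

Lemma sqnZ a v : sqn (a *: v) = a ^+ 2 * sqn v.
Proof.
by rewrite /sqn mulr_sumr; apply: eq_bigr => j _; rewrite !mxE exprMn.
Qed.

Lemma qformD M t v u : (forall j k, M j k = M k j) ->
  qform M (v + t *: u) = qform M v + 2 * t * (\sum_k u ord0 k * (v *m M) ord0 k)
    + t ^+ 2 * qform M u.
Proof.
move=> symM.
have E1 : \sum_j \sum_k v ord0 j * u ord0 k * M j k =
    \sum_k u ord0 k * (v *m M) ord0 k.
  rewrite exchange_big/=; apply: eq_bigr => k _; rewrite mxE mulr_sumr.
  by apply: eq_bigr => j _; ring.
have E2 : \sum_j \sum_k u ord0 j * v ord0 k * M j k =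
    \sum_k u ord0 k * (v *m M) ord0 k.
  apply: eq_bigr => j _; rewrite mxE mulr_sumr; apply: eq_bigr => k _.
  by rewrite symM; ring.
rewrite [2 * t]mulrC -mulrA mulr_natl mulr2n -{1}E1 -E2 /qform mulrDr !mulr_sumr.
rewrite -!big_split/=; apply: eq_bigr => j _; rewrite !mulr_sumr -!big_split/=.
by apply: eq_bigr => k _; rewrite !mxE; ring.
Qed.

Lemma sqnD t v u :
  sqn (v + t *: u) = sqn v + 2 * t * (\sum_k u ord0 k * v ord0 k) + t ^+ 2 * sqn u.
Proof.
rewrite /sqn !mulr_sumr -!big_split/=; apply: eq_bigr => k _.
by rewrite !mxE; ring.
Qed.

Lemma continuous_sqn : continuous sqn.
Proof.
apply: continuous_big => [|j _]; first exact: add_continuous.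
move=> v; have C := @coord_continuous R _ _ ord0 j v.
exact: (cvgM C C).
Qed.

Lemma continuous_qform M : continuous (qform M).
Proof.
apply: continuous_big => [|j _]; first exact: add_continuous.
apply: continuous_big => [|k _]; first exact: add_continuous.
move=> v; have C i := @coord_continuous R _ _ ord0 i v.
exact: (cvgM (cvgM (C j) (C k)) (cvg_cst _)).
Qed.

Lemma sphere_compact : compact [set v | sqn v = 1].
Proof.
apply: bounded_closed_compact.
  exists 1; split; first exact: num_real.
  move=> r r1 v /= v1; apply: le_trans (ltW r1).
  rewrite [leLHS]/Num.norm/= mx_normrE; apply: bigmax_le => // -[i j] _ /=.
  rewrite (ord1 i) -(@ler_pXn2r _ 2%N)// ?nnegrE// expr1n real_normK ?num_real//.
  by rewrite -v1 /sqn (bigD1 j)//= lerDl sumr_ge0// => k _; exact: sqr_ge0.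
rewrite (_ : [set v | _] = sqn @^-1` [set 1]); last by [].
have /continuous_closedP := continuous_sqn; apply.
exact: closed_eq.
Qed.

(** No diagonalisation: the form attains its minimum on the compact unit sphere, and the minimum is
    itself an eigenvalue, hence at least [a]. The eigenvector of [a] shows that the sphere is not
    empty. *)
Lemma rayleigh_min M a : (forall j k, M j k = M k j) ->
  smallest_eigenvalue M a -> forall v, a * sqn v <= qform M v.
Proof.
move=> symM [/eigenvalueP[v0 _ v00] amin].
have n0 : 0 < sqn v0.
  by rewrite lt_neqAle sqn_ge0 andbT eq_sym; apply: contra v00 => /eqP/sqn_eq0 ->.
have normalize v : 0 < sqn v -> sqn ((Num.sqrt (sqn v))^-1 *: v) = 1.
  by move=> v0'; rewrite sqnZ exprVn sqr_sqrtr ?sqn_ge0// mulVf// gt_eqF.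
have [v1 sv1 v1min] : exists2 c, sqn c = 1 & forall t, sqn t = 1 -> qform M c <= qform M t.
  have [] := @compact_EVT_min _ R (qform M) [set v | sqn v = 1].
  - by exists ((Num.sqrt (sqn v0))^-1 *: v0); exact: normalize.
  - exact: sphere_compact.
  - by apply: continuous_subspaceT; exact: continuous_qform.
  - by move=> c; rewrite inE => c1 cmin; exists c => // t t1; apply: cmin; rewrite inE.
set c := qform M v1 in v1min.
have cle v : c * sqn v <= qform M v.
  have [v'0|v'0] := eqVneq (sqn v) 0.
    have vE := sqn_eq0 v'0; rewrite v'0 mulr0 vE.
    by rewrite -(scale0r (0 : 'rV[R]_p)) qformZ expr0n mul0r.
  have vp : 0 < sqn v by rewrite lt_neqAle sqn_ge0 andbT eq_sym.
  have := v1min _ (normalize v vp).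
  by rewrite qformZ exprVn sqr_sqrtr ?sqn_ge0// ler_pdivlMl// mulrC.
(* the minimiser is an eigenvector: the first variation of
   [qform M - c * sqn], nonnegative and zero at v1, vanishes there *)
have eig : v1 *m M = c *: v1.
  apply/eqP; rewrite -subr_eq0; apply/eqP; apply: sqn_eq0.
  set u := v1 *m M - c *: v1.
  have var t : 0 <= 2 * t * sqn u + t ^+ 2 * (qform M u - c * sqn u).
    have := cle (v1 + t *: u); rewrite qformD// sqnD sv1 -/c.
    have -> : sqn u = \sum_k u ord0 k * (v1 *m M) ord0 k - c * \sum_k u ord0 k * v1 ord0 k.
      rewrite mulr_sumr -sumrB /sqn; apply: eq_bigr => k _.
      by rewrite expr2 {2}/u !mxE; ring.
    lra.
  apply/eqP; rewrite eq_le sqn_ge0 andbT -oppr_ge0.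
  apply: (@ge0_of_quadratic _ _ ((qform M u - c * sqn u) / 2)) => t t0 t1.
  have := var (- t); rewrite sqrrN; lra.
have : a <= c.
  apply: amin; apply/eigenvalueP; exists v1 => //.
  apply/eqP => v10; move: sv1; rewrite v10 -(scale0r (0 : 'rV[R]_p)) sqnZ.
  by rewrite expr0n mul0r => /esym/eqP; rewrite oner_eq0.
by move=> ac v; apply: le_trans (cle v); rewrite ler_wpM2r ?sqn_ge0.
Qed.

Lemma rayleigh_max M a : (forall j k, M j k = M k j) ->
  largest_eigenvalue M a -> forall v, qform M v <= a * sqn v.
Proof.
move=> symM [/eigenvalueP[v0 Mv0 v00] amax] v.
have : smallest_eigenvalue (- M) (- a).
  split; first by apply/eigenvalueP; exists v0 => //; rewrite mulmxN Mv0 scaleNr.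
  move=> b /eigenvalueP[u Mu u0]; rewrite lerNl; apply: amax; apply/eigenvalueP.
  by exists u => //; rewrite scaleNr -Mu mulmxN opprK.
move/(rayleigh_min _) => H; have := H _ v; rewrite mulNr lerNl.
suff -> : qform (- M) v = - qform M v by rewrite opprK; apply => j k; rewrite !mxE symM.
rewrite /qform -sumrN; apply: eq_bigr => j _; rewrite -sumrN.
by apply: eq_bigr => k _; rewrite !mxE mulrN.
Qed.

End rayleigh.

(** * Empirical deviations *)

(* [normal_prob] lives on [measurableTypeR R], whose display differs from that of
   the canonical measurable structure on [R] used for random variables. *)
Definition normal01 {R : realType} : set R -> \bar R :=
  pushforward (normal_prob (0 : R) 1) (id : measurableTypeR R -> R).

Section normal01.
Context {R : realType}.

Let mid : measurable_fun setT (id : measurableTypeR R -> R).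
Proof. by move=> _ B mB; rewrite setTI. Qed.

Let normal01_0 : normal01 (set0 : set R) = 0%E.
Proof. exact: measure0. Qed.

Let normal01_ge0 (A : set R) : (0 <= normal01 A)%E.
Proof. exact: measure_ge0. Qed.

Let normal01_sigma_additive : semi_sigma_additive (@normal01 R).
Proof.
pose m : {measure set R -> \bar R} :=
  pushforward (normal_prob (0 : R) 1) (id : measurableTypeR R -> R).
exact: (@measure_semi_sigma_additive _ _ _ (m mid)).
Qed.

HB.instance Definition _ := isMeasure.Build _ _ _ (@normal01 R)
  normal01_0 normal01_ge0 normal01_sigma_additive.

Let normal01_setT : normal01 [set: R] = 1%E.
Proof. exact: (@probability_setT _ _ _ (normal_prob (0 : R) 1)). Qed.

HB.instance Definition _ := Measure_isProbability.Build _ _ _ (@normal01 R)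
  normal01_setT.

Lemma integral_normal01E (phi : R -> R) : measurable_fun setT phi ->
  (forall y, 0 <= phi y) ->
  (\int[normal01]_y (phi y)%:E = \int[normal_prob (0 : R) 1]_y (phi y)%:E)%E.
Proof.
move=> /measurable_EFinP mphi phi0.
have H := ge0_integral_pushforward mid (normal_prob (0 : R) 1) measurableT mphi.
rewrite preimage_setT in H; apply: H => y _; rewrite lee_fin; exact: phi0.
Qed.

End normal01.

Section events.
Context {R : realType} {dO d1 : measure_display} {Om : measurableType dO}
  {T1 : measurableType d1}.
Variables (P : probability Om R) (Q : probability T1 R) (n : nat).
Variables (U : 'I_n -> Om -> T1) (e : 'I_n -> Om -> R).
Hypothesis n0 : (0 < n)%N.
Hypothesis mU : forall i, measurable_fun setT (U i).
Hypothesis me : forall i, measurable_fun setT (e i).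
Hypothesis indep : mutually_indep2 P n U e.
Hypothesis lawU : forall i (S : set T1), measurable S -> P (U i @^-1` S) = Q S.
Let N : probability R R := @normal01 R.
Hypothesis lawe : forall i (B : set R), measurable B -> P (e i @^-1` B) = N B.

Definition emp (xi : T1 * R -> R) (w : Om) : R := n%:R^-1 * \sum_(i < n) xi (U i w, e i w).

Let n_gt0 : 0 < n%:R :> R. Proof. by rewrite ltr0n. Qed.

Lemma sum_ordc (c : R) : \sum_(i < n) c = n%:R * c.
Proof. by rewrite sumr_const card_ord mulr_natl. Qed.

Lemma emp_dev_self (xi v : T1 * R -> R) (a tau : R) :
  measurable_fun setT xi -> measurable_fun setT v -> 0 < a ->
  (forall b : R, \int[Q]_x \int[N]_y
     (expR (b * xi (x, y) - b ^+ 2 / 2 * v (x, y)))%:E <= 1)%E ->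
  whp P (2 * expR (- tau)) (fun w => `|emp xi w| <= a / 2 * emp v w + tau / (a * n%:R)).
Proof.
move=> mxi mv a0 sg.
apply: whpW (subgauss_sum mU me indep lawU lawe tau mxi mv a0 sg) (lexx _) _ => w H.
rewrite /emp normrM ger0_norm ?invr_ge0 ?ler0n// ler_pdivrMl//.
apply: (le_trans H); apply: le_of_eq.
by field; rewrite !gt_eqF.
Qed.

Lemma emp_dev (xi v : T1 * R -> R) (V t : R) :
  measurable_fun setT xi -> measurable_fun setT v -> 0 < V -> 0 < t ->
  (forall x, v x <= V) ->
  (forall b : R, \int[Q]_x \int[N]_y
     (expR (b * xi (x, y) - b ^+ 2 / 2 * v (x, y)))%:E <= 1)%E ->
  whp P (2 * expR (- (n%:R * t ^+ 2 / (2 * V)))) (fun w => `|emp xi w| <= t).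
Proof.
move=> mxi mv V0 t0 vV sg.
(* [a = t / V] balances the self-normalised bound: each of its two terms becomes [t / 2]. *)
have a0 : 0 < t / V by rewrite divr_gt0.
apply: whpW (emp_dev_self (n%:R * t ^+ 2 / (2 * V)) mxi mv a0 sg) (lexx _) _ => w H.
apply: (le_trans H).
have vle : emp v w <= V.
  rewrite /emp ler_pdivrMl// (le_trans (ler_sum _ (fun i _ => vV _)))//.
  by rewrite sum_ordc lexx.
apply: (@le_trans _ _ (t / V / 2 * V + n%:R * t ^+ 2 / (2 * V) / (t / V * n%:R))).
  by rewrite lerD2r ler_wpM2l// ltW// divr_gt0.
by apply: le_of_eq; field; rewrite !gt_eqF.
Qed.

(** Given [x], the product is Gaussian and [c = 1] gives equality; a larger [c] lowers the integrand
    and lets the noise share the proxy [c2] with the other processes. *)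
Lemma gauss_sg (f : T1 -> R) (c b : R) : measurable_fun setT f -> 1 <= c ->
  (\int[Q]_x \int[N]_y (expR (b * (y * f x) - b ^+ 2 / 2 * (c * f x ^+ 2)))%:E <= 1)%E.
Proof.
move=> mf c1.
pose k x := - ((c - 1) * (b ^+ 2 / 2) * f x ^+ 2).
have inner x : (\int[N]_y (expR (b * (y * f x) - b ^+ 2 / 2 * (c * f x ^+ 2)))%:E = (expR (k x))%:E)%E.
  have mexp : measurable_fun setT (fun y : R => expR (b * f x * y - (b * f x) ^+ 2 / 2)).
    by apply: measurableT_comp => //; apply: measurable_funB.
  have one : (\int[N]_y (expR (b * f x * y - (b * f x) ^+ 2 / 2))%:E = 1)%E.
    by rewrite -(normal_mgf (b * f x)) -integral_normal01E.
  transitivity ((expR (k x))%:E * \int[N]_y (expR (b * f x * y - (b * f x) ^+ 2 / 2))%:E)%E.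
    rewrite -ge0_integralZl//; last exact/measurable_EFinP.
    apply: eq_integral => y _; rewrite -EFinM -expRD; congr (expR _)%:E.
    by rewrite /k; field.
  by rewrite one mule1.
under eq_integral do rewrite inner.
rewrite -[leRHS](@probability_setT _ _ _ Q) -[leRHS]mul1e -(integral_cst Q measurableT 1%:E).
apply: ge0_le_integral => //.
- apply/measurable_EFinP; apply: measurableT_comp => //; apply: measurableT_comp => //.
  by apply: measurable_funM => //; exact: measurable_funX.
- move=> x _; rewrite lee_fin -[leRHS]expR0 ler_expR oppr_le0.
  by rewrite mulr_ge0 ?sqr_ge0// mulr_ge0 ?divr_ge0 ?sqr_ge0// subr_ge0.
Qed.

Lemma no_noise (phi : T1 -> R) : measurable_fun setT phi ->
  (forall x, 0 <= phi x) ->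
  (\int[Q]_x \int[N]_y (phi x)%:E = \int[Q]_x (phi x)%:E)%E.
Proof.
move=> mphi phi0; apply: eq_integral => x _.
by rewrite integral_cst// [X in (_ * X)%E]probability_setT mule1.
Qed.

Lemma bounded_sg (x s : T1 -> R) (B b : R) :
  measurable_fun setT x -> measurable_fun setT s -> 0 < B ->
  (forall t, `|x t| <= B) ->
  (\int[Q]_t (x t * (b * s t * expR (- (2 * (b * s t * B) ^+ 2)))) = 0)%R ->
  (\int[Q]_t \int[N]_y (expR (b * (x t * s t) - b ^+ 2 / 2 * (4 * B ^+ 2 * s t ^+ 2)))%:E <= 1)%E.
Proof.
move=> mx ms B0 xB int0.
have mbs : measurable_fun setT (fun t => b * s t) by exact: measurable_funM.
rewrite (no_noise (phi := fun t => expR (b * (x t * s t) - b ^+ 2 / 2 * (4 * B ^+ 2 * s t ^+ 2)))).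
- have := subgauss_bounded mx mbs B0 xB int0; apply: le_trans.
  apply: le_of_eq; apply: eq_integral => t _.
  by congr (expR _)%:E; field.
- apply: measurableT_comp => //; apply: measurable_funB; apply: measurable_funM => //.
    exact: measurable_funM.
  by apply: measurable_funM => //; exact: measurable_funX.
- by move=> t; exact: expR_ge0.
Qed.

(** [y] minus its mean is bounded by [2 * B], whence [16 B^2 = 4 (2 B)^2]. *)
Lemma centered_sg (y : T1 -> R) (B b : R) :
  measurable_fun setT y -> 0 < B -> (forall t, `|y t| <= B) ->
  (\int[Q]_t \int[N]_u (expR (b * (y t - \int[Q]_t y t) - b ^+ 2 / 2 * (16 * B ^+ 2)))%:E <= 1)%E.
Proof.
move=> my B0 yB; set m := (\int[Q]_t y t)%R.
have inty : Q.-integrable setT (EFin \o y) by exact: bounded_integrable yB.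
have mB : `|m| <= B by exact: norm_mean_le.
have B20 : 0 < 2 * B by rewrite mulr_gt0.
have mym : measurable_fun setT (fun t => y t - m) by exact: measurable_funB.
have ymB t : `|y t - m| <= 2 * B.
  by apply: (le_trans (ler_normB _ _)); have := yB t; lra.
have intym : Q.-integrable setT (EFin \o (fun t => y t - m)) by exact: bounded_integrable ymB.
have int0 : (\int[Q]_t ((y t - m) * (b * cst 1 t * expR (- (2 * (b * cst 1 t * (2 * B)) ^+ 2)))) = 0)%R.
  rewrite /cst RintegralZr// RintegralB//; last exact: finite_measure_integrable_cst.
  by rewrite mean_cst -/m subrr mul0r.
have := bounded_sg (b := b) mym (@measurable_cst _ _ _ _ setT (1 : R)) B20 ymB int0.
apply: le_trans; apply: le_of_eq.
apply: eq_integral => t _; apply: eq_integral => u _; congr (expR _)%:E.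
by rewrite /cst; field.
Qed.

Lemma emp_centered (y : T1 -> R) (B t : R) :
  measurable_fun setT y -> 0 < B -> 0 < t -> (forall x, `|y x| <= B) ->
  whp P (2 * expR (- (n%:R * t ^+ 2 / (2 * (16 * B ^+ 2)))))
    (fun w => `|emp (fun x => y x.1) w - \int[Q]_x y x| <= t).
Proof.
move=> my B0 t0 yB; set m := (\int[Q]_x y x)%R.
have V0 : 0 < 16 * B ^+ 2 by rewrite mulr_gt0// exprn_gt0.
have mxi : measurable_fun setT (fun x : T1 * R => y x.1 - m).
  by apply: measurable_funB => //; exact: measurableT_comp.
have mv : measurable_fun setT (fun _ : T1 * R => 16 * B ^+ 2) by [].
have sg b := centered_sg b my B0 yB.
apply: whpW (emp_dev mxi mv V0 t0 (fun=> lexx _) sg) (lexx _) _ => w.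
by rewrite /emp sumrB sum_ordc mulrBr mulrA mulVf ?mul1r// gt_eqF.
Qed.

Lemma emp_bernstein (y : T1 -> R) (B v ep : R) :
  measurable_fun setT y -> 0 < B -> 0 < v -> 0 < ep -> ep <= 1 ->
  (forall x, 0 <= y x <= B) -> \int[Q]_x y x <= v ->
  whp P (2 * expR (- (n%:R * ep ^+ 2 * v / (8 * B))))
    (fun w => `|emp (fun x => y x.1) w - \int[Q]_x y x| <= ep * v).
Proof.
move=> my B0 v0 ep0 ep1 yB yv; set m := (\int[Q]_x y x)%R.
(* At this [|a|] the compensator and the tail each contribute [ep^2 v / (8 B)], together
   [|a| * ep * v]. *)
have one a : `|a| = ep / (4 * B) ->
  whp P (expR (- (n%:R * ep ^+ 2 * v / (8 * B))))
    (fun w => a * (emp (fun x => y x.1) w - m) <= ep ^+ 2 * v / (4 * B)).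
  move=> aE.
  have aB : `|a| * B <= 2^-1.
    rewrite aE (_ : ep / (4 * B) * B = ep / 4); first by lra.
    by field; rewrite gt_eqF.
  have a2 : a ^+ 2 = ep ^+ 2 / (16 * B ^+ 2).
    by rewrite -(real_normK (num_real a)) aE; field; rewrite gt_eqF.
  pose psi (x : T1 * R) := a * (y x.1 - m) - 2 * a ^+ 2 * (B * v).
  have mpsi0 : measurable_fun setT (fun x : T1 => a * (y x - m) - 2 * a ^+ 2 * (B * v)).
    by apply: measurable_funB => //; apply: measurable_funM => //; exact: measurable_funB.
  have mpsi : measurable_fun setT psi.
    apply: (measurableT_comp mpsi0); exact: measurable_fst.
  have psi1 : (\int[Q]_x \int[N]_u (expR (psi (x, u)))%:E <= 1)%E.
    rewrite /psi /= (no_noise (phi := fun x => expR (a * (y x - m) - 2 * a ^+ 2 * (B * v)))).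
    - exact: bernstein_mgf.
    - exact: measurableT_comp.
    - by move=> x; exact: expR_ge0.
  apply: whpW (chernoff_sum mU me indep lawU lawe (n%:R * ep ^+ 2 * v / (8 * B)) mpsi psi1) (lexx _) _ => w.
  rewrite /psi/= sumrB -mulr_sumr sumrB !sum_ordc a2 /emp => H.
  rewrite -(ler_pM2l n_gt0).
  have -> : n%:R * (a * (n%:R^-1 * \sum_(i < n) y (U i w) - m)) =
     a * (\sum_(i < n) y (U i w) - n%:R * m) by field; rewrite gt_eqF.
  move: H; rewrite lerBlDr => H; apply: (le_trans H).
  by apply: le_of_eq; field; rewrite gt_eqF.
have a0 : 0 < ep / (4 * B) by rewrite divr_gt0// mulr_gt0.
have H1 := one (ep / (4 * B)) (ger0_norm (ltW a0)).
have H2 := one (- (ep / (4 * B))); rewrite normrN (ger0_norm (ltW a0)) in H2.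
rewrite mulr_natl mulr2n; apply: whpW (whp_and H1 (H2 erefl)) (lexx _) _ => w [K1 K2].
have E : ep ^+ 2 * v / (4 * B) = ep / (4 * B) * (ep * v) by field; rewrite gt_eqF.
move: K1 K2; rewrite E mulNr -mulrN !ler_pM2l// => K1 K2.
by rewrite ler_norml; apply/andP; split; lra.
Qed.

(** The mean absolute noise is the Lipschitz constant, in sup norm, of the noise process; bounding
    it allows the chain to be cut at a finite level. *)
Lemma emp_abs_noise : whp P (expR (- n%:R)) (fun w => n%:R^-1 * \sum_(i < n) `|e i w| <= 3).
Proof.
have mpsi : measurable_fun setT (fun x : T1 * R => `|x.2| - 2).
  by apply: measurable_funB => //; apply: measurableT_comp.
have int1 : (\int[N]_y (expR (`|y| - 2))%:E <= 1)%E.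
  rewrite /N (integral_normal01E (phi := fun y => expR (`|y| - 2))).
  - exact: normal_abs_mgf.
  - by apply: measurableT_comp => //; apply: measurable_funB.
  - by move=> y; exact: expR_ge0.
have psi1 : (\int[Q]_x \int[N]_y (expR (`|y| - 2))%:E <= 1)%E.
  by rewrite integral_cst// [X in (_ * X)%E]probability_setT mule1.
apply: whpW (chernoff_sum mU me indep lawU lawe n%:R mpsi psi1) (lexx _) _ => w /=.
rewrite sumrB sum_ordc => H.
rewrite ler_pdivrMl//; lra.
Qed.

End events.

(** * Uniform deviations of squares and products *)

Section processes.
Context {R : realType} {dO d1 dz : measure_display} {Om : measurableType dO}
  {T1 : measurableType d1} {Tz : measurableType dz}.
Variables (P : probability Om R) (Q : probability T1 R) (n : nat).
Variables (U : 'I_n -> Om -> T1) (e : 'I_n -> Om -> R).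
Hypothesis n0 : (0 < n)%N.
Hypothesis mU : forall i, measurable_fun setT (U i).
Hypothesis me : forall i, measurable_fun setT (e i).
Hypothesis indep : mutually_indep2 P n U e.
Hypothesis lawU : forall i (S : set T1), measurable S -> P (U i @^-1` S) = Q S.
Hypothesis lawe : forall i (B : set R), measurable B -> P (e i @^-1` B) = normal01 B.

Variables (z : T1 -> Tz) (C : set (Tz -> R)) (mu K c2 ep rho q AE : R).
Hypothesis mz : measurable_fun setT z.
Hypothesis C_meas : forall f, C f -> measurable_fun setT f.
Hypothesis C_bound : forall f, C f -> forall t, `|f t| <= K.
Hypothesis C_var : forall f, C f -> \int[Q]_x (f (z x) ^+ 2) <= mu ^+ 2.
Hypotheses (mu0 : 0 < mu) (K0 : 0 < K) (ep0 : 0 < ep) (ep1 : ep <= 1).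
Hypotheses (c2_ge1 : 1 <= c2) (c2_K : 64 * K ^+ 2 <= c2).
Hypotheses (q0 : 0 < q) (q1 : q < 1) (rho2 : 2 <= rho) (rhoq : rho = 4 * q ^+ 2).
Hypothesis AE0 : 0 <= AE.
Hypothesis nets : forall s : nat, exists (N : nat) (c : nat -> Tz -> R),
    [/\ forall k, C (c k), N%:R <= expR (AE * rho ^+ s + 1) &
        forall f, C f -> exists2 k, (k < N)%N & forall z, `|f z - c k z| <= 2 * (mu / 2 ^+ s)].

(** The exponent of a link divided by [n nu^2 rho^s]: [72 = 2 * 6^2] combines the 2 of the
    sub-Gaussian tail with the link radius [6 mu / 2^s]. *)
Definition rate : R := ep ^+ 2 * (1 - q) ^+ 2 / (72 * c2).

Let n_gt0 : 0 < n%:R :> R. Proof. by rewrite ltr0n. Qed.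
Let c2_gt0 : 0 < c2. Proof. exact: lt_le_trans c2_ge1. Qed.

Lemma rate_gt0 : 0 < rate.
Proof.
rewrite divr_gt0 ?mulr_gt0// ?exprn_gt0// ?subr_gt0//.
Qed.

(** Link errors shrink like [q^s] and radii like [2^-s], so the exponent grows like
    [(2 q)^(2 s) = rho^s], in step with the entropy. *)
Lemma link_exponent (V nu : R) (s : nat) : 0 < V -> V <= c2 ->
  rate * (n%:R * nu ^+ 2) * rho ^+ s <=
  n%:R * (ep * mu * nu * (1 - q) * q ^+ s) ^+ 2 / (2 * (V * (6 * (mu / 2 ^+ s)) ^+ 2)).
Proof.
move=> V0 Vc2.
have p20 : (2 : R) ^+ s != 0 by rewrite expf_neq0.
have -> : n%:R * (ep * mu * nu * (1 - q) * q ^+ s) ^+ 2 / (2 * (V * (6 * (mu / 2 ^+ s)) ^+ 2))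
  = (ep ^+ 2 * (1 - q) ^+ 2 / (72 * V)) * (n%:R * nu ^+ 2) * rho ^+ s.
  have -> : rho ^+ s = (2 ^+ s) ^+ 2 * (q ^+ s) ^+ 2.
    have four : (4 : R) = 2 ^+ 2 by rewrite -natrX.
    by rewrite rhoq four exprMn -!exprM !(mulnC s).
  by field; rewrite p20 !gt_eqF.
have rho0 : 0 <= rho by apply: le_trans rho2.
apply: ler_wpM2r; first exact: exprn_ge0.
apply: ler_wpM2r; first by rewrite mulr_ge0 ?sqr_ge0.
apply: ler_wpM2l; first by rewrite mulr_ge0 ?sqr_ge0.
by rewrite lef_pV2 ?posrE ?mulr_gt0// ler_pM2l.
Qed.

Let mfz (f : Tz -> R) : measurable_fun setT f -> measurable_fun setT (fun x => f (z x)).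
Proof. by move=> mf; exact: measurableT_comp. Qed.

Let sq_bound f : C f -> forall x, 0 <= f (z x) ^+ 2 <= K ^+ 2.
Proof.
move=> Cf x; rewrite sqr_ge0/= -(real_normK (num_real (f (z x)))).
by rewrite lerXn2r ?nnegrE ?(ltW K0)// C_bound.
Qed.

Let sq_integrable f : C f -> Q.-integrable setT (EFin \o (fun x => f (z x) ^+ 2)).
Proof.
move=> Cf; apply: (@bounded_integrable _ _ _ _ _ (K ^+ 2)).
  by apply: measurable_funX; apply: mfz; exact: C_meas.
by move=> x; have /andP[s0 sK] := sq_bound Cf x; rewrite ger0_norm.
Qed.

Let sq_diff_bound (f g : Tz -> R) (u : R) : C f -> C g -> (forall t, `|f t - g t| <= u) ->
  forall t, `|f t ^+ 2 - g t ^+ 2| <= 2 * K * u.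
Proof.
move=> Cf Cg fg t; rewrite subr_sqr normrM mulrC ler_pM//.
by apply: (le_trans (ler_normD _ _)); have := C_bound Cf t; have := C_bound Cg t; lra.
Qed.

(** Differences of squares are at most [2 K] times the sup distance [u], so the centred proxy is
    [16 (2 K u)^2 = 64 K^2 u^2]. The 3 counts two units from the chain and one from the Bernstein
    bound on the coarsest net. *)
Lemma sq_process :
  8 * AE <= rate * (n%:R * mu ^+ 2) -> 8 <= rate * (n%:R * mu ^+ 2) ->
  whp P (4 * expR (- (rate * (n%:R * mu ^+ 2) / 2))) (fun w => forall f, C f ->
    `|emp U e (fun x => f (z x.1) ^+ 2) w - \int[Q]_x (f (z x) ^+ 2)| <= 3 * ep * mu ^+ 2).
Proof.
move=> WA W8.
pose Z f w := emp U e (fun x => f (z x.1) ^+ 2) w - \int[Q]_x (f (z x) ^+ 2).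
pose t := ep * mu * mu.
have t0 : 0 < t by rewrite !mulr_gt0.
have q0' := ltW q0; have q1' := ltW q1.
have ZB f g w : C f -> C g ->
    Z f w - Z g w = emp U e (fun x => f (z x.1) ^+ 2 - g (z x.1) ^+ 2) w -
      \int[Q]_x (f (z x) ^+ 2 - g (z x) ^+ 2).
  move=> Cf Cg; rewrite RintegralB//; [|exact: sq_integrable..].
  by rewrite /Z /emp sumrB; ring.
have link s f g : C f -> C g -> (forall x, `|f x - g x| <= 6 * (mu / 2 ^+ s)) ->
    whp P (2 * expR (- (rate * (n%:R * mu ^+ 2) * rho ^+ s)))
      (fun w => `|Z f w - Z g w| <= t * (1 - q) * q ^+ s).
  move=> Cf Cg fg.
  set u := 6 * (mu / 2 ^+ s) in fg.
  have u0 : 0 < u by rewrite mulr_gt0// divr_gt0// exprn_gt0.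
  have B0 : 0 < 2 * K * u by rewrite !mulr_gt0.
  have ts0 : 0 < t * (1 - q) * q ^+ s by rewrite !mulr_gt0 ?exprn_gt0// subr_gt0.
  have my : measurable_fun setT (fun x => f (z x) ^+ 2 - g (z x) ^+ 2).
    by apply: measurable_funB; apply: measurable_funX; apply: mfz; exact: C_meas.
  apply: whpW (emp_centered n0 mU me indep lawU lawe my B0 ts0 _) _ _.
  - by move=> x; exact: (sq_diff_bound Cf Cg fg).
  - rewrite ler_pM2l// ler_expR lerN2.
    have V0 : 0 < 64 * K ^+ 2 by rewrite mulr_gt0// exprn_gt0.
    apply: (le_trans (link_exponent mu s V0 c2_K)).
    rewrite -/u; apply: le_of_eq; rewrite /t; congr (_ / _); ring.
  - by move=> w; rewrite ZB.
have base f : C f -> whp P (2 * expR (- (rate * (n%:R * mu ^+ 2)))) (fun w => `|Z f w| <= t).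
  move=> Cf.
  have K20 : 0 < K ^+ 2 by exact: exprn_gt0.
  have my : measurable_fun setT (fun x => f (z x) ^+ 2).
    by apply: measurable_funX; apply: mfz; exact: C_meas.
  have mu20 : 0 < mu ^+ 2 by exact: exprn_gt0.
  apply: whpW (emp_bernstein n0 mU me indep lawU lawe my K20 mu20 ep0 ep1 (sq_bound Cf) (C_var Cf)) _ _.
  - rewrite ler_pM2l// ler_expR lerN2 /rate.
    have -> : n%:R * ep ^+ 2 * mu ^+ 2 / (8 * K ^+ 2) =
      (ep ^+ 2 * (8 * K ^+ 2)^-1) * (n%:R * mu ^+ 2) by ring.
    apply: ler_wpM2r; first by rewrite mulr_ge0 ?sqr_ge0.
    rewrite -mulrA; apply: ler_wpM2l; first exact: sqr_ge0.
    apply: (@le_trans _ _ (72 * c2)^-1).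
      rewrite -[leRHS]mul1r; apply: ler_wpM2r; first by rewrite invr_ge0 mulr_ge0 ?(ltW c2_gt0).
      by rewrite -[leRHS](expr1n _ 2) lerXn2r ?nnegrE ?subr_ge0// lerBlDr lerDl.
    by rewrite lef_pV2 ?posrE ?mulr_gt0//; have := c2_K; lra.
  - by move=> w; rewrite /Z /t -mulrA -expr2.
have := @chaining _ _ _ P Tz C Z (fun f w => `|Z f w| <= t) mu AE rho q
  (rate * (n%:R * mu ^+ 2)) t (4 * K) q0' q1' rho2 AE0 WA W8 t0 nets link base.
move=> H; apply: whpW H (lexx _) _ => w H f Cf.
have [|g [Cg Bg fg]] := H _ f Cf.
  move=> f1 g1 u Cf1 Cg1 fg; rewrite ZB//.
  have y2 t' := sq_diff_bound Cf1 Cg1 fg t'.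
  have my : measurable_fun setT (fun x => f1 (z x) ^+ 2 - g1 (z x) ^+ 2).
    by apply: measurable_funB; apply: measurable_funX; apply: mfz; exact: C_meas.
  have m2 : `|(\int[Q]_x (f1 (z x) ^+ 2 - g1 (z x) ^+ 2))%R| <= 2 * K * u.
    by apply: norm_mean_le => // ; exact: bounded_integrable.
  have e2 : `|emp U e (fun x => f1 (z x.1) ^+ 2 - g1 (z x.1) ^+ 2) w| <= 2 * K * u.
    rewrite /emp normrM ger0_norm ?invr_ge0 ?ler0n// ler_pdivrMl//.
    apply: (le_trans (ler_norm_sum _ _ _)).
    by rewrite -(sum_ordc n); apply: ler_sum => i _; exact: y2.
  by apply: (le_trans (ler_normB _ _)); lra.
have -> : emp U e (fun x => f (z x.1) ^+ 2) w - \int[Q]_x (f (z x) ^+ 2) = (Z f w - Z g w) + Z g w.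
  by rewrite /Z; ring.
apply: (le_trans (ler_normD _ _)); move: Bg fg; rewrite /t; lra.
Qed.

(** On the coarsest net the variance proxy is the empirical square, at most [2 mu^2] once the
    squares are controlled. [nu] may exceed [mu] to leave room for a union over many [xi]. *)
Lemma lin_process (xi : T1 * R -> R) (nu M : R) :
  measurable_fun setT xi -> mu <= nu ->
  (forall (f : Tz -> R) (k : R), measurable_fun setT f -> (forall t, `|f t| <= k) -> forall b : R,
     (\int[Q]_x \int[normal01]_y (expR (b * (xi (x, y) * f (z x)) -
        b ^+ 2 / 2 * (c2 * f (z x) ^+ 2)))%:E <= 1)%E) ->
  8 * AE <= rate * (n%:R * nu ^+ 2) -> 8 <= rate * (n%:R * nu ^+ 2) ->
  whp P (4 * expR (- (rate * (n%:R * nu ^+ 2) / 2))) (fun w =>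
    n%:R^-1 * \sum_(i < n) `|xi (U i w, e i w)| <= M ->
    (forall f, C f -> emp U e (fun x => f (z x.1) ^+ 2) w <= 2 * mu ^+ 2) ->
    forall f, C f -> `|emp U e (fun x => xi x * f (z x.1)) w| <= 3 * ep * mu * nu).
Proof.
move=> mxi munu sg WA W8.
have nu0 : 0 < nu by exact: lt_le_trans munu.
pose Z f w := emp U e (fun x => xi x * f (z x.1)) w.
pose t := ep * mu * nu.
have t0 : 0 < t by rewrite !mulr_gt0.
have q0' := ltW q0; have q1' := ltW q1.
have mxif (f : Tz -> R) : measurable_fun setT f -> measurable_fun setT (fun x => xi x * f (z x.1)).
  move=> mf; apply: measurable_funM => //.
  by apply: measurableT_comp => //; apply: measurableT_comp.
have mv (f : Tz -> R) : measurable_fun setT f -> measurable_fun setT (fun x : T1 * R => c2 * f (z x.1) ^+ 2).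
  move=> mf; apply: measurable_funM => //; apply: measurable_funX.
  by apply: measurableT_comp => //; apply: measurableT_comp.
have ZB f g w : Z f w - Z g w = emp U e (fun x => xi x * (f (z x.1) - g (z x.1))) w.
  rewrite /Z /emp -mulrBr -sumrB; congr (_ * _); apply: eq_bigr => i _.
  by rewrite mulrBr.
have link s f g : C f -> C g -> (forall x, `|f x - g x| <= 6 * (mu / 2 ^+ s)) ->
    whp P (2 * expR (- (rate * (n%:R * nu ^+ 2) * rho ^+ s)))
      (fun w => `|Z f w - Z g w| <= t * (1 - q) * q ^+ s).
  move=> Cf Cg fg.
  set u := 6 * (mu / 2 ^+ s) in fg.
  have u0 : 0 < u by rewrite mulr_gt0// divr_gt0// exprn_gt0.
  have ts0 : 0 < t * (1 - q) * q ^+ s by rewrite !mulr_gt0 ?exprn_gt0// subr_gt0.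
  have V0 : 0 < c2 * u ^+ 2 by rewrite mulr_gt0// exprn_gt0.
  have mfg : measurable_fun setT (fun x => f x - g x).
    by apply: measurable_funB; exact: C_meas.
  apply: whpW (emp_dev n0 mU me indep lawU lawe (mxif _ mfg) (mv _ mfg) V0 ts0 _ (sg _ _ mfg fg)) _ _.
  - move=> x; rewrite ler_wpM2l ?(ltW c2_gt0)// -(real_normK (num_real (f _ - g _))).
    by rewrite lerXn2r ?nnegrE ?(ltW u0).
  - rewrite ler_pM2l// ler_expR lerN2.
    exact: (link_exponent nu s c2_gt0 (lexx _)).
  - by move=> w; rewrite ZB.
(* With the proxy [2 c2 mu^2], this [a] and [tau] make both terms of the self-normalised bound equal
   to [t / 2]. *)
pose a := ep * nu / (2 * c2 * mu).
have a0 : 0 < a by rewrite divr_gt0 ?mulr_gt0.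
pose tau := n%:R * ep ^+ 2 * nu ^+ 2 / (4 * c2).
pose Bp f w := `|Z f w| <= a / 2 * (c2 * emp U e (fun x => f (z x.1) ^+ 2) w) + tau / (a * n%:R).
have base f : C f -> whp P (2 * expR (- (rate * (n%:R * nu ^+ 2)))) (Bp f).
  move=> Cf; have mf := C_meas Cf.
  apply: whpW (emp_dev_self n0 mU me indep lawU lawe tau (mxif _ mf) (mv _ mf) a0
    (sg _ _ mf (C_bound Cf))) _ _.
  - rewrite ler_pM2l// ler_expR lerN2 /rate /tau.
    have -> : n%:R * ep ^+ 2 * nu ^+ 2 / (4 * c2) =
      (ep ^+ 2 * (4 * c2)^-1) * (n%:R * nu ^+ 2) by ring.
    apply: ler_wpM2r; first by rewrite mulr_ge0 ?sqr_ge0.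
    rewrite -mulrA; apply: ler_wpM2l; first exact: sqr_ge0.
    apply: (@le_trans _ _ (72 * c2)^-1).
      rewrite -[leRHS]mul1r; apply: ler_wpM2r; first by rewrite invr_ge0 mulr_ge0 ?(ltW c2_gt0).
      by rewrite -[leRHS](expr1n _ 2) lerXn2r ?nnegrE ?subr_ge0// lerBlDr lerDl.
    by rewrite lef_pV2 ?posrE ?mulr_gt0//; have := c2_gt0; lra.
  - move=> w; rewrite /Bp /Z; congr (_ <= _ / 2 * _ + _).
    by rewrite /emp -mulr_sumr; ring.
have := @chaining _ _ _ P Tz C Z Bp mu AE rho q
  (rate * (n%:R * nu ^+ 2)) t M q0' q1' rho2 AE0 WA W8 t0 nets link base.
move=> H; apply: whpW H (lexx _) _ => w H xiM sq f Cf.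
have [|g [Cg Bg fg]] := H _ f Cf.
  move=> f1 g1 u Cf1 Cg1 fg; rewrite ZB.
  rewrite /emp normrM ger0_norm ?invr_ge0 ?ler0n//.
  have u0 : 0 <= u by apply: le_trans (fg point).
  apply: le_trans (ler_wpM2r u0 xiM); rewrite -mulrA ler_wpM2l ?invr_ge0 ?ler0n//.
  rewrite mulr_suml; apply: (le_trans (ler_norm_sum _ _ _)); apply: ler_sum => i _.
  by rewrite normrM ler_wpM2l.
have -> : emp U e (fun x => xi x * f (z x.1)) w = (Z f w - Z g w) + Z g w.
  by rewrite /Z; ring.
have Zg : `|Z g w| <= t.
  apply: (le_trans Bg).
  apply: (@le_trans _ _ (a / 2 * (c2 * (2 * mu ^+ 2)) + tau / (a * n%:R))).
    rewrite lerD2r; apply: ler_wpM2l; first by rewrite divr_ge0 ?(ltW a0).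
    by apply: ler_wpM2l; [exact: ltW|exact: sq].
  apply: le_of_eq; rewrite /a /tau /t.
  by field; rewrite !gt_eqF.
by apply: (le_trans (ler_normD _ _)); move: Zg fg; rewrite /t; lra.
Qed.

End processes.

(** * Population quantities *)

Section population.
Context {R : realType} {p d : nat}.
Variables (Q : probability (obs R p d) R) (G : set (Rvec R d -> R)).
Variables (J : (Rvec R d -> R) -> (Rvec R d -> R) -> R).
Variables (h : 'I_p -> Rvec R d -> R).
Hypothesis GL2 : L2_subspace Q G.
Hypothesis JG : semi_inner_product G J.

Lemma G_zero : G (fun=> 0).
Proof. by case: GL2 => _ []. Qed.

Lemma G_lin (a : R) f g : G f -> G g -> G (fun z => a * f z + g z).
Proof.
case: GL2 => _ [_ [GD GZ]] Gf Gg; apply: (GD (fun z => a * f z)) => //; exact: GZ.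
Qed.

Lemma G_scale (a : R) f : G f -> G (fun z => a * f z).
Proof. by case: GL2 => _ [_ [GD GZ]]; exact: GZ. Qed.

Lemma G_meas f : G f -> measurable_fun setT f.
Proof. by case: GL2 => GL _ /GL[]. Qed.

Lemma G_sq_int f : G f -> Q.-integrable setT (EFin \o (fun w : obs R p d => f w.2 ^+ 2)).
Proof. by case: GL2 => GL _ /GL[]. Qed.

Lemma L2norm_ge0 f : 0 <= L2norm Q f.
Proof. exact: sqrtr_ge0. Qed.

Lemma L2norm_sqr f : L2norm Q f ^+ 2 = \int[Q]_w (f w.2 ^+ 2).
Proof.
by rewrite sqr_sqrtr// fine_ge0// integral_ge0// => w _; rewrite lee_fin sqr_ge0.
Qed.

Lemma L2normZ (a : R) f : G f -> L2norm Q (fun z => a * f z) = `|a| * L2norm Q f.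
Proof.
move=> Gf; apply/eqP; rewrite -(@eqrXn2 _ 2%N)// ?mulr_ge0 ?L2norm_ge0//.
rewrite exprMn real_normK ?num_real// !L2norm_sqr -RintegralZl//; last exact: G_sq_int.
by apply/eqP; apply: eq_Rintegral => w _; rewrite exprMn.
Qed.

Lemma JnormZ_le (a : R) f : G f -> Jnorm J (fun z => a * f z) <= `|a| * Jnorm J f.
Proof.
move=> Gf; have := Jnorm_lin G_lin JG a Gf G_zero.
rewrite (Jnorm0 G_zero JG) addr0.
by have -> : (fun z => a * f z + 0) = (fun z => a * f z) by apply/funext => z; rewrite addr0.
Qed.

Lemma sup_bound (Kg : R) : (forall g, unit_class Q G J g -> forall z, `|g z| <= Kg) ->
  forall f (t : R), G f -> 0 < t -> L2norm Q f <= t -> Jnorm J f <= t ->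
  forall z, `|f z| <= Kg * t.
Proof.
move=> HK f t Gf t0 Lf Jf z.
have tV : `|t^-1| = t^-1 by rewrite gtr0_norm// invr_gt0.
have : unit_class Q G J (fun z => t^-1 * f z).
  split; first exact: G_scale.
  split; first by rewrite L2normZ// tV ler_pdivrMl// mulr1.
  by apply: (le_trans (JnormZ_le _ Gf)); rewrite tV ler_pdivrMl// mulr1.
by move/HK => /(_ z); rewrite normrM tV ler_pdivrMl// mulrC.
Qed.

(** The form at a coordinate vector is a diagonal entry, the squared L2 norm of [h j]. Together with
    the seminorm bound this controls [h j] in sup norm, uniformly in [j] and [p]. *)
Lemma cov_h_diag (Lh : R) : 0 <= Lh -> largest_eigenvalue (cov_h Q h) (Lh ^+ 2) ->
  forall j, L2norm Q (h j) <= Lh.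
Proof.
move=> Lh0 Hmax j.
rewrite -(@ler_pXn2r _ 2%N)// ?nnegrE ?L2norm_ge0// L2norm_sqr.
have sym i k : cov_h Q h i k = cov_h Q h k i.
  by rewrite !mxE; congr fine; apply: eq_integral => w _; rewrite mulrC.
have := rayleigh_max sym Hmax (delta_mx ord0 j).
have -> : sqn (delta_mx ord0 j : 'rV[R]_p) = 1.
  rewrite /sqn (bigD1 j)//= mxE !eqxx expr1n big1 ?addr0// => i ij.
  by rewrite mxE eqxx (negPf ij) expr0n.
have -> : qform (cov_h Q h) (delta_mx ord0 j) = cov_h Q h j j.
  rewrite /qform (bigD1 j)//= [X in _ + X]big1 ?addr0; last first.
    by move=> i ij; apply: big1 => k _; rewrite !mxE eqxx (negPf ij) !mul0r.
  rewrite (bigD1 j)//= big1 ?addr0; first by rewrite !mxE !eqxx !mul1r.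
  by move=> k kj; rewrite !mxE !eqxx (negPf kj) mulr0 mul0r.
rewrite mulr1; apply: le_trans; apply: le_of_eq.
by rewrite mxE; congr fine; apply: eq_integral => w _; rewrite expr2.
Qed.

Hypothesis hx : cond_exp_x_given_z Q h.
Variables (N : set (obs R p d)) (KX B : R).
Hypotheses (mN : measurable N) (QN : Q N = 0%E).
Hypothesis xB : forall w, ~ N w -> forall j, `|w.1 ord0 j| <= KX.
Hypothesis KX0 : 0 <= KX.
Hypothesis hB : forall j z, `|h j z| <= B - KX.

(* [x] is modified on a null set so as to be bounded everywhere *)
Definition xcut j (w : obs R p d) : R := w.1 ord0 j * \1_(~` N) w.
Definition xtil j (w : obs R p d) : R := xcut j w - h j w.2.

Let mx j : measurable_fun setT (fun w : obs R p d => w.1 ord0 j).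
Proof. by have [/integrableP[/measurable_EFinP mx' _] _] := hx j. Qed.

Lemma measurable_xcut j : measurable_fun setT (xcut j).
Proof.
by apply: measurable_funM => //; apply: measurable_indic; exact: measurableC.
Qed.

Lemma measurable_h j : measurable_fun setT (fun w : obs R p d => h j w.2).
Proof.
by have [_ [mh _]] := hx j; apply: (measurableT_comp mh); exact: measurable_snd.
Qed.

Lemma measurable_xtil j : measurable_fun setT (xtil j).
Proof. by apply: measurable_funB; [exact: measurable_xcut|exact: measurable_h]. Qed.

Lemma xcut_bound j w : `|xcut j w| <= KX.
Proof.
rewrite /xcut indicE; have [|/negP nNw] := boolP (w \in ~` N).
  by rewrite inE => Nw; rewrite mulr1 xB.
by rewrite mulr0 normr0.
Qed.

Lemma xtil_bound j w : `|xtil j w| <= B.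
Proof.
by apply: (le_trans (ler_normB _ _)); have := xcut_bound j w; have := hB j w.2; lra.
Qed.

Lemma xcutE j w : ~ N w -> xcut j w = w.1 ord0 j.
Proof. by move=> nN; rewrite /xcut indicE mem_set ?mulr1. Qed.

Let ae_xcut (F F' : obs R p d -> R) (D : set (obs R p d)) :
  (forall w, ~ N w -> F w = F' w) -> ae_eq Q D (EFin \o F) (EFin \o F').
Proof.
move=> FF'; exists N; split => // w /= /not_implyP[_ ne].
by apply: contrapT => nN; apply: ne; rewrite FF'.
Qed.

Let int_xcut j : Q.-integrable setT (EFin \o xcut j).
Proof. exact: bounded_integrable (measurable_xcut j) (xcut_bound j). Qed.

Let int_h j : Q.-integrable setT (EFin \o (fun w : obs R p d => h j w.2)).
Proof. exact: bounded_integrable (measurable_h j) (fun w => hB j w.2). Qed.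

(** The defining property of [h] concerns sets; adding [B] makes [x] and [h] nonnegative weights, so
    that it extends to integrals against [phi]. *)
Lemma xtil_orth_ge0 j (phi : Rvec R d -> R) (M : R) : measurable_fun setT phi ->
  (forall z, 0 <= phi z <= M) -> \int[Q]_w (xtil j w * phi w.2) = 0.
Proof.
move=> mphi phiM.
have msnd : measurable_fun setT (snd : obs R p d -> Rvec R d) by exact: measurable_snd.
have phi0 z : 0 <= phi z by case/andP: (phiM z).
have hBz z := hB j z; have KX0' := KX0.
have B0 : 0 <= B - KX by apply: le_trans (hBz point).
have F0 w : 0 <= xcut j w + B.
  by have := xcut_bound j w; rewrite ler_norml => /andP[H _]; lra.
have G0 (w : obs R p d) : 0 <= h j w.2 + B.
  by have := hBz w.2; rewrite ler_norml => /andP[H _]; lra.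
have mF : measurable_fun setT (fun w => xcut j w + B).
  by apply: measurable_funD => //; exact: measurable_xcut.
have mG : measurable_fun setT (fun w : obs R p d => h j w.2 + B).
  by apply: measurable_funD => //; exact: measurable_h.
have mpz : measurable_fun setT (fun w : obs R p d => phi w.2) by exact: measurableT_comp.
have FG S : measurable S -> (\int[Q]_(w in (snd : obs R p d -> Rvec R d) @^-1` S) (xcut j w + B)%:E =
    \int[Q]_(w in (snd : obs R p d -> Rvec R d) @^-1` S) (h j w.2 + B)%:E)%E.
  move=> mS; have mD := measurable_preimage msnd mS.
  have intB : Q.-integrable ((snd : obs R p d -> Rvec R d) @^-1` S) (EFin \o cst B).
    by apply: (@integrableS _ _ _ Q setT) => //; exact: finite_measure_integrable_cst.
  rewrite (@integralD_EFin _ _ _ Q _ mD (xcut j) (cst B)) //; last first.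
    exact: (integrableS measurableT mD (@subsetT _ _) (int_xcut j)).
  rewrite (@integralD_EFin _ _ _ Q _ mD (fun w : obs R p d => h j w.2) (cst B)) //; last first.
    exact: (integrableS measurableT mD (@subsetT _ _) (int_h j)).
  congr (_ + _)%E; have [_ [_ <-//]] := hx j.
  apply: ae_eq_integral => //.
  - by apply/measurable_EFinP; apply: measurable_funTS; exact: measurable_xcut.
  - by apply/measurable_EFinP; apply: measurable_funTS.
  - by apply: ae_xcut => w nN; rewrite xcutE.
have := ge0_integral_comp_ext msnd msnd mF mG F0 G0 FG mphi phi0.
have M0 : 0 <= M by apply: le_trans (phi0 point) _; case/andP: (phiM point).
have phiN z : `|phi z| <= M by rewrite ger0_norm//; case/andP: (phiM z).
have int1 : Q.-integrable setT (EFin \o (fun w => (xcut j w + B) * phi w.2)).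
  apply: (@bounded_integrable _ _ _ _ _ ((KX + B) * M)); first exact: measurable_funM.
  move=> w; rewrite normrM ler_pM// (le_trans (ler_normD _ _))// lerD ?xcut_bound//.
  by rewrite ger0_norm//; lra.
have int2 : Q.-integrable setT (EFin \o (fun w : obs R p d => (h j w.2 + B) * phi w.2)).
  apply: (@bounded_integrable _ _ _ _ _ ((B - KX + B) * M)); first exact: measurable_funM.
  move=> w; rewrite normrM ler_pM// (le_trans (ler_normD _ _))// lerD//.
  by rewrite ger0_norm//; lra.
rewrite (integral_finE int1) (integral_finE int2) => -[E].
transitivity (\int[Q]_w ((xcut j w + B) * phi w.2 - (h j w.2 + B) * phi w.2)).
  by apply: eq_Rintegral => w _; rewrite /xtil; ring.
by rewrite RintegralB// E subrr.
Qed.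

Lemma xtil_orth j (phi : Rvec R d -> R) (M : R) : measurable_fun setT phi ->
  (forall z, `|phi z| <= M) -> \int[Q]_w (xtil j w * phi w.2) = 0.
Proof.
move=> mphi phiM.
have M0 : 0 <= M by apply: le_trans (phiM point).
have B0 : 0 <= B by apply: le_trans (xtil_bound j point).
have mphiM : measurable_fun setT (fun z => phi z + M) by exact: measurable_funD.
have b1 z : 0 <= phi z + M <= 2 * M.
  by have := phiM z; rewrite ler_norml => /andP[? ?]; apply/andP; split; lra.
have b2 (z : Rvec R d) : 0 <= cst M z <= M by rewrite /cst lexx M0.
have E1 := xtil_orth_ge0 j mphiM b1.
have E2 := xtil_orth_ge0 j (measurable_cst M) b2.
have mpz : measurable_fun setT (fun w : obs R p d => phi w.2).
  by apply: measurableT_comp => //; exact: measurable_snd.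
have int1 : Q.-integrable setT (EFin \o (fun w => xtil j w * (phi w.2 + M))).
  apply: (@bounded_integrable _ _ _ _ _ (B * (2 * M))).
    by apply: measurable_funM; [exact: measurable_xtil|exact: measurable_funD].
  move=> w; rewrite normrM ler_pM ?xtil_bound//.
  by have /andP[? ?] := b1 w.2; rewrite ger0_norm.
have int2 : Q.-integrable setT (EFin \o (fun w : obs R p d => xtil j w * cst M w.2)).
  apply: (@bounded_integrable _ _ _ _ _ (B * M)).
    by apply: measurable_funM => //; exact: measurable_xtil.
  by move=> w; rewrite normrM ler_pM ?xtil_bound// ger0_norm.
transitivity (\int[Q]_w (xtil j w * (phi w.2 + M) - xtil j w * cst M w.2)).
  by apply: eq_Rintegral => w _; rewrite /cst; ring.
by rewrite RintegralB// E1 E2 subrr.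
Qed.

Lemma cov_tildeE j k : cov_tilde Q h j k = \int[Q]_w (xtil j w * xtil k w).
Proof.
rewrite mxE; congr fine; apply: ae_eq_integral => //.
- apply/measurable_EFinP; apply: measurable_funM; apply: measurable_funB => //;
  exact: measurable_h.
- by apply/measurable_EFinP; apply: measurable_funM; exact: measurable_xtil.
- by apply: ae_xcut => w nN; rewrite /xtil !xcutE.
Qed.

Lemma cov_tilde_ge (a : R) (v : 'cV[R]_p) : smallest_eigenvalue (cov_tilde Q h) a ->
  a * (\sum_j v j ord0 ^+ 2) <= \sum_j \sum_k v j ord0 * v k ord0 * cov_tilde Q h j k.
Proof.
move=> Hmin.
have sym j k : cov_tilde Q h j k = cov_tilde Q h k j.
  by rewrite !mxE; congr fine; apply: eq_integral => w _; rewrite mulrC.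
have := rayleigh_min sym Hmin v^T.
rewrite /sqn /qform; under eq_bigr do rewrite mxE.
by under [X in _ <= X -> _]eq_bigr do under eq_bigr do rewrite 2!mxE.
Qed.

End population.

(** * Rates and the probability budget *)

Lemma powR_half {R : realType} (mu b : R) (s : nat) : 0 < mu ->
  (mu / 2 ^+ s) `^ (- b) = mu `^ (- b) * (2 `^ b) ^+ s.
Proof.
move=> mu0; have p0 : 0 < 2 ^+ s :> R by rewrite exprn_gt0.
rewrite /powR !gt_eqF ?divr_gt0// -expRM_natl -expRD.
rewrite lnM ?posrE ?invr_gt0// lnV ?posrE// lnXn// -mulr_natl.
by congr expR; ring.
Qed.

(** Raising the hypothesis to the power [(2m+1)/(2m)] trades [1/n] against [mu^(2+1/m)], and
    [kappa >= 1] absorbs the exponent on [kappa]. In logarithms all of this is linear. *)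
Lemma sample_size_bound {R : realType} (n : nat) (m kappa mu : R) :
  (0 < n)%N -> 2^-1 < m -> 1 <= kappa -> 0 < mu ->
  kappa * n%:R `^ (- (2 * m / (2 * m + 1))) <= mu ^+ 2 ->
  kappa * mu `^ (- m^-1) <= n%:R * mu ^+ 2.
Proof.
move=> n0 m2 k1 mu0.
have m0 : 0 < m by lra.
have k0 : 0 < kappa by lra.
have nR : 0 < n%:R :> R by rewrite ltr0n.
have lk : 0 <= ln kappa by rewrite ln_ge0.
rewrite /powR !gt_eqF//.
rewrite -[kappa]lnK ?posrE// -[mu ^+ 2]lnK ?posrE ?exprn_gt0//.
rewrite -{2}[n%:R]lnK ?posrE// -!expRD !ler_expR lnXn// => H.
set x := ln n%:R in H *; set y := ln mu in H *; set k := ln kappa in H lk *.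
rewrite -[y *+ 2]mulr_natl in H *.
have m1 : 0 < 2 * m + 1 by lra.
have H2 : k * (2 * m + 1) - 2 * m * x <= 2 * y * (2 * m + 1).
  have -> : k * (2 * m + 1) - 2 * m * x =
      (k + - (2 * m / (2 * m + 1)) * x) * (2 * m + 1) by field; rewrite gt_eqF.
  by rewrite ler_pM2r.
rewrite -(@ler_pM2r _ (2 * m))//; last by lra.
have -> : (k + - m^-1 * y) * (2 * m) = 2 * m * k - 2 * y by field; rewrite gt_eqF.
nra.
Qed.

(** [p^2 exp (- x) <= p^2 / (2 p)^4] leaves at most [8 / (16 p)] for the three unions, and
    [exp (- W/4) <= 1/3] merges the other tails into [(8/3 + 1) exp (- W/4)]. *)
Lemma tail_budget {R : realType} (p : nat) (W tn x1 x2 x3 : R) :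
  (0 < p)%N -> 8 <= W -> W / 4 <= tn ->
  4 * ln (2 * p%:R) <= x1 -> 4 * ln (2 * p%:R) <= x2 -> 4 * ln (2 * p%:R) <= x3 ->
  4 * expR (- (W / 2)) + (4 * expR (- (W / 2)) + expR (- tn))
    + (p%:R * (4 * expR (- x1)) + (p%:R * (2 * expR (- x2)) + p%:R * (p%:R * (2 * expR (- x3)))))
  <= 2 / p%:R + 6 * expR (- (W / 4)).
Proof.
move=> p0 W8 Wn h1 h2 h3.
have pR : 1 <= p%:R :> R by rewrite ler1n.
have pp : 0 < p%:R :> R by rewrite ltr0n.
have tail (x : R) : 4 * ln (2 * p%:R) <= x -> p%:R * (p%:R * expR (- x)) <= 16^-1 / p%:R.
  move=> hx; apply: (@le_trans _ _ (p%:R * (p%:R * expR (- (4 * ln (2 * p%:R)))))).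
    apply: ler_wpM2l; first exact: ltW.
    apply: ler_wpM2l; first exact: ltW.
    by rewrite ler_expR lerN2.
  rewrite expRN expRM_natl lnK ?posrE ?mulr_gt0//.
  have -> : p%:R * (p%:R / (2 * p%:R) ^+ 4) = 16^-1 / p%:R * p%:R^-1 :> R.
    by field; rewrite gt_eqF.
  by rewrite ler_piMr ?divr_ge0// invf_le1.
have ple (x : R) : p%:R * expR (- x) <= p%:R * (p%:R * expR (- x)) :> R.
  by rewrite ler_pM2l// ler_peMl// expR_ge0.
have e1 : expR (- (W / 2)) <= expR (- (W / 4)) / 3.
  have -> : - (W / 2) = - (W / 4) + - (W / 4) by field.
  rewrite expRD ler_wpM2l ?expR_ge0// expRN lef_pV2 ?posrE ?expR_gt0//.
  by apply: le_trans (expR_ge1Dx _); lra.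
have e2 : expR (- tn) <= expR (- (W / 4)) by rewrite ler_expR lerN2.
have e3 := expR_ge0 (- (W / 4)).
have i0 : 0 <= p%:R^-1 :> R by rewrite invr_ge0 ltW.
have := tail _ h1; have := tail _ h2; have := tail _ h3.
have := ple x1; have := ple x2.
lra.
Qed.

Lemma sup_entropyS {R : realType} {T : Type} (G C C' : set (T -> R)) (u : R) :
  C `<=` C' -> (sup_entropy G C u <= sup_entropy G C' u)%E.
Proof.
move=> CC'; apply: le_ereal_inf => _ [N [c [[Gc cov] ->]]].
by exists N, c; split => //; split => // g /CC'; exact: cov.
Qed.

Section good_events.
Context {R : realType} {n p d : nat} {dO : measure_display} {Om : measurableType dO}.
Variables (P : probability Om R) (Q : probability (obs R p d) R).
Variables (XZ : 'I_n -> Om -> obs R p d) (e : 'I_n -> Om -> R).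
Hypotheses (n0 : (0 < n)%N) (p0 : (0 < p)%N).
Hypothesis mXZ : forall i, measurable_fun setT (XZ i).
Hypothesis me : forall i, measurable_fun setT (e i).
Hypothesis indep : mutually_indep2 P n XZ e.
Hypothesis lawXZ : forall i (S : set (obs R p d)), measurable S -> P (XZ i @^-1` S) = Q S.
Hypothesis lawe : forall i (B : set R), measurable B -> P (e i @^-1` B) = normal01 B.
Variables (xt : 'I_p -> obs R p d -> R) (C : set (Rvec R d -> R)).
Variables (B K c2 ep rho q AE mu lam : R).
Hypothesis mxt : forall j, measurable_fun setT (xt j).
Hypothesis xtB : forall j w, `|xt j w| <= B.
Hypothesis orth : forall j (phi : Rvec R d -> R) (M : R), measurable_fun setT phi ->
  (forall z, `|phi z| <= M) -> \int[Q]_w (xt j w * phi w.2) = 0.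
Hypothesis C_meas : forall f, C f -> measurable_fun setT f.
Hypothesis C_bound : forall f, C f -> forall t, `|f t| <= K.
Hypothesis C_var : forall f, C f -> \int[Q]_x (f x.2 ^+ 2) <= mu ^+ 2.
Hypotheses (B0 : 0 < B) (K0 : 0 < K) (ep0 : 0 < ep) (ep13 : 3 * ep <= 1).
Hypotheses (c2_ge1 : 1 <= c2) (c2_K : 64 * K ^+ 2 <= c2).
Hypotheses (c2_B : 4 * B ^+ 2 <= c2) (c2_B4 : 16 * B ^+ 4 <= c2).
Hypotheses (q0 : 0 < q) (q1 : q < 1) (rho2 : 2 <= rho) (rhoq : rho = 4 * q ^+ 2).
Hypothesis AE0 : 0 <= AE.
Hypothesis nets : forall s : nat, exists (N : nat) (c : nat -> Rvec R d -> R),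
    [/\ forall k, C (c k), N%:R <= expR (AE * rho ^+ s + 1) &
        forall f, C f -> exists2 k, (k < N)%N & forall z, `|f z - c k z| <= 2 * (mu / 2 ^+ s)].
Hypotheses (mu0 : 0 < mu) (mu1 : mu <= 1) (lam0 : 0 < lam).
Let D := rate c2 ep q.
Hypotheses (AE_le : 8 * AE <= D * (n%:R * mu ^+ 2)) (D_ge8 : 8 <= D * (n%:R * mu ^+ 2)).
Hypothesis lam_ge : 8 * ln (2 * p%:R) <= D * (n%:R * lam ^+ 2).

Let nR : 0 < n%:R :> R. Proof. by rewrite ltr0n. Qed.
Let D0 : 0 < D. Proof. exact: rate_gt0. Qed.
Let ep1 : ep <= 1. Proof. by have e3 := ep13; have e0 := ep0; lra. Qed.
Let D_le : D <= ep ^+ 2 / c2.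
Proof.
have c20 : 0 < c2 by exact: lt_le_trans c2_ge1.
rewrite /D /rate -mulrA; apply: ler_wpM2l; first exact: sqr_ge0.
apply: (@le_trans _ _ (1 / (72 * c2))).
  apply: ler_wpM2r; first by rewrite invr_ge0 mulr_ge0 ?ltW.
  by rewrite -[leRHS](expr1n _ 2) lerXn2r ?nnegrE ?subr_ge0 ?(ltW q1)// lerBlDr lerDl ltW.
by rewrite mul1r lef_pV2 ?posrE ?mulr_gt0//; lra.
Qed.

Lemma good_events : whp P (2 / p%:R + 6 * expR (- (D * (n%:R * mu ^+ 2) / 4))) (fun w =>
  [/\ forall j, `|emp XZ e (fun x => x.2 * xt j x.1) w| <= ep * lam,
      forall j k, `|emp XZ e (fun x => xt j x.1 * xt k x.1) w -
         \int[Q]_x (xt j x * xt k x)| <= ep * lam,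
      forall f, C f -> `|emp XZ e (fun x => x.2 * f x.1.2) w| <= 3 * ep * mu * mu,
      forall j f, C f -> `|emp XZ e (fun x => xt j x.1 * f x.1.2) w| <= 3 * ep * mu * (lam + mu) &
      forall f, C f -> `|emp XZ e (fun x => f x.1.2 ^+ 2) w - \int[Q]_x (f x.2 ^+ 2)|
        <= 3 * ep * mu ^+ 2]).
Proof.
have c20 : 0 < c2 by exact: lt_le_trans c2_ge1.
have el0 : 0 < ep * lam by exact: mulr_gt0.
have msnd : measurable_fun setT (snd : obs R p d -> Rvec R d) by exact: measurable_snd.
have lam0' := lam0; have mu0' := mu0; have D0' := D0.
set W := D * (n%:R * mu ^+ 2).
pose nu := lam + mu.
have munu : mu <= nu by rewrite /nu lerDr ltW.
have nu2 : mu ^+ 2 <= nu ^+ 2 by rewrite lerXn2r ?nnegrE ?(ltW mu0)// (le_trans (ltW mu0)).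
have nul : lam ^+ 2 <= nu ^+ 2.
  by rewrite lerXn2r ?nnegrE ?addr_ge0 ?(ltW lam0) ?(ltW mu0)// lerDl ltW.
have Wnu : W <= D * (n%:R * nu ^+ 2).
  by rewrite /W; apply: ler_wpM2l; [exact: ltW|rewrite ler_pM2l].
have proc5 := sq_process n0 mXZ me indep lawXZ lawe msnd C_meas C_bound C_var mu0 K0 ep0 ep1
  c2_ge1 c2_K q0 q1 rho2 rhoq AE0 nets AE_le D_ge8.
have sg3 : forall (f : Rvec R d -> R) (k : R), measurable_fun setT f ->
    (forall t, `|f t| <= k) -> forall b : R,
   (\int[Q]_x \int[normal01]_y (expR (b * (y * f x.2) - b ^+ 2 / 2 * (c2 * f x.2 ^+ 2)))%:E <= 1)%E.
  by move=> f k mf fk b; exact: (gauss_sg Q b (measurableT_comp mf msnd) c2_ge1).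
have sg4 j : forall (f : Rvec R d -> R) (k : R), measurable_fun setT f ->
    (forall t, `|f t| <= k) -> forall b : R,
   (\int[Q]_x \int[normal01]_y (expR (b * (xt j x * f x.2) - b ^+ 2 / 2 * (c2 * f x.2 ^+ 2)))%:E <= 1)%E.
  move=> f k mf fk b.
  have mfx : measurable_fun setT (fun x : obs R p d => f x.2) by exact: measurableT_comp.
  (* The single test function of [z] at which the sub-Gaussian bound for [xt j * f] uses conditional
     centring. *)
  have mphi : measurable_fun setT (fun z => b * f z * expR (- (2 * (b * f z * B) ^+ 2))).
    apply: measurable_funM; first exact: measurable_funM.
    apply: measurableT_comp => //; apply: measurableT_comp => //; apply: measurable_funM => //.
    by apply: measurable_funX; apply: measurable_funM => //; exact: measurable_funM.
  have phib z : `|b * f z * expR (- (2 * (b * f z * B) ^+ 2))| <= `|b| * k.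
    rewrite !normrM -[leRHS]mulr1 ler_pM ?mulr_ge0//; first by rewrite ler_wpM2l.
    by rewrite ger0_norm ?expR_ge0// -expR0 ler_expR oppr_le0 mulr_ge0 ?sqr_ge0.
  have := bounded_sg (mxt j) mfx B0 (xtB j) (orth j mphi phib).
  apply: le_trans.
  rewrite !(no_noise Q (phi := fun x => expR _)); last 4 first.
  - apply: measurableT_comp => //; apply: measurable_funB; apply: measurable_funM => //.
      exact: measurable_funM.
    by apply: measurable_funM => //; exact: measurable_funX.
  - by move=> x; exact: expR_ge0.
  - apply: measurableT_comp => //; apply: measurable_funB; apply: measurable_funM => //.
      exact: measurable_funM.
    by apply: measurable_funM => //; exact: measurable_funX.
  - by move=> x; exact: expR_ge0.
  apply: ge0_le_integral => //.
  - apply/measurable_EFinP; apply: measurableT_comp => //.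
    apply: measurable_funB; apply: measurable_funM => //.
      exact: measurable_funM.
    by apply: measurable_funM => //; exact: measurable_funX.
  - apply/measurable_EFinP; apply: measurableT_comp => //.
    apply: measurable_funB; apply: measurable_funM => //.
      exact: measurable_funM.
    by apply: measurable_funM => //; exact: measurable_funX.
  - move=> x _; rewrite lee_fin ler_expR lerD2l lerN2; apply: ler_wpM2l.
      by rewrite divr_ge0 ?sqr_ge0.
    by rewrite ler_wpM2r ?sqr_ge0.
have proc3 := lin_process n0 mXZ me indep lawXZ lawe msnd C_meas C_bound mu0 ep0
  c2_ge1 q0 q1 rho2 rhoq AE0 nets (xi := fun x => x.2) 3 measurable_snd (lexx _) sg3 AE_le D_ge8.
have mxt1 j : measurable_fun setT (fun x : obs R p d * R => xt j x.1).
  by apply: (measurableT_comp (mxt j)); exact: measurable_fst.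
have proc4 j := lin_process n0 mXZ me indep lawXZ lawe msnd C_meas C_bound mu0 ep0
  c2_ge1 q0 q1 rho2 rhoq AE0 nets (xi := fun x => xt j x.1) B (mxt1 j) munu (sg4 j)
  (le_trans AE_le Wnu) (le_trans D_ge8 Wnu).
have noise := emp_abs_noise n0 mXZ me indep lawXZ lawe.
have ev1 j : whp P (2 * expR (- (n%:R * (ep * lam) ^+ 2 / (2 * c2))))
    (fun w => `|emp XZ e (fun x => x.2 * xt j x.1) w| <= ep * lam).
  apply: (emp_dev n0 mXZ me indep lawXZ lawe (v := fun x => 1 * xt j x.1 ^+ 2)) => //.
  - by apply: measurable_funM => //; exact: measurable_snd.
  - by apply: measurable_funM => //; exact: measurable_funX.
  - move=> x; rewrite mul1r; apply: le_trans c2_B; rewrite -(real_normK (num_real (xt j x.1))).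
    have : `|xt j x.1| ^+ 2 <= B ^+ 2 by rewrite lerXn2r ?nnegrE ?(ltW B0).
    by have := sqr_ge0 B; lra.
  - by move=> b; exact: (gauss_sg Q b (mxt j) (lexx 1)).
have ev2 j k : whp P (2 * expR (- (n%:R * (ep * lam) ^+ 2 / (2 * (16 * (B ^+ 2) ^+ 2)))))
    (fun w => `|emp XZ e (fun x => xt j x.1 * xt k x.1) w - \int[Q]_x (xt j x * xt k x)| <= ep * lam).
  apply: (emp_centered n0 mXZ me indep lawXZ lawe) => //.
  - exact: measurable_funM.
  - exact: exprn_gt0.
  - by move=> x; rewrite normrM expr2 ler_pM.
apply: whpW (whp_and (whp_and proc5 (whp_and proc3 noise))
  (whp_and (whp_ord proc4) (whp_and (whp_ord ev1) (whp_ord (fun j => whp_ord (ev2 j)))))) _ _.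
  have lg := lam_ge.
  have nl0 : 0 <= n%:R * lam ^+ 2 by rewrite mulr_ge0 ?sqr_ge0.
  have Dn : D * (n%:R * lam ^+ 2) <= ep ^+ 2 / c2 * (n%:R * lam ^+ 2) by exact: ler_wpM2r.
  apply: tail_budget => //.
  - have D1 : D <= 1.
      apply: (le_trans D_le); rewrite ler_pdivrMr// mul1r (le_trans _ c2_ge1)//.
      by rewrite -[leRHS](expr1n _ 2) lerXn2r ?nnegrE ?(ltW ep0).
    have nmu : n%:R * mu ^+ 2 <= n%:R.
      rewrite -[leRHS]mulr1; apply: ler_wpM2l; first exact: ltW.
      by rewrite -[leRHS](expr1n _ 2) lerXn2r ?nnegrE ?(ltW mu0).
    have nmu0 : 0 <= n%:R * mu ^+ 2 by rewrite mulr_ge0 ?sqr_ge0.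
    have Wn : W <= n%:R.
      by apply: le_trans nmu; rewrite -[leRHS]mul1r; exact: ler_wpM2r.
    have W0 : 0 <= W by rewrite mulr_ge0// ltW.
    by rewrite -/D -/W; lra.
  - have : D * (n%:R * lam ^+ 2) <= D * (n%:R * nu ^+ 2).
      by apply: ler_wpM2l; [exact: ltW|rewrite ler_pM2l].
    by rewrite -/D; lra.
  - have -> : n%:R * (ep * lam) ^+ 2 / (2 * c2) = ep ^+ 2 / c2 * (n%:R * lam ^+ 2) / 2.
      by field; rewrite gt_eqF.
    lra.
  - have B4 : 16 * (B ^+ 2) ^+ 2 <= c2 by rewrite -exprM.
    have B40 : 0 < 16 * (B ^+ 2) ^+ 2 by rewrite mulr_gt0// !exprn_gt0.
    have : ep ^+ 2 / c2 * (n%:R * lam ^+ 2) <= ep ^+ 2 / (16 * (B ^+ 2) ^+ 2) * (n%:R * lam ^+ 2).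
      apply: ler_wpM2r => //; apply: ler_wpM2l; first exact: sqr_ge0.
      by rewrite lef_pV2 ?posrE.
    have -> : n%:R * (ep * lam) ^+ 2 / (2 * (16 * (B ^+ 2) ^+ 2)) =
        ep ^+ 2 / (16 * (B ^+ 2) ^+ 2) * (n%:R * lam ^+ 2) / 2.
      by field; rewrite gt_eqF.
    lra.
move=> w [[H5 [H3 Hn]] [H4 [H1 H2]]].
(* The premise under which the product processes were bounded. *)
have sq2 f : C f -> emp XZ e (fun x => f x.1.2 ^+ 2) w <= 2 * mu ^+ 2.
  move=> Cf; have := H5 f Cf; rewrite ler_norml => /andP[_ H].
  have := C_var Cf; move: H; set I := \int[Q]_x _ => H I2.
  by have := ler_wpM2r (sqr_ge0 mu) ep13; lra.
split=> //.
- by move=> f; exact: H3.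
- move=> j f; apply: H4 => //.
  rewrite ler_pdivrMl// -sum_ordc; apply: ler_sum => i _; exact: xtB.
Qed.

End good_events.

(** * Choice of the constants and reduction to the unit scale *)

Lemma pow2_lt4 {R : realType} (b : R) : b < 2 -> 2 `^ b < 4.
Proof.
move=> b2; have ln2 : 0 < ln (2 : R) by rewrite ln_gt0// ltr1n.
have -> : 4 = expR (2 * ln 2) :> R by rewrite expRM_natl lnK ?posrE// -natrX.
by rewrite /powR gt_eqF// ltr_expR ltr_pM2r.
Qed.

Lemma L2norm0 {R : realType} {p d : nat} (Q : probability (obs R p d) R) :
  L2norm Q (fun=> 0) = 0.
Proof.
rewrite /L2norm; under eq_integral do rewrite expr0n.
by rewrite integral0 sqrtr0.
Qed.

Lemma scale_in_ball {R : realType} {p d : nat} (Q : probability (obs R p d) R)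
  (G : set (Rvec R d -> R)) (J : (Rvec R d -> R) -> (Rvec R d -> R) -> R) (mu t : R) g :
  L2_subspace Q G -> semi_inner_product G J -> 0 < mu -> 0 < t ->
  G g -> L2norm Q g <= t -> mu * Jnorm J g <= t ->
  [/\ G (fun z => mu / t * g z), L2norm Q (fun z => mu / t * g z) <= mu &
      Jnorm J (fun z => mu / t * g z) <= 1].
Proof.
move=> GL2 JG mu0 t0 Gg Lg Jg; have c0 : 0 < mu / t by rewrite divr_gt0.
split; first exact: (G_scale GL2).
  rewrite (L2normZ GL2)// gtr0_norm// mulrAC ler_pdivrMr//.
  by apply: ler_wpM2l => //; exact: ltW.
apply: (le_trans (JnormZ_le GL2 JG _ Gg)).
by rewrite gtr0_norm// mulrAC ler_pdivrMr// mul1r.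
Qed.

Lemma le_of_scaled {R : realType} (mu t x c : R) : 0 < mu -> 0 < t ->
  `|mu / t * x| <= c * mu -> `|x| <= c * t.
Proof.
move=> mu0 t0; have c0 : 0 < mu / t by rewrite divr_gt0.
rewrite normrM (gtr0_norm c0) -ler_pdivlMl// => H; apply: (le_trans H).
by apply: le_of_eq; field; rewrite !gt_eqF.
Qed.

(** [m > 1/2] gives [2^(1/m) < 4], hence [q < 1]. The maximum with 2 makes [rho^(s+1)] outgrow the
    level number in the count of links. *)
Lemma chaining_ratio {R : realType} (m : R) : 2^-1 < m ->
  exists rho q : R, [/\ 2 <= rho, 2 `^ m^-1 <= rho, 0 < q, q < 1 & rho = 4 * q ^+ 2].
Proof.
move=> m2; have m0 : 0 < m by lra.
pose rho := Num.max (2 `^ m^-1) (2 : R).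
have rho2 : 2 <= rho by rewrite /rho le_max lexx orbT.
have rho4 : rho < 4.
  rewrite /rho gt_max pow2_lt4 /=; first by lra.
  by rewrite -[2]invrK ltf_pV2 ?posrE.
have rho0 : 0 < rho by exact: lt_le_trans rho2.
exists rho, (Num.sqrt rho / 2).
have rhoq : rho = 4 * (Num.sqrt rho / 2) ^+ 2.
  by rewrite exprMn sqr_sqrtr ?(ltW rho0)//; field.
split => //; [by rewrite /rho le_max lexx|by rewrite divr_gt0// sqrtr_gt0|].
rewrite ltNge; apply/negP => q1.
have : 1 ^+ 2 <= (Num.sqrt rho / 2) ^+ 2.
  by rewrite lerXn2r ?nnegrE// (le_trans _ q1).
by rewrite expr1n; clear -rho4 rhoq; lra.
Qed.

(** [a] and [b] stand for [|Kg|] and [|KX|], [Hh] for the radius of a ball of [G] containing every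
    [h j]; then [B] bounds [x - h], and [c2] dominates every variance proxy. *)
Lemma process_constants {R : realType} (a b Hh : R) : 0 <= a -> 0 <= b -> 0 < Hh ->
  exists K B c2 : R, [/\ K = a + 1, B = b + K * Hh, 0 < K & 0 < B] /\
    [/\ 1 <= c2, 64 * K ^+ 2 <= c2, 4 * B ^+ 2 <= c2 & 16 * B ^+ 4 <= c2].
Proof.
move=> a0 b0 H0; have K0 : 0 < a + 1 by lra.
exists (a + 1), (b + (a + 1) * Hh).
have B0 : 0 < b + (a + 1) * Hh by rewrite ltr_wpDl// mulr_gt0.
move: K0 B0; move: (a + 1) (b + _ * _) => K B K0 B0.
exists (1 + 4 * B ^+ 2 + 64 * K ^+ 2 + 16 * B ^+ 4).
have [B2 K2 B4] : [/\ 0 <= B ^+ 2, 0 <= K ^+ 2 & 0 <= B ^+ 4].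
  by rewrite !exprn_ge0// ltW.
by split; split => //; clear -B2 K2 B4; lra.
Qed.

(** The constant is tuned to give [8 (A + 1) mu^(-1/m) <= D n mu^2]; as [mu <= 1], this covers the
    entropy and the constant 8 at once. *)
Lemma rate_conditions {R : realType} (A m D mu : R) n : (0 < n)%N -> 2^-1 < m -> 0 < A ->
  0 < D -> 0 < mu -> mu <= 1 ->
  (1 + 8 * (A + 1) / D) * n%:R `^ (- (2 * m / (2 * m + 1))) <= mu ^+ 2 ->
  [/\ 0 <= A * mu `^ (- m^-1), 8 * (A * mu `^ (- m^-1)) <= D * (n%:R * mu ^+ 2) &
      8 <= D * (n%:R * mu ^+ 2)].
Proof.
move=> n0 m2 A0 D0 mu0 mu1 kmu; have m0 : 0 < m by lra.
pose kap := 1 + 8 * (A + 1) / D.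
have kap1 : 1 <= kap by rewrite /kap lerDl divr_ge0 ?(ltW D0)// mulr_ge0//; lra.
have := sample_size_bound n0 m2 kap1 mu0 kmu.
have : 1 <= mu `^ (- m^-1).
  rewrite /powR gt_eqF// -[leLHS]expR0 ler_expR mulr_le0 ?ln_le0//.
  by rewrite oppr_le0 invr_ge0 ltW.
move: (mu `^ _) (n%:R * _) => E t E1 nmu.
have Dt : 8 * (A + 1) * E <= D * t.
  apply: (@le_trans _ _ (D * (kap * E))); last by rewrite ler_pM2l.
  have -> : D * (kap * E) = D * E + 8 * (A + 1) * E by rewrite /kap; field; rewrite gt_eqF.
  rewrite lerDr mulr_ge0 ?(ltW D0)//; exact: le_trans E1.
have AE0 : 0 <= A * E by rewrite mulr_ge0 ?(ltW A0)//; exact: le_trans E1.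
by split=> //; clear -Dt AE0 E1; lra.
Qed.

Lemma regularization_condition {R : realType} (D lam : R) n p : (0 < n)%N -> (0 < p)%N ->
  0 < D -> 0 < lam ->
  Num.sqrt (2 * ln (2 * p%:R) / n%:R) / (Num.sqrt D / 2) <= lam ->
  8 * ln (2 * p%:R) <= D * (n%:R * lam ^+ 2).
Proof.
move=> n0 p0 D0 lam0; have nR : 0 < n%:R :> R by rewrite ltr0n.
have pR : 1 <= p%:R :> R by rewrite ler1n.
have l0 : 0 <= ln (2 * p%:R) :> R by rewrite ln_ge0//; lra.
rewrite ler_pdivrMr ?divr_gt0 ?sqrtr_gt0// => H.
have : 2 * ln (2 * p%:R) / n%:R <= (lam * (Num.sqrt D / 2)) ^+ 2.
  rewrite -[leLHS]sqr_sqrtr ?divr_ge0 ?mulr_ge0 ?(ltW nR)//.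
  by rewrite lerXn2r ?nnegrE ?sqrtr_ge0// mulr_ge0 ?divr_ge0 ?sqrtr_ge0 ?(ltW lam0).
rewrite !exprMn sqr_sqrtr ?(ltW D0)// ler_pdivrMr//.
have -> : lam ^+ 2 * (D * 2^-1 ^+ 2) * n%:R = D * (n%:R * lam ^+ 2) / 4 by field.
by move: (ln _) (D * _) => a b; clear; lra.
Qed.

Theorem theorem2 (R : realType) (LXmin Lhmax KX Kg Jh A m : R) :
  0 < LXmin -> 0 <= Lhmax -> 0 < A -> 2^-1 < m ->
  exists delta0 deltaT kappaT : R,
    [/\ 0 < delta0, delta0 <= 253^-1, 0 < deltaT & 0 < kappaT] /\
  forall (n p d : nat) (dO : measure_display) (Om : measurableType dO)
    (P : probability Om R) (Q : probability (obs R p d) R)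
    (XZ : 'I_n -> Om -> obs R p d) (e : 'I_n -> Om -> R)
    (G : set (Rvec R d -> R)) (J : (Rvec R d -> R) -> (Rvec R d -> R) -> R)
    (h : 'I_p -> Rvec R d -> R) (beta0 : 'cV[R]_p) (g0 : Rvec R d -> R),
    (0 < n)%N -> (0 < p)%N ->
    (* sampling: (x_i, z_i) i.i.d. ~ Q; (C1) e_i i.i.d. N(0,1), independent of them *)
    (forall i, measurable_fun setT (XZ i)) ->
    (forall i, measurable_fun setT (e i)) ->
    mutually_indep2 P n XZ e ->
    (forall i (S : set (obs R p d)), measurable S -> P (XZ i @^-1` S) = Q S) ->
    (forall i (B : set R), measurable B -> P (e i @^-1` B) = normal_prob 0 1 B) ->
    (* the function class *)
    L2_subspace Q G -> semi_inner_product G J -> G g0 ->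
    (* h = E[x | z] *)
    cond_exp_x_given_z Q h ->
    (* (C2) *)
    {ae Q, forall w : obs R p d, forall j : 'I_p, `|(w.1 : 'rV[R]_p) ord0 j| <= KX} ->
    (* (C3): LXmin^2, Lhmax^2 are the smallest / largest eigenvalues *)
    smallest_eigenvalue (cov_tilde Q h) (LXmin ^+ 2) ->
    largest_eigenvalue (cov_h Q h) (Lhmax ^+ 2) ->
    (* (C4) *)
    (forall u : R, 0 < u ->
       (sup_entropy G (unit_class Q G J) u <= (A * u `^ (- m^-1))%:E)%E) ->
    (* (C5) *)
    (forall g, unit_class Q G J g -> forall z, `|g z| <= Kg) ->
    (* (C6) *)
    (forall j, G (h j) /\ Jnorm J (h j) <= Jh) ->
  forall lam mu Rad : R, 0 < lam -> 0 < mu -> 0 < Rad ->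
    kappaT * n%:R `^ (- (2 * m / (2 * m + 1))) <= mu ^+ 2 ->
    mu ^+ 2 <= delta0 * Rad ^+ 2 / (2 * (1 + Jnorm J g0 + Jh) ^+ 2) ->
    Rad ^+ 2 <= lam -> lam <= 1 ->
    4 * lam ^+ 2 * (support_size beta0)%:R / LXmin ^+ 2 <= delta0 * Rad ^+ 2 ->
    Num.sqrt (2 * ln (2 * p%:R) / n%:R) / deltaT <= lam ->
    1 + Lhmax / LXmin <= mu^-1 ->
  exists Ev : set Om, measurable Ev /\
    (P Ev >= (1 - 2 / p%:R - 6 * expR (- (n%:R * deltaT ^+ 2 * mu ^+ 2)))%:E)%E /\
    forall w, Ev w ->
      let X := fun i => ((XZ i w).1 : 'rV[R]_p) in
      let Z := fun i => (XZ i w).2 in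
      let Y := fun i => (X i *m beta0) ord0 ord0 + g0 (Z i) + e i w in
      forall (bhat : 'cV[R]_p) (ghat : Rvec R d -> R),
        is_minimizer G X Z Y J lam mu bhat ghat ->
        tilde_pred_norm2 X Z h (bhat - beta0) + lam / 4 * l1norm (bhat - beta0)
          <= (support_size beta0)%:R * lam ^+ 2 / LXmin ^+ 2.
Proof.
move=> LX0 Lh0 A0 m2.
have [d0 d0E] : exists d0 : R, d0 = 1000^-1 by exists 1000^-1.
(* The chained bounds cost [3 * ep], so [1/3000] meets the tolerance [1/1000] of the deterministic
   part. *)
have [ep epE] : exists ep : R, ep = 3000^-1 by exists 3000^-1.
have ep0 : 0 < ep by rewrite epE; lra.
have ep13 : 3 * ep <= 1 by rewrite epE; lra.
have ep3 : 3 * ep = 1000^-1 by rewrite epE; field.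
have d00 : 0 < d0 by rewrite d0E; lra.
have d01 : d0 <= 253^-1 by rewrite d0E; lra.
have [Hh HhE] : exists Hh : R, Hh = 1 + Lhmax + `|Jh| by eexists.
have Hh0 : 0 < Hh by rewrite HhE -addrA ltr_pwDl// addr_ge0.
have [rho [q [rho2 rho_b q0 q1 rhoq]]] := chaining_ratio m2.
have [K [B [c2 [[KE BE K0 B0] [c2_ge1 c2_K c2_B c2_B4]]]]] :=
  process_constants (normr_ge0 Kg) (normr_ge0 KX) Hh0.
have D0 : 0 < rate c2 ep q by exact: rate_gt0.
(* [deltaT ^ 2 = rate / 4], so [n deltaT^2 mu^2] is the exponent in the probability of the good
   events. *)
exists d0, (Num.sqrt (rate c2 ep q) / 2), (1 + 8 * (A + 1) / rate c2 ep q); split.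
  split; [exact: d00|exact: d01|by rewrite divr_gt0// sqrtr_gt0|].
  by rewrite ltr_pwDl// divr_ge0 ?(ltW D0)// mulr_ge0// addr_ge0// ltW.
move=> n p d dO Om P Q XZ e G J h beta0 g0 n0 p0 mXZ me indep lawXZ lawe GL2 JG Gg0 hx xK
  Smin Smax ent HK hG lam mu Rad lam0 mu0 Rad0 kmu mu_le Rad_le lam_le s0_le lam_ge mu_inv.
have nR : 0 < n%:R :> R by rewrite ltr0n.
have G0 := G_zero GL2; have Glin := G_lin GL2.
have Gh j : G (h j) by have [] := hG j.
have Jh_le j : Jnorm J (h j) <= Jh by have [] := hG j.
have Jh0 : 0 <= Jh by apply: le_trans (Jh_le (Ordinal p0)); exact: Jnorm_ge0.
have mu1 : mu <= 1.
  have : 1 <= mu^-1 by apply: le_trans mu_inv; rewrite lerDl divr_ge0// ltW.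
  by rewrite -[X in X <= _ -> _]invr1 lef_pV2 ?posrE.
have [AE0 AE_le D_ge8] := rate_conditions n0 m2 A0 D0 mu0 mu1 kmu.
have lam_ge' := regularization_condition n0 p0 D0 lam0 lam_ge.
have [N [mN QN xN]] := xK.
have xB w : ~ N w -> forall j, `|w.1 ord0 j| <= `|KX|.
  move=> nNw j; apply: le_trans (ler_norm KX).
  by apply: contrapT => H; apply: nNw; apply: xN => /(_ j).
have hB j z : `|h j z| <= B - `|KX|.
  have Hb := sup_bound GL2 JG HK (Gh j) Hh0.
  have L1 : L2norm Q (h j) <= Hh.
    by apply: (le_trans (cov_h_diag Lh0 Smax j)); rewrite HhE addrAC lerDr addr_ge0.
  have J1 : Jnorm J (h j) <= Hh.
    by apply: (le_trans (Jh_le j)); rewrite HhE ler_wpDl ?addr_ge0// ler_norm.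
  apply: (le_trans (Hb L1 J1 z)); rewrite BE addrAC subrr add0r ler_pM2r//.
  by rewrite KE ler_wpDr// ler_norm.
(* A function with L2 norm and [mu * J] at most [t] lands in [C] after multiplication by [mu / t];
   as [mu <= 1], [C] lies in the unit class and inherits its entropy bound. *)
pose C : set (Rvec R d -> R) := [set f | G f /\ L2norm Q f <= mu /\ Jnorm J f <= 1].
have CU : C `<=` unit_class Q G J.
  by move=> f [Gf [Lf Jf]]; split => //; split => //; apply: le_trans mu1.
have C0 : C (fun=> 0).
  by split => //; rewrite L2norm0 (Jnorm0 G0 JG); split; rewrite ?ltW.
have C_meas f : C f -> measurable_fun setT f by case=> Gf _; exact: G_meas GL2 _ Gf.
have C_bound f : C f -> forall t, `|f t| <= K.
  move=> /CU Uf t; apply: (le_trans (HK f Uf t)).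
  by rewrite KE ler_wpDr// ler_norm.
have C_var f : C f -> \int[Q]_x (f x.2 ^+ 2) <= mu ^+ 2.
  move=> [_ [Lf _]]; rewrite -L2norm_sqr lerXn2r ?nnegrE ?L2norm_ge0//.
  exact: ltW.
have nets s : exists (N : nat) (c : nat -> Rvec R d -> R),
    [/\ forall k, C (c k), N%:R <= expR (A * mu `^ (- m^-1) * rho ^+ s + 1) &
        forall f, C f -> exists2 k, (k < N)%N & forall z, `|f z - c k z| <= 2 * (mu / 2 ^+ s)].
  have u0 : 0 < mu / 2 ^+ s by rewrite divr_gt0// exprn_gt0.
  have [Nk [c [Cc Nle cov]]] := entropy_net C0 (le_trans (sup_entropyS _ _ CU) (ent _ u0)).
  exists Nk, c; split => //; apply: (le_trans Nle); rewrite ler_expR lerD2r.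
  (* Halving the radius multiplies the entropy bound by [2^(1/m) <= rho]. *)
  rewrite powR_half// mulrA; apply: ler_wpM2l => //.
  by rewrite lerXn2r ?nnegrE ?powR_ge0// (le_trans _ rho_b) ?powR_ge0.
have lawe' i (S : set R) : measurable S -> P (e i @^-1` S) = normal01 S by exact: lawe.
have KXn := normr_ge0 KX.
have evs := good_events n0 p0 mXZ me indep lawXZ lawe'
  (measurable_xtil hx mN) (xtil_bound xB KXn hB) (xtil_orth hx mN QN xB KXn hB)
  C_meas C_bound C_var B0 K0 ep0 ep13 c2_ge1 c2_K c2_B c2_B4 q0 q1 rho2 rhoq AE0 nets
  mu0 mu1 lam0 AE_le D_ge8 lam_ge'.
(* Almost surely no sample point falls in [N], and off [N] the truncated [xtil] is the true
   [x - h]. *)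
have evN i : whp P 0 (fun w => ~ N (XZ i w)).
  by apply: (whp_event (measurable_preimage (mXZ i) mN)); rewrite lawXZ// QN.
have [Ev [mEv PEv good]] := whp_and (whp_ord evN) evs.
exists Ev; split => //; split.
  rewrite -[X in P X]setCK probability_setC; last exact: measurableC.
  have Pfin : P (~` Ev) \is a fin_num by rewrite fin_num_measure//; exact: measurableC.
  rewrite -(fineK Pfin) -EFinB lee_fin.
  have : fine (P (~` Ev)) <= n%:R * 0 + (2 / p%:R + 6 * expR (- (rate c2 ep q * (n%:R * mu ^+ 2) / 4))).
    by rewrite -lee_fin fineK.
  have -> : n%:R * (Num.sqrt (rate c2 ep q) / 2) ^+ 2 * mu ^+ 2 = rate c2 ep q * (n%:R * mu ^+ 2) / 4.
    by rewrite exprMn sqr_sqrtr ?(ltW D0)//; field.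
  by move: (fine _) (2 / _) (expR _) => a b c; clear; rewrite mulr0; lra.
move=> w /good [{}evN [H1 H2 H3 H4 H5]] X Z Y bhat ghat [Ggh min].
have xE i j : xtil h N j (XZ i w) = X i ord0 j - h j (Z i).
  by rewrite /xtil xcutE.
have inC g t : G g -> 0 < t -> L2norm Q g <= t -> mu * Jnorm J g <= t ->
    C (fun z => mu / t * g z).
  by move=> Gg t0 Lg Jg; have [] := scale_in_ball GL2 JG mu0 t0 Gg Lg Jg.
have mepl : ep * lam <= 3 * ep * lam.
  by rewrite -mulrA ler_peMl ?mulr_ge0 ?ltW// ltr1n.
have D1 j : `|n%:R^-1 * (\sum_(i < n) e i w * (X i ord0 j - h j (Z i)))| <= 3 * ep * lam.
  apply: le_trans mepl; apply: le_trans (H1 j); rewrite /emp.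
  by under [in leRHS]eq_bigr do rewrite /= xE.
have D2 j k : `|n%:R^-1 * (\sum_(i < n) (X i ord0 j - h j (Z i)) * (X i ord0 k - h k (Z i)))
    - cov_tilde Q h j k| <= 3 * ep * lam.
  apply: le_trans mepl; rewrite (cov_tildeE hx mN QN).
  apply: le_trans (H2 j k); rewrite /emp.
  by under [in leRHS]eq_bigr do rewrite /= !xE.
have D3 g t : G g -> 0 < t -> L2norm Q g <= t -> mu * Jnorm J g <= t ->
    `|n%:R^-1 * (\sum_(i < n) e i w * g (Z i))| <= 3 * ep * mu * t.
  move=> Gg t0 Lg Jg; apply: (le_of_scaled mu0 t0).
  apply: le_trans (H3 _ (inC g t Gg t0 Lg Jg)); rewrite /emp; apply: le_of_eq.
  congr (`| _ |); rewrite !mulr_sumr; apply: eq_bigr => i _ /=.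
  by rewrite -/(Z i); ring.
have D4 g t j : G g -> 0 < t -> L2norm Q g <= t -> mu * Jnorm J g <= t ->
    `|n%:R^-1 * (\sum_(i < n) (X i ord0 j - h j (Z i)) * g (Z i))| <= 3 * ep * (lam + mu) * t.
  move=> Gg t0 Lg Jg; apply: (le_of_scaled mu0 t0).
  have -> : 3 * ep * (lam + mu) * mu = 3 * ep * mu * (lam + mu) by ring.
  apply: le_trans (H4 j _ (inC g t Gg t0 Lg Jg)); rewrite /emp; apply: le_of_eq.
  congr (`| _ |); rewrite !mulr_sumr; apply: eq_bigr => i _ /=.
  by rewrite xE -/(Z i); ring.
have D5 g t : G g -> 0 < t -> L2norm Q g <= t -> mu * Jnorm J g <= t ->
    `|n%:R^-1 * (\sum_(i < n) g (Z i) * g (Z i)) - L2norm Q g ^+ 2| <= 3 * ep * t ^+ 2.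
  move=> Gg t0 Lg Jg; have c0 : 0 < mu / t by rewrite divr_gt0.
  have := H5 _ (inC g t Gg t0 Lg Jg).
  have -> : emp XZ e (fun x => (mu / t * g x.1.2) ^+ 2) w - \int[Q]_x ((mu / t * g x.2) ^+ 2) =
     (mu / t) ^+ 2 * (n%:R^-1 * (\sum_(i < n) g (Z i) * g (Z i)) - L2norm Q g ^+ 2).
    rewrite mulrBr; congr (_ - _).
      by rewrite /emp !mulr_sumr; apply: eq_bigr => i _ /=; rewrite -/(Z i); ring.
    by rewrite -(L2norm_sqr Q (fun z => mu / t * g z)) (L2normZ GL2)// (gtr0_norm c0) exprMn.
  rewrite normrM (gtr0_norm (exprn_gt0 2 c0)) -ler_pdivlMl ?exprn_gt0// => H.
  apply: (le_trans H); apply: le_of_eq.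
  by field; rewrite !gt_eqF.
have := deterministic_bound G0 Glin JG (L2norm_ge0 Q) Gg0 Gh Jh_le Jh0 lam0 mu0 Rad0 LX0
  d0E ep3 mu_le Rad_le lam_le s0_le (fun v => cov_tilde_ge v Smin) D1 D2 D3 D4 D5 Ggh min.
apply: le_trans; rewrite lerD2r; apply: le_of_eq.
by congr (_ * _); apply: eq_bigr => i _; rewrite expr2.
Qed.
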